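(* Let $f:\mathbb R^n\to\mathbb R$ be locally Lipschitz continuous and bounded from below, and let $\mathcal D_f:\mathbb R^n\rightrightarrows\mathbb R^n$ be a compact convex valued mapping with closed graph such that $f$ is a potential function that admits $\mathcal D_f$ as its conservative field and the set $\{f(x):0\in\mathcal D_f(x)\}$ has empty interior in $\mathbb R$ (i.e. its complement is dense in $\mathbb R$). Let $\{(x_k,m_k,v_k)\}$ be a sequence of random vectors in $\mathbb R^n\times\mathbb R^n\times\mathbb R^n$ generated by $$(x_{k+1},m_{k+1},v_{k+1})=(x_k,m_k,v_k)-\eta_k(d_{x,k},d_{m,k},d_{v,k})-\theta_k(\xi_{x,k},\xi_{m,k},\xi_{v,k}),$$ and suppose that: (1) $\alpha,\gamma\ge 0$ and $\varepsilon,\tau_1,\tau_2>0$; (2) $\sup_{k\ge0}\ \|x_k\|+\|m_k\|+\|v_k\|<+\infty$ almost surely; (3) $\mathcal U:\mathbb R^n\times\mathbb R^n\times\mathbb R^n\rightrightarrows\mathbb R^n$ is locally bounded, convex compact valued, with closed graph, and there is a constant $\kappa\ge0$ such that $\widetilde{\mathrm{sign}}(v)\odot\mathcal U(x,m,v)\ge\kappa|v|\ge0$ for all $x,m,v\in\mathbb R^n$; (4) there is a positive sequence of real numbers $\{\delta_k\}$ with $\lim_{k\to+\infty}\delta_k=0$ and $(d_{x,k},d_{m,k},d_{v,k})\in\mathcal G^{\delta_k}(x_k,m_k,v_k)$ for all $k$, where $\mathcal G$ is the mapping built from $\mathcal D_f,\mathcal U,\alpha,\gamma,\varepsilon,\tau_1,\tau_2$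 as defined in the context; (5) $\{(\xi_{x,k},\xi_{m,k},\xi_{v,k})\}$ is a uniformly bounded martingale difference sequence with respect to a filtration $\{\mathcal F_k\}$, i.e. it is adapted, $\mathbb E[(\xi_{x,k},\xi_{m,k},\xi_{v,k})\mid\mathcal F_{k-1}]=0$ almost surely for every $k\ge1$, and there is a constant $M$ such that almost surely $\sup_{k\ge0}\|(\xi_{x,k},\xi_{m,k},\xi_{v,k})\|\le M$; (6) the stepsizes $\{\eta_k\},\{\theta_k\}$ are positive real sequences with $\sum_{k=0}^{+\infty}\eta_k=+\infty$, $\sum_{k=0}^{+\infty}\theta_k=+\infty$, $\lim_{k\to+\infty}\eta_k\log(k)=0$ and $\lim_{k\to+\infty}\frac{\theta_k^2}{\eta_k}\log(k)=0$. Suppose moreover that $(1-\kappa)\gamma\tau_2\le2\tau_1$. Then almost surely, any cluster point of $\{x_k\}$ lies in $\{x\in\mathbb R^n:0\in\mathcal D_f(x)\}$, and the sequence $\{f(x_k)\}$ converges.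
   Context: Notation. For vectors, $\odot$, $|\cdot|$, powers, and addition of a scalar are entrywise. $\widetilde{\mathrm{sign}}(v)$ has $i$-th entry $-1,0,1$ according to $v_i<0$, $v_i=0$, $v_i>0$. For $y\in\mathbb R^n$ and a set $\mathcal X\subset\mathbb R^n$, $y\odot\mathcal X=\{y\odot x:x\in\mathcal X\}$; an inequality between a set and a vector means the entrywise inequality for every element of the set. Conservative fields. A set-valued mapping $\mathcal D:\mathbb R^n\rightrightarrows\mathbb R^n$ is a conservative field if it has closed graph, nonempty compact values, and $\int_0^1\max_{v\in\mathcal D(\gamma(t))}\langle\gamma'(t),v\rangle\,dt=0$ for every absolutely continuous curve $\gamma:[0,1]\to\mathbb R^n$ with $\gamma(0)=\gamma(1)$. $f$ is a potential function admitting $\mathcal D$ as its conservative field if $f(x)=f(x_0)+\int_0^1\max_{v\in\mathcal D(\gamma(t))}\langle\gamma'(t),v\rangle\,dt$ for all $x_0,x$ and every absolutely continuous $\gamma$ with $\gamma(0)=x_0$, $\gamma(1)=x$. A set-valued mapping is locally bounded if each point has a neighborhood on which the union of its values is bounded. For a set-valued mapping $\mathcal D$ and $\delta\ge0$, $\mathcal D^{\delta}(x):=\{w:\exists z\in\mathbb B_\delta(x),\ \mathrm{dist}(w,\mathcal D(z))\le\delta\}$, with $\mathbb B_\delta(x)$ the ball of radius $\delta$ around $x$. The mapping $\mathcal G:\mathbb R^n\times\mathbb R^n\times\mathbb R^n\rightrightarrows\mathbb R^n\times\mathbb R^n\times\mathbb R^n$ is $$\mathcal G(x,m,v)=\Big\{\big((|v|+\varepsilon)^{-\gamma}\odot(m+\alpha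 d),\ \tau_1m-\tau_1d,\ \tau_2v-\tau_2u\big):d\in\mathcal D_f(x),\ u\in\mathcal U(x,m,v)\Big\}.$$ *)

(* Defs.v *)
From HB Require Import structures.
From mathcomp Require Import all_boot all_order all_algebra.
From mathcomp Require Import all_classical all_reals all_analysis.

Set Implicit Arguments.
Unset Strict Implicit.
Unset Printing Implicit Defensive.

Import Order.TTheory GRing.Theory Num.Theory.
Import numFieldNormedType.Exports.

Local Open Scope classical_set_scope.
Local Open Scope ring_scope.

Notation triple R n := ('rV[R]_n * 'rV[R]_n * 'rV[R]_n)%type.

Section Euclidean.
Context {R : realType} {n : nat}.

Definition dotv (u v : 'rV[R]_n) : R := \sum_(i < n) u 0 i * v 0 i.

(* The library norm on 'rV[R]_n is the sup norm (same topology and same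
   bounded sets); quantities that depend on the norm use the Euclidean one. *)
Definition enorm (u : 'rV[R]_n) : R := Num.sqrt (dotv u u).

Definition enorm3 (z : triple R n) : R :=
  Num.sqrt (enorm z.1.1 ^+ 2 + enorm z.1.2 ^+ 2 + enorm z.2 ^+ 2).

Definition odot (u v : 'rV[R]_n) : 'rV[R]_n := \row_i (u 0 i * v 0 i).

End Euclidean.

(* A set-valued mapping from V to W is a function V -> set W;
   its values may be empty unless stated otherwise. *)
Section SetValued.
Context {R : realType}.

Definition closed_graph (V W : topologicalType) (D : V -> set W) : Prop :=
  closed [set p : V * W | D p.1 p.2].

Definition locally_bounded (V : topologicalType) (W : normedModType R)
    (D : V -> set W) : Prop :=
  forall x : V, exists2 N, nbhs x N & bounded_set (\bigcup_(y in N) D y).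

(* Extended-real valued, so that the distance to the empty set is +oo. *)
Definition edist (V : zmodType) (nrm : V -> R) (w : V) (A : set V) : \bar R :=
  ereal_inf [set (nrm (w - y))%:E | y in A].

Definition expansion (V : zmodType) (nrm : V -> R) (D : V -> set V) (delta : R)
    (x : V) : set V :=
  [set w | exists2 z, nrm (z - x) <= delta
                    & (edist nrm w (D z) <= delta%:E)%E].

Definition locally_lipschitz (V W : normedModType R) (f : V -> W) : Prop :=
  forall x : V, exists2 N, nbhs x N & [lipschitz f y | y in N].

End SetValued.

Section Conservative.
Context {R : realType} {n : nat}.
Implicit Types (g : R -> 'rV[R]_n) (D : 'rV[R]_n -> set 'rV[R]_n).

(* Curves on [0, 1] are total functions on R; only the values on [0, 1]
   matter. *)
Definition abs_continuous g : Prop :=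
  forall e : R, 0 < e -> exists2 d : R, 0 < d &
    forall (k : nat) (a b : 'I_k -> R),
      (forall i, [&& 0 <= a i, a i <= b i & b i <= 1]) ->
      trivIset [set: 'I_k] (fun i => `]a i, b i[%classic) ->
      \sum_(i < k) (b i - a i) < d ->
      \sum_(i < k) enorm (g (b i) - g (a i)) < e.

(* The derivative of an absolutely continuous curve exists almost
   everywhere on [0, 1]; its junk values elsewhere (and at the endpoints) do
   not affect the integral. For nonempty compact values the supremum below is
   a maximum. The Lebesgue integral is extended-real valued, so equating it
   with a real number also says that it is finite. *)
Definition path_integral D g : \bar R :=
  (\int[lebesgue_measure]_(t in `[0%R, 1%R])
     (sup [set dotv (derive1 g t) v | v in D (g t)])%:E)%E.

Definition conservative_field D : Prop :=
  [/\ closed_graph D,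
      forall x, D x !=set0 /\ compact (D x)
    & forall g, abs_continuous g -> g 0 = g 1 -> path_integral D g = 0%E].

Definition is_potential (f : 'rV[R]_n -> R) D : Prop :=
  forall x0 x g, abs_continuous g -> g 0 = x0 -> g 1 = x ->
    (f x)%:E = ((f x0)%:E + path_integral D g)%E.

Definition adam_map (alpha gamma epsilon tau1 tau2 : R) (Df : 'rV[R]_n -> set 'rV[R]_n)
    (U : triple R n -> set 'rV[R]_n) (z : triple R n) : set (triple R n) :=
  let: (x, m, v) := z in
  [set w | exists d u, [/\ Df x d, U (x, m, v) u &
    w = (odot (map_mx (fun t => (`|t| + epsilon) `^ (- gamma)) v)
              (m + alpha *: d),
         tau1 *: m - tau1 *: d,
         tau2 *: v - tau2 *: u)]].

End Conservative.

Section Probability.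
Context {d : measure_display} {T : measurableType d} {R : realType} {n : nat}.
Variable P : probability T R.

(* Measurability of X : T -> R^n with respect to a sigma-algebra G on T; the
   Borel sigma-algebra of R^n is generated by the coordinates. *)
Definition vmeasurable (G : set (set T)) (X : T -> 'rV[R]_n) : Prop :=
  forall (i : 'I_n) (B : set R), measurable B ->
    G ((fun w => X w 0 i) @^-1` B).

Definition filtration (F : nat -> set (set T)) : Prop :=
  [/\ forall k, sigma_algebra [set: T] (F k),
      forall k, F k `<=` measurable
    & forall j k, (j <= k)%N -> F j `<=` F k].

(* Y is a version of the conditional expectation E[X | G]. *)
Definition is_cond_exp (G : set (set T)) (X Y : T -> R) : Prop :=
  [/\ P.-integrable [set: T] (EFin \o X),
      P.-integrable [set: T] (EFin \o Y),
      (forall B : set R, measurable B -> G (Y @^-1` B))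
    & forall A, G A ->
        (\int[P]_(w in A) (Y w)%:E = \int[P]_(w in A) (X w)%:E)%E].

Definition vcond_exp_eq0 (G : set (set T)) (X : T -> 'rV[R]_n) : Prop :=
  forall i : 'I_n, is_cond_exp G (fun w => X w 0 i) (fun=> 0).

Definition martingale_difference (F : nat -> set (set T))
    (X : nat -> T -> triple R n) : Prop :=
  (forall k, [/\ vmeasurable (F k) (fun w => (X k w).1.1),
                 vmeasurable (F k) (fun w => (X k w).1.2)
               & vmeasurable (F k) (fun w => (X k w).2)]) /\
  (forall k, (1 <= k)%N ->
     [/\ vcond_exp_eq0 (F k.-1) (fun w => (X k w).1.1),
         vcond_exp_eq0 (F k.-1) (fun w => (X k w).1.2)
       & vcond_exp_eq0 (F k.-1) (fun w => (X k w).2)]).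

End Probability.

(* Main.v *)
(* Let h(x, m, v) = f(x) + (1 / (2 tau1)) sum_i m_i^2 (|v_i| + epsilon)^(-gamma).
   The sign condition on U and (1 - kappa) gamma tau2 <= 2 tau1 make h a Lyapunov
   function of the differential inclusion p' in -G(p): along a solution h
   decreases, and it can fail to decrease over a time interval only if m = 0
   and 0 in Df(x) at the starting point. Measuring time by the partial sums of
   eta, windows of length at most 1 of the iterates starting at index s converge,
   along any free ultrafilter of starting indices s, to a solution of the inclusion,
   because the noise accumulated in such windows tends to 0 almost surely.
   If the bounded sequence h(z_k) had two limit values a < b, one could pick
   c1 in (a, b) that is not a critical value of f and c2 in (c1, b); on the windows
   given by the upcrossings of [c1, c2] the limit curve starts at level c1 and does not
   go below it, so it starts at a critical point of level c1, a contradiction.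
   Hence h(z_k) converges, every limit curve keeps h constant, and every limit
   point of (x_k, m_k) has m = 0 and 0 in Df(x).
   The noise estimate is a maximal inequality for the supermartingales
   exp (lambda S_b - 2 lambda^2 M^2 sum theta_i^2), with lambda of order log s,
   followed by Borel-Cantelli over s. *)
From HB Require Import structures.
Require Import Defs.
From mathcomp Require Import all_boot all_order all_algebra.
From mathcomp Require Import all_classical all_reals all_analysis.
From mathcomp Require Import measurable_realfun.
From mathcomp Require Import ring lra.

Set Implicit Arguments.
Unset Strict Implicit.
Unset Printing Implicit Defensive.

Import Order.TTheory GRing.Theory Num.Theory.
Import numFieldNormedType.Exports.

Local Open Scope classical_set_scope.
Local Open Scope ring_scope.

(** * Lipschitz curves and integration *)

(** The path integral of a conservative field contains a maximum over [D], so the potential identity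
    directly bounds an increment of f from below by any selection of [D]. Descent along a solution
    asks for the opposite bound; reversing time turns one into the other. No selection has to be
    measurable, because the rate is bounded below by a function built from m and the almost
    everywhere derivative of the quadratic term alone. Passing to limit curves requires upper
    semicontinuity of G, hence local boundedness of D_f. This is not a hypothesis and has to be
    derived from convexity, the closed graph and the Lipschitz potential. The scaling (|v_i| +
    epsilon)^(-gamma) may fail to be differentiable at v_i = 0. It is Lipschitz, so along a
    Lipschitz curve it is differentiable almost everywhere, and where v_i = 0 it is at its maximum,
    so that any derivative there is 0. *)

Lemma near_lipschitz_continuous (R : realType) (V W : normedModType R)
    (F : V -> W) (L : R) (N : set V) (p : V) : 0 <= L -> nbhs p N ->
  (forall q, N q -> `|F p - F q| <= L * `|p - q|) -> {for p, continuous F}.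
Proof.
move=> L0 nN FL; apply/cvgrPdist_le => e e0.
have L1 : 0 < L + 1 by rewrite ltr_wpDl.
near=> s; rewrite (le_trans (FL s _))//; first by near: s.
rewrite (@le_trans _ _ ((L + 1) * `|p - s|))//; first by rewrite ler_wpM2r// lerDl.
rewrite -ler_pdivlMl// mulrC; near: s.
by apply: cvgr_dist_le => //; rewrite divr_gt0.
Unshelve. all: by end_near. Qed.

Lemma lipschitz_continuous (R : realType) (V W : normedModType R) (F : V -> W)
    (L : R) :
  (forall s t, `|F s - F t| <= L * `|s - t|) -> continuous F.
Proof.
move=> FL t; apply: (@near_lipschitz_continuous R V W F `|L| setT t) => //.
  exact: filterT.
by move=> q _; rewrite (le_trans (FL _ _))// ler_wpM2r// ler_norm.
Qed.

Lemma cvg_sumr (R : realType) (T : Type) (F : set_system T) (n : nat)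
    (f : 'I_n -> T -> R) (l : 'I_n -> R) : Filter F ->
  (forall i, f i x @[x --> F] --> l i) ->
  \sum_(i < n) f i x @[x --> F] --> \sum_(i < n) l i.
Proof. by move=> FF fl; apply: cvg_big => //; exact: add_continuous. Qed.

Lemma lipschitz_derive_le (R : realType) (F : R -> R) (L t a : R) :
  (forall s t, `|F s - F t| <= L * `|s - t|) -> is_derive t 1 F a -> `|a| <= L.
Proof.
move=> FL [dF <-]; have /cvg_norm := dF.
rewrite -[lim _]/('D_1 F t) => cv.
rewrite -(cvg_lim _ cv)//; apply: limr_le; first exact: cvgP cv.
near=> h; have h0 : h != 0 by near: h; exact: nbhs_dnbhs_neq.
rewrite normrZ normfV ler_pdivrMl ?normr_gt0// mulrC.
by rewrite (le_trans (FL _ _))// addrK [h *: _]mulr1.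
Unshelve. all: by end_near. Qed.

Section lipschitz_ftc.
Context {R : realType}.
Notation mu := (@lebesgue_measure R).

(** The Stieltjes measures of [F] and [G] add up to [L] times Lebesgue measure, since both sides
    agree on half-open intervals; dropping the nonnegative contribution of [G] leaves the bound. *)
Lemma lipschitz_stieltjes_le (F G : cumulative R R) (L : R) : 0 <= L ->
  (forall t, F t + G t = L * t) ->
  forall A : set (measurableTypeR R), measurable A ->
    (lebesgue_stieltjes_measure F A <= L%:E * mu A)%E.
Proof.
move=> L0 FG A mA.
have FGnd : {homo (fun t : R => L * t) : x y / x <= y}.
  by move=> x y xy; rewrite ler_wpM2l.
have FGrc : right_continuous (fun t : R => L * t).
  by apply: right_continuousW => x; exact: mulrl_continuous.
pose FGc : cumulative R R :=
  HB.pack (fun t : R => L * t) (isCumulative.Build R _ R _ FGnd FGrc).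
have ocE (X : set R) : ocitv X -> forall H : cumulative R R,
    lebesgue_stieltjes_measure H X = wlength H X.
  by move=> oX H; rewrite /lebesgue_stieltjes_measure /measure_extension measurable_mu_extE.
have E1 : lebesgue_stieltjes_measure FGc A =
    measure_add (lebesgue_stieltjes_measure F) (lebesgue_stieltjes_measure G) A.
  apply: lebesgue_stieltjes_measure_unique => // X oX.
  transitivity (lebesgue_stieltjes_measure F X + lebesgue_stieltjes_measure G X)%E; last first.
    by rewrite -[RHS]/(measure_add (lebesgue_stieltjes_measure F) (lebesgue_stieltjes_measure G) X) measure_addE.
  rewrite (ocE _ oX FGc) (ocE _ oX F) (ocE _ oX G).
  case/ocitvP : oX => [->|[[a b] /= ab ->]]; first by rewrite !wlength0 adde0.
  by rewrite !wlength_itv_bnd ?ltW// -EFinD -!FG; congr (_%:E); lra.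
have E2 : lebesgue_stieltjes_measure FGc A = mscale (NngNum L0) mu A.
  apply: lebesgue_stieltjes_measure_unique => // X oX.
  transitivity (L%:E * lebesgue_stieltjes_measure idfun X)%E => //.
  rewrite (ocE _ oX FGc) (ocE _ oX idfun).
  case/ocitvP : oX => [->|[[a b] /= ab ->]]; first by rewrite !wlength0 mule0.
  by rewrite !wlength_itv_bnd ?ltW// -EFinM; congr (_%:E) => /=; lra.
rewrite [leRHS](_ : _ = mscale (NngNum L0) mu A)// -E2 E1 measure_addE.
by rewrite leeDl.
Qed.

(* [F t + L * t] is nondecreasing and its Stieltjes measure is dominated by a
   multiple of Lebesgue measure: [w] is the Radon-Nikodym density minus [L]. *)
Lemma lipschitz_ftc (F : R -> R) (L : R) : 0 < L ->
  (forall s t, `|F s - F t| <= L * `|s - t|) ->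
  exists w : R -> R, [/\ measurable_fun [set: R] w,
    (forall t, `|w t| <= L),
    {ae mu, forall t : R, 0 < t < 1 -> is_derive t 1 F (w t)} &
    (\int[mu]_(t in `[0%R, 1%R]) (w t)%:E)%E = (F 1 - F 0)%:E].
Proof.
move=> L0 FL.
have cF := @lipschitz_continuous R R^o R^o F L FL.
have FLn x y : x <= y -> `|F x - F y| <= L * (y - x).
  by move=> xy; rewrite (le_trans (FL _ _))// distrC ger0_norm// subr_ge0.
have Hnd : {homo (fun t : R => F t + L * t) : x y / x <= y}.
  by move=> x y /FLn; rewrite ler_norml => /andP[_]; lra.
have Hc : continuous (fun t : R => F t + L * t).
  by move=> t; apply: cvgD; [exact: cF|exact: mulrl_continuous].
pose H : cumulative R R :=
  HB.pack (fun t : R => F t + L * t)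
    (isCumulative.Build R _ R _ Hnd (right_continuousW Hc)).
have Gnd : {homo (fun t : R => L * t - F t) : x y / x <= y}.
  by move=> x y /FLn; rewrite ler_norml => /andP[+ _]; lra.
have Gc : continuous (fun t : R => L * t - F t).
  by move=> t; apply: cvgB; [exact: mulrl_continuous|exact: cF].
pose G : cumulative R R :=
  HB.pack (fun t : R => L * t - F t)
    (isCumulative.Build R _ R _ Gnd (right_continuousW Gc)).
(* [G] serves only as the nondecreasing complement that makes the sum linear. *)
have HG t : H t + G t = (L + L) * t by rewrite /=; lra.
have LL0 : 0 <= L + L by rewrite addr_ge0// ltW.
have HL := lipschitz_stieltjes_le LL0 HG.
have HE a b : a <= b -> lebesgue_stieltjes_measure H `]a, b]%classic = (H b - H a)%:E.
  move=> ab; rewrite /lebesgue_stieltjes_measure /measure_extension.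
  rewrite measurable_mu_extE; last exact: is_ocitv.
  exact: (wlength_itv_bnd H false false ab).
(* Restriction to []0, 1]] makes the Stieltjes measure finite before its Radon-Nikodym derivative is
   taken. *)
have mI : measurable (`]0, 1]%classic : set (measurableTypeR R)) by exact: measurable_itv.
have fI : (lebesgue_stieltjes_measure H `]0%R, 1%R]%classic < +oo)%E.
  by rewrite HE// ltry.
pose nu := mfrestr mI fI.
have numu : nu `<< mu.
  apply/null_content_dominatesP => A mA A0.
  apply/eqP; rewrite eq_le measure_ge0 andbT /nu /mfrestr /mrestr.
  have mAI := measurableI _ _ mA mI.
  rewrite (le_trans (HL _ mAI))// -(mule0 (L + L)%:E) lee_pmul2l//; last by rewrite lte_fin addr_gt0.
  by rewrite -A0 le_measure ?inE.
pose f := Radon_Nikodym_SigmaFinite.f nu mu.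
pose g : R -> R := fun t => fine (f t).
have gE : EFin \o g = f.
  by apply/funext => t; rewrite /g /= fineK//; exact: Radon_Nikodym_SigmaFinite.f_fin_num.
have ig : mu.-integrable [set: R] (fun t => (g t)%:E).
  by rewrite (_ : (fun t => _) = f); [exact: Radon_Nikodym_SigmaFinite.f_integrable|rewrite -gE].
have mg : measurable_fun [set: R] g by apply/measurable_EFinP; exact: (measurable_int mu ig).
have gint (t : R) : 0 <= t <= 1 -> (\int[mu]_(s in `]0%R, t]) (g s)%:E)%E = (H t - H 0)%:E.
  move=> /andP[t0 t1].
  have -> : (fun s => (g s)%:E) = f by rewrite -gE.
  rewrite -Radon_Nikodym_SigmaFinite.f_integral//.
  rewrite -[LHS]/(lebesgue_stieltjes_measure H (`]0, t]%classic `&` `]0, 1]%classic)).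
  rewrite (_ : _ `&` _ = `]0, t]%classic) ?HE//.
  apply/seteqP; split => s /=; rewrite !in_itv/=; first by move=> [].
  by move=> /andP[-> st]; rewrite st (le_trans st).
have lg : locally_integrable [set: R] g.
  by apply: open_integrable_locally; [exact: openT|exact: ig].
have igS (A : set R) : measurable A -> mu.-integrable A (EFin \o g).
  by move=> mA; exact: integrableS ig.
have aeF : Filter (nbhs (almost_everywhere mu)) := ae_filter_ringOfSetsType mu.
have dg : {ae mu, forall t : R, 0 < t < 1 -> is_derive t 1 F (g t - L)}.
  have := @FTC1 _ g (BRight 0) (fun y => igS _ (measurable_itv _)) lg.
  apply: filterS => t Ht /andP[t0 t1]; have {Ht} := Ht t0.
  move=> [dG GE].
  have dH : is_derive t 1 (H : R -> R) (g t).
    have : is_derive t 1 (fun x => H 0 + \int[mu]_(t0 in `]0, x]) g t0) (g t).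
      rewrite -[g t]add0r; apply: is_deriveD.
      by apply: (DeriveDef dG); rewrite -derive1E; exact: GE.
    apply: near_eq_is_derive.
      near=> s.
      rewrite /Rintegral gint.
        by rewrite /= addrC subrK.
      by apply/andP; split; apply: ltW; near: s; [exact: lt_nbhsr|exact: lt_nbhsl].
  have -> : F = (fun x => H x - L * x) by apply/funext => x /=; lra.
  rewrite -[X in _ - X]mulr1; apply: is_deriveB.
(* The density is bounded by [L] only where it is the derivative of [F]; truncation makes the bound
   hold everywhere and changes nothing at those points. *)
pose w t := Num.max (- L) (Num.min L (g t - L)).
have wL t : `|w t| <= L.
  rewrite /w ler_norml le_max lexx/= ge_max ge_min lexx/= andbT.
  by rewrite -subr_ge0 opprK.
have dw : {ae mu, forall t : R, 0 < t < 1 -> w t = g t - L}.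
  apply: filterS dg => t /[apply] dF.
  have : `|g t - L| <= L by exact: lipschitz_derive_le FL dF.
  by rewrite /w ler_norml => /andP[a b]; rewrite min_r// max_r.
have mw : measurable_fun [set: R] w.
  apply: measurable_maxr => //; apply: measurable_minr => //.
  exact: measurable_funB.
exists w; split => //.
  by apply: filterS2 dg dw => t d1 d2 t01; rewrite d2//; exact: d1.
rewrite -integral_itv_obnd_cbnd; last exact/measurable_EFinP/measurable_funTS.
rewrite -integral_itv_bndo_bndc; last exact/measurable_EFinP/measurable_funTS.
have mgL : measurable_fun [set: R] (fun t => g t - L) by exact: measurable_funB.
transitivity (\int[mu]_(t in `]0%R, 1%R[) (g t - L)%:E)%E.
  apply: (@ae_eq_integral _ (measurableTypeR R) R mu) => //.
  - exact/measurable_EFinP/measurable_funTS.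
  - exact/measurable_EFinP/measurable_funTS.
  - by apply: filterS dw => t wg; rewrite /= in_itv/= => /wg ->.
rewrite integral_itv_bndo_bndc; last exact/measurable_EFinP/measurable_funTS.
under eq_integral do rewrite EFinB.
rewrite integralB//=; last 2 first.
- exact: igS.
- by apply: measurable_bounded_integrable => //; [rewrite /= lebesgue_measure_itv/= lte_fin ltr01 oppr0 adde0 ltry|exact: bounded_cst].
rewrite gint ?ler01 ?lexx//= integral_cst//= lebesgue_measure_itv/= lte_fin ltr01.
by rewrite oppr0 adde0 mule1 -EFinB; congr (_%:E); rewrite /=; lra.
Unshelve. all: by end_near. Qed.
End lipschitz_ftc.

Import HBNNSimple.

(* The integrand of [path_integral] is a supremum whose measurability is never
   established; monotonicity of the integral does not need it. *)
Section integral_monotone_nonmeasurable.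
Local Open Scope ereal_scope.
Context d (T : measurableType d) (R : realType) (mu : {measure set T -> \bar R}).

Lemma ge0_ae_le_integral_nonmeasurable (f g : T -> \bar R) :
  (forall x, 0 <= f x) -> (forall x, 0 <= g x) ->
  {ae mu, forall x, f x <= g x} -> \int[mu]_x f x <= \int[mu]_x g x.
Proof.
move=> f0 g0 [N [mN N0 fgN]]; rewrite !ge0_integralTE//.
apply: ge_ereal_sup => _ [h hf <-].
(* Setting the simple function [h] to 0 on the exceptional null set keeps its integral and puts it
   below [g] everywhere. *)
pose h' : {nnsfun T >-> R} := mul_nnsfun h (indic_nnsfun R (measurableC mN)).
have h'E x : h' x = (h x * \1_(~` N) x)%R by [].
apply: (@le_trans _ _ (sintegral mu h')); last first.
  apply: ereal_sup_ubound; exists h' => // x.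
  rewrite h'E indicE; have [xN|xN] := boolP (x \in ~` N).
    rewrite mulr1 (le_trans (hf x))//.
    by apply: contrapT => nfg; move: xN; rewrite inE; apply; exact: fgN.
  by rewrite mulr0.
rewrite -!integralT_nnsfun le_eqVlt; apply/orP; left; apply/eqP.
apply: ae_eq_integral => //.
  exact/measurable_EFinP.
  exact/measurable_EFinP.
exists N; split => // x /= /not_implyP[_] hh'.
apply: contrapT => xN; apply: hh'.
by rewrite /= -[mindic _ _ x]/(\1_(~` N) x) indicE mem_set// mulr1.
Qed.

Lemma ae_le_integral_nonmeasurable (D : set T) (f g : T -> \bar R) :
  {ae mu, forall x, D x -> f x <= g x} ->
  \int[mu]_(x in D) f x <= \int[mu]_(x in D) g x.
Proof.
move=> fg.
have fgD : {ae mu, forall x, (f \_ D) x <= (g \_ D) x}.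
  apply: filterS fg => x; rewrite !patchE.
  by case: ifPn => // xD; apply; rewrite inE in xD.
rewrite (integral_mkcond D f) (integral_mkcond D g) (integralE _ _ (f \_ D)) (integralE _ _ (g \_ D)).
apply: leeB; apply: ge0_ae_le_integral_nonmeasurable => //.
  by apply: filterS fgD => x fgx; rewrite !funeposE; exact: le_max2.
by apply: filterS fgD => x fgx; rewrite !funenegE; apply: le_max2 => //; rewrite leeN2.
Qed.

End integral_monotone_nonmeasurable.

(** * Set-valued mappings and conservative fields *)

(** Baire's theorem is applied to row vectors below, which calls for a complete normed space. *)
HB.instance Definition _ (R : realType) (m n : nat) := Complete.on 'M[R]_(m, n).

Section set_valued.

Lemma convex_setP (R : realType) (M : lmodType R) (A : set M) (x y : M) (t : R) :
  convex_set A -> A x -> A y -> 0 <= t <= 1 -> A (t *: x + (1 - t) *: y).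
Proof.
move=> cA Ax Ay t01.
have it : Itv.spec (@Itv.num_sem R) (Itv.Real `[0%Z, 1%Z]) t.
  by rewrite /= /Itv.num_sem/= in_itv/= num_real.
by have /set_mem := cA x y (Itv.mk it) (mem_set Ax) (mem_set Ay).
Qed.

(** A tube argument: the complement of the graph is open, and compactness of [K] makes the
    neighbourhood of [p] uniform in [w]. *)
Lemma closed_graph_near_disjoint (V W : topologicalType) (D : V -> set W)
    (K : set W) (p : V) :
  closed_graph D -> compact K -> (forall w, K w -> ~ D p w) ->
  \forall q \near p, forall w, K w -> ~ D q w.
Proof.
move=> cD /compact_near_coveringP cK KD.
apply: (cK V (nbhs p) (fun q w => ~ D q w)) => w Kw.
have oD : open (~` [set p : V * W | D p.1 p.2]) by rewrite openC.
have : nbhs (p, w) (~` [set p : V * W | D p.1 p.2]).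
  by apply: open_nbhs_nbhs; split => //=; exact: KD.
case=> -[A B] /= [nA nB] AB; exists (B, A) => // -[w' q] /= [Bw Aq].
exact: (AB (q, w')).
Qed.

(** What is left of [K] outside the open [e]-neighbourhood of [D p] is compact and misses [D p], so
    nearby values miss it too. *)
Lemma closed_graph_usc (R : realType) (V : topologicalType) (W : normedModType R)
    (D : V -> set W) (K : set W) (p : V) (e : R) :
  closed_graph D -> compact K -> (\forall q \near p, D q `<=` K) -> 0 < e ->
  \forall q \near p, forall w, D q w -> exists2 u, D p u & `|w - u| < e.
Proof.
move=> cD cK DK e0.
pose B := \bigcup_(u in D p) ball u e.
have oB : open B by apply: bigcup_open => u _; exact: ball_open.
have cKB : compact (K `&` ~` B).
  by apply: compact_closedI => //; rewrite closedC.
have KBD w : (K `&` ~` B) w -> ~ D p w.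
  by move=> [_ Bw] Dw; apply: Bw; exists w => //; exact: ballxx.
apply: filterS2 DK (closed_graph_near_disjoint cD cKB KBD) => q DK KB w Dw.
have /contrapT[u Du] : ~ ~ B w by move=> Bw; exact: (KB w (conj (DK _ Dw) Bw) Dw).
by rewrite -ball_normE /= => uw; exists u => //; rewrite distrC.
Qed.

(** If a nearby value contained both a short vector and a very long one, convexity would put a point
    of it into a compact shell around the ball that contains [D p]. The shell misses [D p], hence
    also all nearby values. *)
Lemma convex_locally_bounded (R : realType) (V : topologicalType) n
    (D : V -> set 'rV[R]_n) (p : V) (N : R) :
  closed_graph D -> (forall q, convex_set (D q)) -> compact (D p) ->
  (\forall q \near p, exists2 w, D q w & `|w| <= N) ->
  exists M, \forall q \near p, forall w, D q w -> `|w| <= M.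
Proof.
move=> cD vD kD DN.
have [M [MN DM]] : exists M : R, N <= M /\ forall w, D p w -> `|w| <= M.
  have [M0 [_ HM0]] := compact_bounded kD.
  exists (Num.max N (M0 + 1)); split; first by rewrite le_max lexx.
  by move=> w Dw; rewrite le_max (HM0 (M0 + 1)) ?orbT// ltrDl.
have [M0|M0] := ltP M 0.
  exists M; apply: filterS DN => q [w Dw wN] u.
  by have := le_lt_trans (le_trans wN MN) M0; rewrite normr_lt0.
pose K := [set w : 'rV[R]_n | M + 1 <= `|w| <= 3 * M + 1].
have cK : compact K.
  apply: bounded_closed_compact.
    exists (3 * M + 1); split; first exact: num_real.
    by move=> x Mx w /andP[_ /le_trans]; apply; exact: ltW.
  have -> : K = (fun w : 'rV[R]_n => `|w|) @^-1` `[M + 1, 3 * M + 1]%classic.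
    by apply/seteqP; split => w /=; rewrite in_itv.
  by apply: closed_comp => [w _|]; [exact: norm_continuous|exact: itv_closed].
have KD w : K w -> ~ D p w.
  by move=> /andP[+ _] /DM wM; rewrite leNgt ltr_pwDr.
exists (3 * M + 1).
apply: filterS2 DN (closed_graph_near_disjoint cD cK KD) => q [w Dw wN] KDq v Dv.
rewrite leNgt; apply/negP => Mv.
have wM : `|w| <= M by exact: le_trans wN MN.
have vw : 2 * M + 1 <= `|v - w|.
  rewrite (@le_trans _ _ (`|v| - `|w|))//; last exact: lerB_dist.
  lra.
(* The point at distance [2 * M + 1] from [w] on the way to [v]: since [w] has norm at most [M], its
   norm lies between [M + 1] and [3 * M + 1]. *)
pose t := (2 * M + 1) / `|v - w|.
have vw0 : 0 < `|v - w| by lra.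
have t01 : 0 <= t <= 1.
  by rewrite /t divr_ge0 ?ler_pdivrMr ?mul1r//; lra.
apply: (KDq (t *: v + (1 - t) *: w)); last by apply: convex_setP.
have -> : t *: v + (1 - t) *: w = w + t *: (v - w).
  by rewrite scalerBl scale1r scalerBr [in RHS]addrCA.
have tn : `|t *: (v - w)| = 2 * M + 1.
  have /andP[t0 _] := t01.
  by rewrite normrZ ger0_norm// /t divfK// gt_eqF.
have := lerB_normD (t *: (v - w)) w; have := ler_normD w (t *: (v - w)).
rewrite tn addrC => H1 H2; apply/andP; split.
  by apply: (le_trans _ H2); lra.
by apply: (le_trans H1); lra.
Qed.

End set_valued.

(** * Sup norm and Euclidean inner product on row vectors *)

Section row_vectors.
Context {R : realType} {n : nat}.
Implicit Types u v w : 'rV[R]_n.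

Lemma ler_coord_norm u i : `|u 0 i| <= `|u|.
Proof.
rewrite [leRHS]/Num.Def.normr/= mx_normrE.
exact: (le_bigmax_cond 0 (fun ij : 'I_1 * 'I_n => `|u ij.1 ij.2|) (j := (0, i))).
Qed.

Lemma rV_norm_le u (c : R) : 0 <= c -> (forall i, `|u 0 i| <= c) -> `|u| <= c.
Proof.
move=> c0 uc; rewrite [leLHS]/Num.Def.normr/= mx_normrE; apply/bigmax_leP; split => //.
by move=> [i j] _ /=; rewrite (ord1 i).
Qed.

Lemma dotvC u v : dotv u v = dotv v u.
Proof. by apply: eq_bigr => i _; rewrite mulrC. Qed.

Lemma dotvDl u v w : dotv (u + v) w = dotv u w + dotv v w.
Proof. by rewrite /dotv -big_split; apply: eq_bigr => i _; rewrite mxE mulrDl. Qed.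

Lemma dotvZl (a : R) u v : dotv (a *: u) v = a * dotv u v.
Proof. by rewrite /dotv mulr_sumr; apply: eq_bigr => i _; rewrite mxE mulrA. Qed.

Lemma dotvNl u v : dotv (- u) v = - dotv u v.
Proof. by rewrite -scaleN1r dotvZl mulN1r. Qed.

Lemma dotvDr u v w : dotv u (v + w) = dotv u v + dotv u w.
Proof. by rewrite dotvC dotvDl !(dotvC _ u). Qed.

Lemma dotvZr (a : R) u v : dotv u (a *: v) = a * dotv u v.
Proof. by rewrite dotvC dotvZl dotvC. Qed.

Lemma dotvNr u v : dotv u (- v) = - dotv u v.
Proof. by rewrite dotvC dotvNl dotvC. Qed.

Lemma dotvv_ge0 u : 0 <= dotv u u.
Proof. by apply: sumr_ge0 => i _; rewrite -expr2 sqr_ge0. Qed.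

Lemma ler_norm_dotv u v : `|dotv u v| <= n%:R * (`|u| * `|v|).
Proof.
rewrite (le_trans (ler_norm_sum _ _ _))//.
rewrite (@le_trans _ _ (\sum_(i < n) `|u| * `|v|))//.
  by apply: ler_sum => i _; rewrite normrM ler_pM// ler_coord_norm.
by rewrite sumr_const card_ord mulr_natl.
Qed.

Lemma compact_ball_rV (c : R) : compact [set u : 'rV[R]_n | `|u| <= c].
Proof.
apply: bounded_closed_compact.
  exists c; split; first exact: num_real.
  by move=> x cx w /le_trans; apply; exact: ltW.
by apply: (@preimage_closed _ _ (fun w : 'rV[R]_n => `|w|) [set x | x <= c]) => [w _|];
  [exact: norm_continuous|exact: closed_le].
Qed.

Lemma coord_continuous i : continuous (fun u => u 0 i : R^o).
Proof.
apply: (@lipschitz_continuous R _ R^o _ 1) => s t.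
by rewrite mul1r; have := ler_coord_norm (s - t) i; rewrite !mxE.
Qed.

Lemma ler_sqr_norm_dotv u : `|u| ^+ 2 <= dotv u u.
Proof.
have h : 0 <= Num.sqrt (dotv u u) by exact: sqrtr_ge0.
rewrite -[leRHS]sqr_sqrtr ?dotvv_ge0// ler_sqr ?nnegrE//.
apply: rV_norm_le => // i.
rewrite -sqrtr_sqr ler_wsqrtr// /dotv (bigD1 i)//= -expr2 lerDl.
by apply: sumr_ge0 => j _; rewrite -expr2 sqr_ge0.
Qed.

Lemma ler_enorm u : enorm u <= n%:R * `|u|.
Proof.
rewrite /enorm -[leRHS]ger0_norm ?mulr_ge0// -sqrtr_sqr ler_wsqrtr//.
rewrite (le_trans (ler_norm _))// (le_trans (ler_norm_dotv _ _))//.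
rewrite exprMn -[X in n%:R * X]expr2 ler_wpM2r// ?sqr_ge0// -natrX ler_nat.
by case: (n) => // k; rewrite -{1}(expn1 k.+1) leq_pexp2l.
Qed.

Lemma ler_norm_enorm u : `|u| <= enorm u.
Proof.
by rewrite -[leLHS]ger0_norm// -sqrtr_sqr ler_wsqrtr// ler_sqr_norm_dotv.
Qed.

Lemma le_sup_dotv (A : set 'rV[R]_n) u v : compact A -> A v ->
  dotv u v <= sup [set dotv u w | w in A].
Proof.
move=> cA Av; apply: ub_le_sup; last by exists v.
have [M [_ HM]] := compact_bounded cA.
exists (n%:R * (`|u| * (M + 1))) => _ [w Aw <-].
rewrite (le_trans (ler_norm _))// (le_trans (ler_norm_dotv _ _))//.
by rewrite ler_wpM2l// ler_wpM2l// (HM (M + 1))// ltrDl.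
Qed.

Lemma lipschitz_abs_continuous (g : R -> 'rV[R]_n) (C : R) :
  (forall s t, `|g s - g t| <= C * `|s - t|) -> abs_continuous g.
Proof.
move=> gC e e0.
have C0 : 0 < n%:R * `|C| + 1 by rewrite ltr_wpDl// mulr_ge0.
exists (e / (n%:R * `|C| + 1)); first by rewrite divr_gt0.
move=> k a b ab _ abd.
apply: (@le_lt_trans _ _ ((n%:R * `|C| + 1) * \sum_(i < k) (b i - a i))); last first.
  by rewrite -ltr_pdivlMl// mulrC.
rewrite mulr_sumr; apply: ler_sum => i _.
have /and3P[_ abi _] := ab i.
have abi0 : 0 <= b i - a i by rewrite subr_ge0.
rewrite (le_trans (ler_enorm _))// mulrDl mul1r ler_wpDr// -mulrA ler_wpM2l//.
rewrite (le_trans (gC _ _))// (ger0_norm abi0) ler_wpM2r//; exact: ler_norm.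
Qed.

End row_vectors.

(** * Potential functions and local boundedness of their conservative fields *)

Section potential_bounds.
Context {R : realType} {n : nat}.
Variables (f : 'rV[R]_n -> R) (D : 'rV[R]_n -> set 'rV[R]_n).
Hypotheses (fD : is_potential f D) (D_compact : forall x, compact (D x))
  (D0 : forall x, D x !=set0).

Lemma potential_segment_ge (p e : 'rV[R]_n) (c : R) :
  (forall t, 0 <= t <= 1 -> forall v, D (p + t *: e) v -> c <= dotv e v) ->
  c <= f (p + e) - f p.
Proof.
move=> cD; pose g (t : R) : 'rV[R]_n := p + t *: e.
have gL s t : `|g s - g t| <= `|e| * `|s - t|.
  by rewrite /g opprD addrACA subrr add0r -scalerBl normrZ mulrC.
have g0 : g 0 = p by rewrite /g scale0r addr0.
have g1 : g 1 = p + e by rewrite /g scale1r.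
have := fD (lipschitz_abs_continuous gL) g0 g1.
have dg t : derive1 g t = e.
  rewrite /derive1; apply: cvg_lim => //; apply: cvg_near_cst.
  near=> h; rewrite /g opprD addrACA subrr add0r -scalerBl addrK scalerA mulVf ?scale1r//.
  by near: h; exact: nbhs_dnbhs_neq.
have cI : (c%:E <= path_integral D g)%E.
  have -> : c%:E = (\int[@lebesgue_measure R]_(t in `[0%R, 1%R]) c%:E)%E.
    by rewrite integral_cst//= lebesgue_measure_itv/= lte_fin ltr01 oppr0 adde0 mule1.
  apply: ae_le_integral_nonmeasurable; apply: nearW => t /=; rewrite in_itv/= => t01.
  rewrite lee_fin dg; have [v Dv] := D0 (g t).
  by rewrite (le_trans (cD _ t01 _ Dv))//; exact: le_sup_dotv.
(* Infinite path integrals are incompatible with the finite values of [f] at the two ends. *)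
move: cI; case: path_integral => [r| |] //=; rewrite lee_fin => cr.
by rewrite -EFinD => -[->]; rewrite addrAC subrr add0r.
Unshelve. all: by end_near. Qed.

End potential_bounds.

Section conservative_locally_bounded.
Context {R : realType} {n : nat}.
Variables (f : 'rV[R]_n -> R) (D : 'rV[R]_n -> set 'rV[R]_n).
Hypotheses (f_lip : locally_lipschitz f) (fD : is_potential f D)
  (D_closed : closed_graph D) (D_compact : forall x, compact (D x))
  (D_convex : forall x, convex_set (D x)) (D0 : forall x, D x !=set0).

Lemma locally_lipschitz_near (p : 'rV[R]_n) :
  exists2 L, 0 <= L & exists2 N, nbhs p N &
    forall q r, N q -> N r -> `|f q - f r| <= L * `|q - r|.
Proof.
have [N nN [M [_ HM]]] := f_lip p.
exists (`|M| + 1); first by rewrite addr_ge0.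
exists N => // q r Nq Nr.
by apply: (HM (`|M| + 1) _ (q, r)) => //; rewrite ltr_pwDr// ler_norm.
Qed.

Lemma locally_lipschitz_continuous : continuous f.
Proof.
move=> p; have [L L0 [N nN HL]] := locally_lipschitz_near p.
apply: (@near_lipschitz_continuous R _ R^o f L N p L0 nN) => q Nq.
by apply: HL => //; exact: nbhs_singleton.
Qed.

(** [v0] is the Euclidean projection of 0 on [A]: a step [t] from [v0] towards [v] changes the
    squared norm by [t * (2 * a + t * b)], which would be negative for small [t] if [a] were. *)
Lemma convex_min_dotv (A : set 'rV[R]_n) : compact A -> convex_set A -> A !=set0 ->
  exists2 v0, A v0 & forall v, A v -> dotv v0 v0 <= dotv v0 v.
Proof.
move=> kA cA A0.
have cq : continuous (fun v : 'rV[R]_n => dotv v v).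
  move=> v; rewrite /dotv; apply: (@cvg_sumr _ _ (nbhs v)) => i.
  by apply: cvgM; exact: coord_continuous.
have [v0 /set_mem Av0 min0] := compact_EVT_min A0 kA (continuous_subspaceT cq).
exists v0 => // v Av; rewrite leNgt; apply/negP => lt0.
pose a := dotv v0 (v - v0); pose b := dotv (v - v0) (v - v0).
have a0 : a < 0 by rewrite /a dotvDr dotvNr subr_lt0.
have b0 : 0 <= b := dotvv_ge0 _.
(* Small enough for [t * b <= - a], so that [2 * a + t * b <= a < 0]. *)
pose t := Num.min 1 (- a / (b + 1)).
have b1 : 0 < b + 1 by rewrite ltr_wpDl.
have t0 : 0 < t by rewrite /t lt_min ltr01 divr_gt0// oppr_gt0.
have tb : t * b <= - a.
  rewrite (@le_trans _ _ (- a / (b + 1) * b))//.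
    by rewrite ler_wpM2r// /t ge_min lexx orbT.
  by rewrite mulrAC ler_pdivrMr// ler_wpM2l// ?lerDl// oppr_ge0 ltW.
have t01 : 0 <= t <= 1 by rewrite (ltW t0) /t ge_min lexx.
have := min0 _ (mem_set (convex_setP cA Av Av0 t01)).
have -> : t *: v + (1 - t) *: v0 = v0 + t *: (v - v0).
  by rewrite scalerBl scale1r scalerBr [in RHS]addrCA.
rewrite dotvDl !dotvDr !dotvZl !dotvZr (dotvC (v - v0) v0) -/a -/b.
have -> : dotv v0 v0 + t * a + (t * a + t * (t * b)) =
    dotv v0 v0 + t * (2 * a + t * b) by ring.
rewrite lerDl pmulr_rge0//; lra.
Qed.

(** Along the element [v0] of least Euclidean norm of [D p], every element of [D p] has inner
    product at least [dotv v0 v0] with [v0], and nearby values of [D] almost do. So [f] grows at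
    nearly this rate, which exceeds the Lipschitz rate if the norm of [v0] is larger than [L]. *)
Lemma potential_min_norm (p : 'rV[R]_n) (L M : R) (N : set 'rV[R]_n) : 0 <= L ->
  nbhs p N -> (forall q r, N q -> N r -> `|f q - f r| <= L * `|q - r|) ->
  (\forall q \near p, forall w, D q w -> `|w| <= M) ->
  exists2 v, D p v & `|v| <= L.
Proof.
move=> L0 nN fL DM.
have [v0 Dv0 v0min] := convex_min_dotv (@D_compact p) (@D_convex p) (D0 p).
exists v0 => //; rewrite leNgt; apply/negP => Lv0.
set q0 := dotv v0 v0 in v0min *.
have v00 : 0 < `|v0| by exact: le_lt_trans Lv0.
have Lq0 : L * `|v0| < q0.
  by rewrite (lt_le_trans _ (ler_sqr_norm_dotv v0))// expr2 ltr_pM2r.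
pose e := q0 - L * `|v0|.
have e0 : 0 < e by rewrite subr_gt0.
(* Half of the gap [e] pays for replacing an element of a nearby value by one of [D p] at distance
   [h]; the factor [n%:R] comes from bounding the inner product by sup norms. *)
pose h := e / 2 / (n%:R * `|v0| + 1).
have nv0 : 0 < n%:R * `|v0| + 1 by rewrite ltr_wpDl// mulr_ge0.
have h0 : 0 < h by rewrite !divr_gt0.
have nh : n%:R * `|v0| * h <= e / 2.
  rewrite /h mulrA ler_pdivrMr// mulrC ler_wpM2l ?lerDl//.
  by rewrite divr_ge0// ltW.
pose K := [set w : 'rV[R]_n | `|w| <= M].
have cK : compact K by exact: (@compact_ball_rV R n M).
have usc := closed_graph_usc D_closed cK DM h0.
have [r /= r0 Hr] := (nbhs_ballP _ _).1 (filterI nN usc).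
pose s := r / 2 / `|v0|.
have s0 : 0 < s by rewrite !divr_gt0.
have sr t : 0 <= t <= 1 -> ball p r (p + t *: (s *: v0)).
  move=> /andP[t0 t1]; rewrite -ball_normE/= opprD addrA subrr add0r normrN.
  have ts : 0 <= t * s by rewrite mulr_ge0// ltW.
  have -> : `|t *: (s *: v0)| = t * (r / 2).
    by rewrite scalerA normrZ (ger0_norm ts) -mulrA /s divfK// gt_eqF.
  by rewrite (@le_lt_trans _ _ (r / 2))// ?ler_piMl//; lra.
have : s * (q0 - e / 2) <= f (p + s *: v0) - f p.
  apply: (potential_segment_ge fD D_compact D0) => t t01 v Dv.
  have [_ /(_ _ Dv)[u Du uv]] := Hr _ (sr _ t01).
  rewrite dotvZl ler_pM2l// -(subrK u v) dotvDr addrC.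
  have : `|dotv v0 (v - u)| <= e / 2.
    rewrite (le_trans (ler_norm_dotv v0 (v - u)))// mulrA (le_trans _ nh)//.
    by rewrite ler_wpM2l ?mulr_ge0// ltW.
  by have := v0min _ Du; rewrite ler_norml => ? /andP[+ _]; lra.
have p1 : ball p r (p + s *: v0).
  by rewrite -[s *: v0]scale1r; apply: sr; rewrite ler01 lexx.
have := fL _ _ (Hr _ p1).1 (nbhs_singleton nN).
rewrite addrAC subrr add0r normrZ (gtr0_norm s0) => H1 H2.
have := le_trans H2 (le_trans (ler_norm _) H1).
by rewrite mulrCA ler_pM2l// /e; lra.
Qed.

(* By Baire's theorem [D] is locally bounded on a dense open set; there the
   element of minimal norm of [D q] is bounded by the Lipschitz constant of [f],
   and closedness of the graph extends this bound to all points near [p]. *)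
Lemma conservative_locally_bounded (p : 'rV[R]_n) :
  exists M, \forall q \near p, forall w, D q w -> `|w| <= M.
Proof.
pose E (r : R) := [set y | exists2 w, D y w & `|w| <= r].
have oE r : open (~` E r).
  rewrite openE => q Eq; rewrite /interior.
  have := closed_graph_near_disjoint D_closed (@compact_ball_rV R n r) (p := q).
  move=> /(_ _)/wrap[|].
    by move=> w wr Dw; apply: Eq; exists w.
  by apply: filterS => y Dy [w Dw wr]; exact: (Dy w).
(* [E] is closed because the graph is; [F k] removes its boundary, which has empty interior. *)
pose F (k : nat) := ~` E k%:R `|` (E k%:R)°.
have oF k : open (F k) /\ dense (F k).
  split; first by apply: openU => //; exact: open_interior.
  move=> O [y Oy] oO.
  have [OE|/existsNP[a /not_implyP[Oa Ea]]] := pselect (O `<=` E k%:R).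
    by exists y; split => //; right; exact: filterS OE (open_nbhs_nbhs (conj oO Oy)).
  by exists a; split => //; left.
have [L L0 [N nN fL]] := locally_lipschitz_near p.
have nAB : nbhs p N° by exact: nbhs_interior.
(* One element of norm at most [L] in each nearby value is enough: convexity then bounds the whole
   values. *)
suff : \forall q \near p, exists2 w, D q w & `|w| <= L.
  exact: convex_locally_bounded.
apply: filterS nAB => q ABq; apply: contrapT => Eq.
(* The point [a] avoids all the boundaries, and [D a] has an element of some integer bound [k] on
   its norm; hence [a] is interior to [E k%:R], and [D] is bounded near [a]. *)
have := @Baire _ _ F oF (N° `&` ~` E L).
move=> [||a [[ABa Ea] Fa]].
- by exists q.
- by apply: openI; [exact: open_interior|exact: oE].
apply: Ea; have [w Dw] := D0 a.
have wk : `|w| <= (Num.bound `|w|)%:R by exact/ltW/archi_boundP.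
have [Ek|Ek] := Fa (Num.bound `|w|) I; first by exfalso; apply: Ek; exists w.
have [M DM] := convex_locally_bounded D_closed D_convex (@D_compact a) Ek.
apply: (potential_min_norm L0 ABa fL DM).
Qed.

End conservative_locally_bounded.

(** * Limit curves of stochastic approximation schemes *)

Lemma ultra_compact_cvg (T : Type) (U : set_system T) (E : topologicalType)
    (K : set E) (f : T -> E) : UltraFilter U -> compact K -> U (f @^-1` K) ->
  exists p : E, f x @[x --> U] --> p.
Proof.
move=> UU cK UK; have [p [_ fp]] := cK _ (fmap_proper_filter f _) UK.
exists p => B Bp.
have [//|UnB] := in_ultra_setVsetC (f @^-1` B) UU.
have [x [/=]] := fp (~` B) B UnB Bp.
by [].
Qed.

Section limit_curve.
Context {R : realType}.

Lemma convex_sum (E : lmodType R) (A : set E) (c : nat -> R) (u : nat -> E)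
    (a b : nat) :
  convex_set A -> (forall i, 0 < c i) -> (a < b)%N ->
  (forall i, (a <= i < b)%N -> A (u i)) ->
  exists2 w, A w &
    \sum_(a <= i < b) c i *: u i = (\sum_(a <= i < b) c i) *: w.
Proof.
move=> cA c0; elim: b => // b IHb; rewrite ltnS leq_eqVlt => /predU1P[<-|ab] Au.
  by exists (u a); rewrite ?big_nat1//; apply: Au; rewrite leqnn ltnSn.
have [|w Aw wE] := IHb ab.
  by move=> i /andP[ai ib]; apply: Au; rewrite ai ltnS ltnW.
have Ab : A (u b) by apply: Au; rewrite ltnSn ltnW.
have S0 : 0 < \sum_(a <= i < b) c i.
  by rewrite big_ltn// ltr_pwDl// sumr_ge0// => i _; exact: ltW.
set S := \sum_(a <= i < b) c i in wE S0.
have Sb0 : 0 < S + c b by rewrite addr_gt0.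
exists ((S / (S + c b)) *: w + (1 - S / (S + c b)) *: u b).
  apply: convex_setP => //.
  apply/andP; split; first by rewrite divr_ge0// ltW.
  by rewrite ler_pdivrMr// mul1r lerDl ltW.
have ab' := ltnW ab.
rewrite big_nat_recr//= (big_nat_recr b a)//= wE -/S scalerDr !scalerA.
congr (_ *: _ + _ *: _); first by rewrite mulrC divfK// gt_eqF.
by rewrite mulrBr mulr1 mulrCA divff ?gt_eqF// mulr1 addrAC subrr add0r.
Qed.

(** The recursion is split into an exact element [g k] of [G] at a point [y k] close to the iterate
    [z k], a vanishing error [r k], and the noise increment [zeta k], which is controlled only
    through its sums over windows of elapsed time at most 1. *)
Variables (E : normedModType R) (G : E -> set E).
Variables (z y g r zeta : nat -> E) (eta : nat -> R) (K : set E) (C : R).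
Hypotheses (G_convex : forall p, convex_set (G p))
  (G_compact : forall p, compact (G p))
  (G_usc : forall p e, 0 < e ->
    \forall q \near p, forall w, G q w -> exists2 u, G p u & `|w - u| < e).
Hypotheses (z_rec : forall k,
    z k.+1 = z k - eta k *: g k - eta k *: r k - zeta k)
  (gG : forall k, G (y k) (g k)) (gC : forall k, `|g k| <= C)
  (yz : (y k - z k) @[k --> \oo] --> (0 : E))
  (r0 : r k @[k --> \oo] --> (0 : E))
  (cK : compact K) (zK : forall k, K (z k))
  (eta0 : forall k, 0 < eta k) (eta_cvg : eta k @[k --> \oo] --> (0 : R))
  (eta_sum : series eta @ \oo --> +oo).

Definition elapsed (a b : nat) : R := \sum_(a <= i < b) eta i.

Hypothesis noise : forall e : R, 0 < e -> \forall a \near \oo, forall b,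
  (a <= b)%N -> elapsed a b <= 1 -> `|\sum_(a <= i < b) zeta i| <= e.

Lemma elapsed_ge0 a b : 0 <= elapsed a b.
Proof. by apply: sumr_ge0 => i _; exact: ltW. Qed.

Lemma elapsed_cat a b c : (a <= b)%N -> (b <= c)%N ->
  elapsed a c = elapsed a b + elapsed b c.
Proof. by move=> ab bc; rewrite /elapsed (big_cat_nat ab bc). Qed.

Lemma elapsed_recr a b : (a <= b)%N -> elapsed a b.+1 = elapsed a b + eta b.
Proof. by move=> ab; rewrite /elapsed big_nat_recr. Qed.

Lemma elapsed_le a b c : (a <= b)%N -> (b <= c)%N -> elapsed a b <= elapsed a c.
Proof. by move=> ab bc; rewrite (elapsed_cat ab bc) lerDl elapsed_ge0. Qed.

(** Divergence of the stepsize series makes every time reachable; the index is the least [k >= s]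
    whose next step goes beyond time [t]. *)
Lemma elapsed_indexE : exists n : nat -> R -> nat, forall s t, 0 <= t ->
  [/\ (s <= n s t)%N, elapsed s (n s t) <= t & t < elapsed s (n s t).+1].
Proof.
suff H (p : nat * R) : exists k, 0 <= p.2 ->
    [/\ (p.1 <= k)%N, elapsed p.1 k <= p.2 & p.2 < elapsed p.1 k.+1].
  have [n nP] := choice H.
  by exists (fun s t => n (s, t)) => s t /(nP (s, t)).
case: p => s t /=; have [t0|] := leP 0 t; last by move=> _; exists 0%N.
have : exists k, (s <= k)%N && (t < elapsed s k.+1).
  move/cvgryPge : eta_sum => /(_ (t + elapsed 0 s + 1)) [N _ HN].
  exists (maxn N s); rewrite leq_maxr/=.
  have := HN (maxn N s).+1; rewrite /= /series/=.
  rewrite leqW ?leq_maxl// => /(_ isT).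
  rewrite -/(elapsed 0 (maxn N s).+1).
  by rewrite (elapsed_cat (leq0n s) (leqW (leq_maxr N s))); lra.
move=> /ex_minnP[k /andP[sk tk] kmin]; exists k => _; split => //.
move: sk; rewrite leq_eqVlt => /predU1P[<-|]; first by rewrite /elapsed big_geq.
case: k => // k in tk kmin *; rewrite ltnS => sk.
rewrite leNgt; apply/negP => tk'.
by have := kmin k; rewrite sk tk' => /(_ isT); rewrite ltnn.
Qed.

Lemma telescope_rec a b : (a <= b)%N ->
  z b - z a = - \sum_(a <= i < b) eta i *: g i - \sum_(a <= i < b) eta i *: r i
              - \sum_(a <= i < b) zeta i.
Proof.
move=> ab; rewrite -telescope_sumr// -!sumrN -!big_split/=.
apply: eq_bigr => i _; rewrite z_rec -!addrA.
by rewrite addrC -!addrA addNr addr0.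
Qed.

Lemma weighted_sum_le (u : nat -> E) (M : R) a b :
  (forall i, (a <= i < b)%N -> `|u i| <= M) ->
  `|\sum_(a <= i < b) eta i *: u i| <= M * elapsed a b.
Proof.
move=> uM; rewrite (le_trans (ler_norm_sum _ _ _))// /elapsed mulr_sumr.
rewrite big_nat_cond [leRHS]big_nat_cond; apply: ler_sum => i.
rewrite andbT => iab.
by rewrite normrZ (gtr0_norm (eta0 i)) mulrC ler_wpM2r ?uM// ltW.
Qed.

Lemma rec_error_le (e : R) : 0 < e -> \forall a \near \oo, forall b,
  (a <= b)%N -> elapsed a b <= 1 ->
  `|z b - z a + \sum_(a <= i < b) eta i *: g i| <= e.
Proof.
move=> e0; have e20 : 0 < e / 2 by rewrite divr_gt0.
have /cvgrPdist_le/(_ _ e20)[N _ HN] := r0.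
apply: filterS2 (noise e20) (nbhs_infty_ge N) => a Ha aN b ab ab1.
rewrite telescope_rec// [X in `|X|]addrC !addrA subrr add0r.
rewrite -opprD normrN.
rewrite (le_trans (ler_normD _ _))// [e in leRHS]splitr lerD//; last exact: Ha.
rewrite (le_trans (@weighted_sum_le _ (e / 2) _ _ _))//.
  move=> i /andP[ai _]; have := HN i (leq_trans aN ai).
  by rewrite sub0r normrN.
by rewrite ler_piMr// ltW.
Qed.

Lemma displacement_le (e : R) : 0 < e -> \forall a \near \oo, forall b,
  (a <= b)%N -> elapsed a b <= 1 -> `|z b - z a| <= C * elapsed a b + e.
Proof.
move=> e0; apply: filterS (rec_error_le e0) => a Ha b ab ab1.
rewrite -[z b - z a](addrK (\sum_(a <= i < b) eta i *: g i)) addrC.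
rewrite (le_trans (ler_normD _ _))// normrN lerD//; last exact: Ha.
exact: weighted_sum_le.
Qed.

Variable n : nat -> R -> nat.
Hypothesis nP : forall s t, 0 <= t ->
  [/\ (s <= n s t)%N, elapsed s (n s t) <= t & t < elapsed s (n s t).+1].

Lemma index_le s t t' : 0 <= t -> t <= t' -> (n s t <= n s t')%N.
Proof.
move=> t0 tt'; rewrite leqNgt; apply/negP => nn.
have [sn nt _] := nP s t0; have [sn' _ nt'] := nP s (le_trans t0 tt').
have := lt_le_trans nt' (elapsed_le (leqW sn') nn).
by move=> /lt_le_trans/(_ nt); rewrite ltNge tt'.
Qed.

(** Each index falls short of its nominal time by less than one step, which explains the error of
    one stepsize on either side. *)
Lemma elapsed_index s t t' : 0 <= t -> t <= t' ->
  t' - t - eta (n s t') <= elapsed (n s t) (n s t') <= t' - t + eta (n s t).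
Proof.
move=> t0 tt'.
have [sn nt] := nP s t0; rewrite elapsed_recr// => nt2.
have [sn' nt'] := nP s (le_trans t0 tt'); rewrite elapsed_recr// => nt2'.
have := elapsed_cat sn (index_le s t0 tt').
by move=> H; apply/andP; split; lra.
Qed.

Variables (U : set_system nat).
Hypotheses (UU : UltraFilter U) (Uoo : (\oo : set_system nat) `<=` U).

(* [n s t] is the last index reached within time [t] from [s]; limits along an
   ultrafilter of starting indices replace the extraction of subsequences. *)
Definition limit_curve (t : R) : E := lim (z (n s t) @[s --> U]).

Lemma limit_curve_cvg t : z (n s t) @[s --> U] --> limit_curve t.
Proof.
have [|p zp] := @ultra_compact_cvg _ U _ K (fun s => z (n s t)) UU cK.
  by apply: filterE => s; exact: zK.
exact/cvgP/zp.
Qed.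

Lemma limit_curve0 (p : E) : z s @[s --> U] --> p -> limit_curve 0 = p.
Proof.
move=> zp; rewrite /limit_curve (_ : (fun s => z (n s 0)) = z).
  by apply: cvg_lim => //; exact: norm_hausdorff.
apply/funext => s; congr z; have [sn n0 _] := nP s (lexx 0).
apply/eqP; rewrite eqn_leq sn andbT leqNgt; apply/negP => ns.
have := le_trans (elapsed_le (leqnSn s) ns) n0.
by rewrite /elapsed big_nat1 leNgt eta0.
Qed.

Lemma near_index (P : nat -> Prop) t : 0 <= t ->
  (\forall a \near \oo, P a) -> \forall s \near U, P (n s t).
Proof.
move=> t0 [N _ NP]; apply: Uoo; exists N => // s Ns.
by apply: NP; have [sn _ _] := nP s t0; exact: leq_trans sn.
Qed.

Lemma near_limit_curve t (e : R) : 0 < e ->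
  \forall s \near U, `|limit_curve t - z (n s t)| <= e.
Proof. by move=> e0; have /cvgrPdist_le := @limit_curve_cvg t; apply. Qed.

Lemma eta_near_le (e : R) : 0 < e -> \forall a \near \oo, eta a <= e.
Proof.
move=> e0; have /cvgrPdist_le/(_ _ e0) := eta_cvg; apply: filterS => a.
by rewrite sub0r normrN; exact/le_trans/ler_norm.
Qed.

(** The iterates move by at most [C] times the elapsed time, up to noise. Four errors of [e / 4]
    each arise: the two limits, the noise with the error [r], and the overshoot of one step. *)
Lemma limit_curve_lipschitz s t : 0 <= s <= 1 -> 0 <= t <= 1 ->
  `|limit_curve s - limit_curve t| <= C * `|s - t|.
Proof.
wlog st : s t / s <= t.
  move=> H s01 t01; have [st|/ltW ts] := leP s t; first exact: H.
  by rewrite distrC (distrC s); exact: H.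
move=> /andP[s0 s1] /andP[t0 t1].
have C0 : 0 <= C := le_trans (normr_ge0 _) (gC 0%N).
rewrite distrC (distrC s) [`|t - s|]ger0_norm ?subr_ge0//.
apply/ler_addgt0Pr => e e0.
have e4 : 0 < e / 4 by rewrite divr_gt0.
have C1 : 0 < C + 1 by rewrite ltr_wpDl.
near U => k.
have H1 : `|limit_curve t - z (n k t)| <= e / 4.
  by near: k; exact: near_limit_curve.
have H2 : `|limit_curve s - z (n k s)| <= e / 4.
  by near: k; exact: near_limit_curve.
have H3 : eta (n k s) <= e / 4 / (C + 1).
  by near: k; apply: (@near_index (fun a => eta a <= _)) => //; apply: eta_near_le; rewrite divr_gt0.
have H4 : forall b, (n k s <= b)%N -> elapsed (n k s) b <= 1 ->
    `|z b - z (n k s)| <= C * elapsed (n k s) b + e / 4.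
  near: k; apply: (@near_index (fun a => forall b, (a <= b)%N ->
    elapsed a b <= 1 -> `|z b - z a| <= C * elapsed a b + e / 4)) => //.
  exact: displacement_le.
have {}H4 := H4 _ (index_le k s0 st).
have /andP[_ S2] := elapsed_index k s0 st.
have S1 : elapsed (n k s) (n k t) <= 1.
  have [sn _ _] := nP k s0; have [_ nt _] := nP k t0.
  have := elapsed_cat sn (index_le k s0 st); have := elapsed_ge0 k (n k s).
  lra.
have {}H4 := H4 S1.
have H5 : C * elapsed (n k s) (n k t) <= C * (t - s) + e / 4.
  rewrite (le_trans (ler_wpM2l C0 S2))// mulrDr lerD2l.
  rewrite (le_trans (ler_wpM2l C0 H3))// mulrCA ler_piMr// ?(ltW e4)//.
  by rewrite ler_pdivrMr// mul1r lerDl.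
have -> : limit_curve t - limit_curve s = (limit_curve t - z (n k t)) +
    (z (n k t) - z (n k s)) - (limit_curve s - z (n k s)).
  by rewrite addrA subrK opprB addrA subrK.
rewrite (le_trans (ler_normB _ _))// (le_trans (lerD (ler_normD _ _) (lexx _)))//.
lra.
Unshelve. all: by end_near. Qed.

(** For small [h] all points [y i] of the window from time [t] to time [t + h] are so close to [p]
    that each [g i] is within [e / 4] of [G p]. Their average with weights [eta i] is then close to
    a point of the convex set [G p], and minus this average approximates the difference quotient. *)
Lemma limit_curve_inclusion (t e : R) : 0 <= t < 1 -> 0 < e ->
  \forall h \near 0^'+, exists2 w, G (limit_curve t) w &
    `|h^-1 *: (limit_curve (t + h) - limit_curve t) + w| <= e.
Proof.
move=> /andP[t0 t1] e0; set p := limit_curve t.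
have C0 : 0 <= C := le_trans (normr_ge0 _) (gC 0%N).
have C1 : 0 < C + 1 by rewrite ltr_wpDl.
have e4 : 0 < e / 4 by rewrite divr_gt0.
have [M M0 GM] : exists2 M : R, 0 <= M & forall w, G p w -> `|w| <= M.
  have [M0 [_ HM0]] := compact_bounded (@G_compact p).
  exists (`|M0| + 1); first by rewrite addr_ge0.
  by move=> w; apply: HM0; rewrite ltr_pwDr// ler_norm.
have [r' /= r'0 Gr] := (nbhs_ballP _ _).1 (@G_usc p _ e4).
have r8 : 0 < r' / 8 by rewrite divr_gt0.
near=> h.
have h0 : 0 < h by near: h; exact: nbhs_right_gt.
have th1 : t + h <= 1.
  by rewrite -lerBrDl; near: h; apply: nbhs_right_le; rewrite subr_gt0.
have Ch : C * h <= r' / 4.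
  rewrite (@le_trans _ _ ((C + 1) * h))//; first by rewrite ler_wpM2r ?lerDl// ltW.
  rewrite -ler_pdivlMl// mulrC; near: h; apply: nbhs_right_le.
  by rewrite !divr_gt0.
have he8 : 0 < h * e / 8 by rewrite !divr_gt0// mulr_gt0.
have t0h : 0 <= t + h by rewrite addr_ge0// ltW.
have tth : t <= t + h by rewrite lerDl ltW.
(* Bound on the stepsizes at both ends of the window: [h / 2] makes the window nonempty and its
   duration [S] at most [2 * h]; the other term makes [S *: w] and [h *: w] differ by at most
   [h * e / 8]. *)
pose e1 := Num.min (h / 2) (h * e / 8 / (M + 1)).
have M1 : 0 < M + 1 by rewrite ltr_wpDl.
have e10 : 0 < e1 by rewrite lt_min !divr_gt0// mulr_gt0.
have e1h : e1 <= h / 2 by rewrite ge_min lexx.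
have e1M : e1 * M <= h * e / 8.
  rewrite (@le_trans _ _ (h * e / 8 / (M + 1) * M))//.
    by rewrite ler_wpM2r// ge_min lexx orbT.
  by rewrite mulrAC ler_pdivrMr// ler_wpM2l// ?lerDl// ltW.
near U => k.
have H1 : `|p - z (n k t)| <= r' / 8 by near: k; exact: near_limit_curve.
have H1' : `|p - z (n k t)| <= h * e / 8 by near: k; exact: near_limit_curve.
have H2 : `|limit_curve (t + h) - z (n k (t + h))| <= h * e / 8.
  by near: k; exact: near_limit_curve.
have H3 : eta (n k t) <= e1.
  by near: k; apply: (@near_index (fun a => eta a <= _)) => //; exact: eta_near_le.
have H3' : C * eta (n k t) <= r' / 8.
  rewrite (@le_trans _ _ ((C + 1) * eta (n k t)))//.
    by rewrite ler_wpM2r ?lerDl// ltW.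
  rewrite -ler_pdivlMl// mulrC; near: k.
  apply: (@near_index (fun a => eta a <= _)) => //; apply: eta_near_le.
  by rewrite !divr_gt0.
have H4 : eta (n k (t + h)) <= e1.
  by near: k; apply: (@near_index (fun a => eta a <= _)) => //; exact: eta_near_le.
have H5 : forall c, (n k t <= c)%N -> elapsed (n k t) c <= 1 ->
    `|z c - z (n k t)| <= C * elapsed (n k t) c + r' / 8.
  near: k; apply: (@near_index (fun a => forall b, (a <= b)%N ->
    elapsed a b <= 1 -> `|z b - z a| <= C * elapsed a b + r' / 8)) => //.
  exact: displacement_le.
have H6 : forall c, (n k t <= c)%N -> elapsed (n k t) c <= 1 ->
    `|z c - z (n k t) + \sum_(n k t <= i < c) eta i *: g i| <= h * e / 8.
  near: k; apply: (@near_index (fun a => forall b, (a <= b)%N ->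
    elapsed a b <= 1 -> `|z b - z a + \sum_(a <= i < b) eta i *: g i| <= _)) => //.
  exact: rec_error_le.
have H7 : forall i, (n k t <= i)%N -> `|y i - z i| <= r' / 8.
  near: k; apply: (@near_index (fun a => forall i, (a <= i)%N ->
    `|y i - z i| <= r' / 8)) => //.
  have /cvgrPdist_le/(_ _ r8)[N _ HN] := yz.
  exists N => // j /= Nj i ji; have := HN i (leq_trans Nj ji).
  by rewrite sub0r normrN.
set a := n k t in H1 H1' H3 H3' H5 H6 H7; set b := n k (t + h) in H2 H4.
have ab : (a <= b)%N := index_le k t0 tth.
have thE : t + h - t = h by rewrite addrAC subrr add0r.
have /andP[] := elapsed_index k t0 tth; rewrite -/a -/b thE.
set S := elapsed a b => Sl Su.
have S1 : S <= 1.
  have [sn _ _] := nP k t0; have [_ nt _] := nP k t0h.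
  have := elapsed_cat sn (index_le k t0 tth); have := elapsed_ge0 k (n k t).
  rewrite -/a -/b -/S => k0 kE.
  by rewrite (le_trans _ th1)// (le_trans _ nt)// kE lerDr.
have ltab : (a < b)%N.
  rewrite ltn_neqAle ab andbT; apply/eqP => abE.
  have S0 : S = 0 by rewrite /S abE /elapsed big_geq.
  have : h <= h / 2.
    by rewrite (le_trans _ e1h)// (le_trans _ H4)// -subr_le0 (le_trans Sl)// S0.
  by rewrite leNgt ltr_pdivrMr// ltr_pMr// ltr1n.
(* The contributions are [r' / 4] for the motion during [h] and four times [r' / 8], for the limit,
   the extra step, the noise and the distance from [y i] to [z i]; their sum is [3 / 4 * r']. *)
have yp i : (a <= i < b)%N -> ball p r' (y i).
  move=> /andP[ai ib].
  have Sai : elapsed a i <= S := elapsed_le ai (ltnW ib).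
  have := H5 i ai (le_trans Sai S1); have := H7 i ai.
  have CS : C * elapsed a i <= C * h + C * eta a.
    by rewrite -mulrDr ler_wpM2l// (le_trans Sai).
  move=> A1 A2; rewrite -ball_normE/= -/p.
  have -> : p - y i = (p - z a) - (z i - z a) - (y i - z i).
    by rewrite opprB addrA subrK opprB addrA subrK.
  rewrite (le_lt_trans (ler_normB _ _))//.
  rewrite (le_lt_trans (lerD (ler_normB _ _) (lexx _)))//.
  have A3 := le_trans A2 (lerD (le_trans CS (lerD Ch H3')) (lexx _)).
  rewrite (le_lt_trans (lerD (lerD H1 A3) A1))//.
  rewrite [ltLHS](_ : _ = 3 / 4 * r'); last by field.
  by rewrite gtr_pMl// ltr_pdivrMr// mul1r ltr_nat.
have [|u uP] := @choice nat E
  (fun i v => (a <= i < b)%N -> G p v /\ `|g i - v| <= e / 4).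
  move=> i; have [iab|] := boolP (a <= i < b)%N; last by exists 0.
  have [v Gv gv] := Gr _ (yp _ iab) _ (gG i).
  by exists v => _; split => //; exact: ltW.
have [w Gw wE] := convex_sum (@G_convex p) eta0 ltab (fun i iab => (uP i iab).1).
rewrite -/(elapsed a b) -/S in wE.
exists w => //.
have H8 : `|\sum_(a <= i < b) eta i *: g i - S *: w| <= h * e / 2.
  rewrite -wE -sumrB; under eq_bigr do rewrite -scalerBr.
  rewrite (le_trans (@weighted_sum_le (fun i => g i - u i) (e / 4) _ _ _))//.
    by move=> i /uP[].
  rewrite -/S [leRHS](_ : _ = e / 4 * (h + h)); last by field.
  rewrite ler_wpM2l ?(ltW e4)// (le_trans Su)// lerD2l (le_trans H3)//.
  by rewrite (le_trans e1h)// ler_pdivrMr// ler_peMr ?ler1n// ltW.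
have H9 : `|(h - S) *: w| <= h * e / 8.
  rewrite normrZ (le_trans _ e1M)// ler_pM// ?GM//.
  rewrite distrC ler_distl (le_trans _ Sl) ?lerD2l ?lerN2//=.
  by rewrite (le_trans Su)// lerD2l.
have -> : h^-1 *: (limit_curve (t + h) - p) + w =
    h^-1 *: (limit_curve (t + h) - p + h *: w).
  by rewrite [in RHS]scalerDr scalerA mulVf ?gt_eqF// scale1r.
rewrite normrZ gtr0_norm ?invr_gt0// ler_pdivrMl//.
set Sg := \sum_(a <= i < b) eta i *: g i in H8.
(* Five errors: four of [h * e / 8] and, for replacing [g] by elements of [G p], one of
   [h * e / 2]. *)
have -> : limit_curve (t + h) - p + h *: w =
    (limit_curve (t + h) - z b) + (z b - z a + Sg) - (p - z a) -
    (Sg - S *: w) + (h - S) *: w.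
  rewrite scalerBl.
  have -> : limit_curve (t + h) - z b + (z b - z a + Sg) =
      limit_curve (t + h) - z a + Sg.
    by rewrite -[z b - z a + Sg]addrA [LHS]addrA subrK addrA.
  rewrite opprB [_ - z a + Sg + _]addrAC [_ - z a + _]addrA subrK.
  have cancel (V1 V2 V3 V4 : E) : V1 + V2 - (V2 - V3) + (V4 - V3) = V1 + V4.
    by rewrite opprB [V1 + V2 + _]addrA [V1 + V2 + V3]addrAC addrK addrACA subrr addr0.
  by rewrite cancel.
have {}H6 := H6 b ab S1; rewrite -/Sg in H6.
rewrite (le_trans (ler_normD _ _))// (le_trans (lerD (ler_normB _ _) (lexx _)))//.
rewrite (le_trans (lerD (lerD (ler_normB _ _) (lexx _)) (lexx _)))//.
rewrite (le_trans (lerD (lerD (lerD (ler_normD _ _) (lexx _)) (lexx _)) (lexx _)))//.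
rewrite (le_trans (lerD (lerD (lerD (lerD H2 H6) H1') H8) H9))//.
by rewrite [leLHS](_ : _ = h * e)//; field.
Unshelve. all: by end_near. Qed.

End limit_curve.

(** * The Lyapunov function *)

Lemma is_derive_quotient (R : realType) (F : R -> R) (t a : R) :
  is_derive t 1 F a -> h^-1 * (F (t + h) - F t) @[h --> 0^'] --> a.
Proof.
move=> [dF <-]; have := dF; rewrite /derivable /derive => /cvg_ex[l Fl].
rewrite (cvg_lim _ Fl)//; apply: cvg_trans Fl; apply: near_eq_cvg.
by near=> h; rewrite /= [h *: _]mulr1 [h + t]addrC.
Unshelve. all: by end_near. Qed.

Lemma is_derive_at_max (R : realType) (F : R -> R) (t a : R) :
  is_derive t 1 F a -> (forall s, F s <= F t) -> a = 0.
Proof.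
move=> /is_derive_quotient dF Fmax; apply: contrapT => /eqP a0.
have na0 : 0 < `|a| by rewrite normr_gt0.
have /cvgrPdist_lt/(_ _ na0) := dF.
rewrite /prop_near1 /nbhs/= /dnbhs/= => /nbhs_ballP[e /= e0 He].
pose h := e / 2 * Num.sg a.
have h0 : h != 0 by rewrite /h !mulf_neq0 ?sgr_eq0// ?invr_eq0 ?gt_eqF.
have := He h; rewrite /= -ball_normE/= sub0r normrN /h normrM normr_sg a0 mulr1.
rewrite gtr0_norm ?divr_gt0// ltr_pdivrMr// ltr_pMr// ltr1n => /(_ isT h0).
rewrite -/h; set q := _ * _ => aq.
have {}aq : 0 < a * q.
  have : `|a * (a - q)| < a * a.
    rewrite normrM -[ltRHS]gtr0_norm ?normrM ?ltr_pM2l//.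
    by rewrite -expr2 exprn_even_gt0.
  by rewrite ltr_norml mulrBr => /andP[_]; lra.
have hq : h * q = F (t + h) - F t by rewrite /q mulVKf.
have : 0 < h * q.
  rewrite /h -mulrA pmulr_rgt0 ?divr_gt0//.
  have [a1|a1|a1] := ltgtP a 0; last by rewrite a1 eqxx in a0.
  - by rewrite ltr0_sg// mulN1r oppr_gt0; rewrite nmulr_rgt0 in aq.
  - by rewrite gtr0_sg// mul1r; rewrite pmulr_rgt0 in aq.
by rewrite hq subr_gt0 ltNge Fmax.
Qed.

Section scaling.
Context {R : realType}.
Variables (gamma epsilon : R).
Hypotheses (gamma_ge0 : 0 <= gamma) (epsilon_gt0 : 0 < epsilon).

Definition scaling (t : R) : R := (`|t| + epsilon) `^ (- gamma).

Let base_gt0 (t : R) : 0 < `|t| + epsilon.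
Proof. by rewrite ltr_wpDl. Qed.

Lemma scaling_gt0 t : 0 < scaling t.
Proof. by apply: powR_gt0; exact: base_gt0. Qed.

Lemma scaling_anti s t : `|s| <= `|t| -> scaling t <= scaling s.
Proof.
move=> st; rewrite /scaling !powRN lef_pV2 ?posrE ?powR_gt0//.
by apply: ge0_ler_powR; rewrite ?nnegrE ?lerD2r// ltW// base_gt0.
Qed.

Lemma scaling_le t : scaling t <= epsilon `^ (- gamma).
Proof. by have := @scaling_anti 0 t; rewrite /scaling normr0 add0r; apply. Qed.

Lemma scaling_lipschitz : exists2 L : R, 0 <= L &
  forall s t, `|scaling s - scaling t| <= L * `|s - t|.
Proof.
(* The derivative of the power with exponent [- gamma] is largest in modulus at the smallest base,
   which is [epsilon]. *)
pose L := gamma * epsilon `^ (- gamma - 1).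
have L0 : 0 <= L by rewrite mulr_ge0// powR_ge0.
exists L => // s t; wlog st : s t / `|s| < `|t|.
  move=> H; have [/H//|ts|st] := ltgtP `|s| `|t|.
    by rewrite distrC (distrC s); exact: H.
  by rewrite /scaling st subrr normr0 mulr_ge0.
have [|||c] := @MVT R (fun x => x `^ (- gamma)) (fun x => - gamma * x `^ (- gamma - 1))
  (`|s| + epsilon) (`|t| + epsilon).
- by rewrite ltrD2r.
- move=> x; rewrite in_itv/= => /andP[sx _]; apply: is_derive1_powR.
  exact: lt_trans sx.
- apply: derivable_within_continuous => x; rewrite in_itv/= => /andP[sx _].
  by apply: derivable_powR; rewrite in_itv/= andbT (lt_le_trans _ sx).
rewrite in_itv/= => /andP[sc _].
rewrite -/(scaling s) -/(scaling t) => E; rewrite distrC E normrM.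
have c0 : epsilon <= c by rewrite (le_trans _ (ltW sc))// lerDr.
apply: ler_pM => //; last by rewrite opprD addrACA subrr addr0 distrC ler_dist_dist.
rewrite normrM normrN (ger0_norm gamma_ge0) ler_wpM2l// ger0_norm ?powR_ge0//.
rewrite -opprD !powRN lef_pV2 ?posrE ?powR_gt0 ?(lt_le_trans _ c0)//.
apply: ge0_ler_powR; rewrite ?nnegrE ?addr_ge0//; first exact: ltW.
exact/ltW/(lt_le_trans _ c0).
Qed.

Lemma is_derive_scaling (F : R -> R) (t a : R) : F t != 0 ->
  is_derive t 1 F a -> is_derive t 1 (scaling \o F)
    (- gamma * (scaling (F t) / (`|F t| + epsilon)) * (Num.sg (F t) * a)).
Proof.
move=> Ft0 dF.
have cF : {for t, continuous F}.
  by apply: differentiable_continuous; apply/derivable1_diffP; exact: (@ex_derive _ _ _ _ _ _ _ dF).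
have dN : is_derive t 1 (fun x => `|F x| + epsilon) (Num.sg (F t) * a).
  rewrite -[Num.sg (F t) * a]addr0; apply: is_deriveD.
  have : is_derive t 1 (fun x => Num.sg (F t) * F x) (Num.sg (F t) * a).
    exact: is_deriveZ.
  apply: near_eq_is_derive.
  have [F0|F0|F0] := ltgtP (F t) 0; last by rewrite F0 eqxx in Ft0.
  - near=> x; have xF : F x < 0 by near: x; exact: cvgr_lt cF _ F0.
    by rewrite ltr0_sg// mulN1r ltr0_norm.
  - near=> x; have xF : 0 < F x by near: x; exact: cvgr_gt cF _ F0.
    by rewrite gtr0_sg// mul1r gtr0_norm.
have := @is_derive1_comp R (fun x => x `^ (- gamma)) (fun x => `|F x| + epsilon) t
  _ _ (is_derive1_powR (- gamma) (base_gt0 (F t))) dN.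
rewrite powRB; last by apply/implyP => _; rewrite gt_eqF// base_gt0.
by rewrite powRr1 ?(ltW (base_gt0 _))//.
Unshelve. all: by end_near. Qed.

End scaling.

Lemma is_derive_unique (R : realType) (F : R -> R) (t a b : R) :
  is_derive t 1 F a -> is_derive t 1 F b -> a = b.
Proof. by move=> [_ <-] [_ <-]. Qed.

Lemma ae_exists_itv (R : realType) (P : R -> Prop) (a b : R) :
  0 <= a -> a < b -> b <= 1 ->
  {ae @lebesgue_measure R, forall t : R, 0 < t < 1 -> P t} ->
  exists2 t, a < t < b & P t.
Proof.
move=> a0 ab b1 [N [mN N0 PN]]; apply: contrapT => nP.
have : (lebesgue_measure (`]a, b[%classic : set R) <= lebesgue_measure N)%E.
  apply: le_measure; rewrite ?inE//.
  move=> t /=; rewrite in_itv/= => /andP[ta tb]; apply: PN => /= H.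
  apply: nP; exists t; first by rewrite ta tb.
  by apply: H; rewrite (le_lt_trans a0 ta) (lt_le_trans tb b1).
rewrite lebesgue_measure_itv/= lte_fin ab N0 -EFinD lee_fin.
by rewrite leNgt subr_gt0 ab.
Qed.

Lemma bounded_integrable01 (R : realType) (F : R -> R) (M : R) :
  measurable_fun [set: R] F -> (forall t, `|F t| <= M) ->
  (@lebesgue_measure R).-integrable `[0, 1]%classic (fun t => (F t)%:E).
Proof.
move=> mF FM; apply: measurable_bounded_integrable => //.
- by rewrite /= lebesgue_measure_itv/= lte_fin ltr01 oppr0 adde0 ltry.
- exact: measurable_funTS.
- exists M; split; first exact: num_real.
  by move=> x Mx t _; rewrite /= (le_trans (FM t))// ltW.
Qed.

Lemma ae_forall_ord (d : measure_display) (T : measurableType d) (R : realType)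
    (mu : {measure set T -> \bar R}) (n : nat) (P : 'I_n -> T -> Prop) :
  (forall i, {ae mu, forall t, P i t}) -> {ae mu, forall t, forall i, P i t}.
Proof.
by move=> HP; apply: filter_forall.
Qed.

Lemma rV_quotient_cvg (R : realType) (n : nat) (g : R -> 'rV[R]_n) (t : R)
    (w : 'rV[R]_n) :
  (forall i, is_derive t 1 (fun s => g s 0 i) (w 0 i)) ->
  h^-1 *: (g (t + h) - g t) @[h --> 0^'] --> w.
Proof.
move=> dg; apply/cvgrPdist_le => e e0.
have : \forall h \near 0^', forall i, `|w 0 i - h^-1 * (g (t + h) 0 i - g t 0 i)| <= e.
  apply: filter_forall => i.
  by have /cvgrPdist_le/(_ _ e0) := is_derive_quotient (dg i).
apply: filterS => h Hh; apply: rV_norm_le => [|i]; first exact: ltW.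
by rewrite !mxE; exact: Hh.
Qed.

Lemma derive1_rV (R : realType) (n : nat) (g : R -> 'rV[R]_n) (t : R)
    (w : 'rV[R]_n) :
  (forall i, is_derive t 1 (fun s => g s 0 i) (w 0 i)) -> derive1 g t = w.
Proof.
move=> /rV_quotient_cvg dg; rewrite /derive1; apply: cvg_lim => //.
by under eq_fun do rewrite [_ + t]addrC.
Qed.

Lemma bounded_lipschitzM (R : realType) (F G : R -> R) (A B L M : R) :
  (forall t, `|F t| <= A) -> (forall t, `|G t| <= B) ->
  (forall s t, `|F s - F t| <= L * `|s - t|) ->
  (forall s t, `|G s - G t| <= M * `|s - t|) ->
  forall s t, `|F s * G s - F t * G t| <= (A * M + L * B) * `|s - t|.
Proof.
move=> FA GB FL GM s t.
have -> : F s * G s - F t * G t = F s * (G s - G t) + (F s - F t) * G t by ring.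
rewrite (le_trans (ler_normD _ _))// !normrM mulrDl lerD//.
  by rewrite -mulrA ler_pM.
by rewrite mulrAC ler_pM.
Qed.

Section lyapunov.
Context {R : realType} {n : nat}.
Notation mu := (@lebesgue_measure R).
Variables (f : 'rV[R]_n -> R) (D : 'rV[R]_n -> set 'rV[R]_n)
  (U : triple R n -> set 'rV[R]_n).
Variables (alpha gamma epsilon tau1 tau2 kappa : R).
Hypotheses (fD : is_potential f D) (D_closed : closed_graph D)
  (D_compact : forall x, compact (D x)).
Hypotheses (alpha_ge0 : 0 <= alpha) (gamma_ge0 : 0 <= gamma)
  (epsilon_gt0 : 0 < epsilon) (tau1_gt0 : 0 < tau1) (tau2_gt0 : 0 < tau2)
  (U_sign : forall x0 m0 v0 u, U (x0, m0, v0) u -> forall i : 'I_n,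
     0 <= kappa * `|v0 0 i| <= Num.sg (v0 0 i) * u 0 i)
  (kappa_cond : (1 - kappa) * gamma * tau2 <= 2 * tau1).
Let sc := scaling gamma epsilon.

Definition lyapunov (p : triple R n) : R :=
  f p.1.1 + (2 * tau1)^-1 *
    \sum_(i < n) (p.1.2 0 i ^+ 2 * scaling gamma epsilon (p.2 0 i)).

(* Curves are traversed backwards, from the end of the window to its start, so
   that the Lyapunov function grows at a positive rate. *)
Lemma lyapunov_rate (T B m v d u x' m' s' Q' : R) : 0 < T -> `|v| <= B ->
  x' = T * (sc v * (m + alpha * d)) -> m' = T * (tau1 * (m - d)) ->
  - (2 * tau1) * T * (sc v * `|v| / (`|v| + epsilon)) <= s' ->
  Q' = 2 * m * m' * sc v + m ^+ 2 * s' ->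
  T * (sc B * epsilon / (B + epsilon)) * m ^+ 2 <=
    x' * d + (2 * tau1)^-1 * Q'.
Proof.
move=> T0 vB -> -> s'ge ->.
have B0 : 0 <= B := le_trans (normr_ge0 _) vB.
have Be : 0 < B + epsilon by rewrite ltr_wpDl.
have ve : 0 < `|v| + epsilon by rewrite ltr_wpDl.
have sv := scaling_gt0 gamma epsilon_gt0 v; rewrite -/sc in sv.
set q := (2 * tau1)^-1 * (m ^+ 2 * s').
have qge : - (T * (sc v * `|v| / (`|v| + epsilon)) * m ^+ 2) <= q.
  have -> : - (T * (sc v * `|v| / (`|v| + epsilon)) * m ^+ 2) =
      (2 * tau1)^-1 * (m ^+ 2 * (- (2 * tau1) * T * (sc v * `|v| / (`|v| + epsilon)))).
    by field; rewrite !gt_eqF.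
  rewrite /q ler_wpM2l ?invr_ge0 ?mulr_ge0 ?(ltW tau1_gt0)//.
  by rewrite ler_wpM2l// sqr_ge0.
(* The mixed terms in [m * d] cancel, which is what the weight 1 / (2 tau1) in the Lyapunov function
   is made for. *)
have -> : T * (sc v * (m + alpha * d)) * d +
    (2 * tau1)^-1 * (2 * m * (T * (tau1 * (m - d))) * sc v + m ^+ 2 * s') =
    T * sc v * (alpha * d ^+ 2) + T * sc v * m ^+ 2 + q.
  by rewrite /q; field; rewrite gt_eqF.
rewrite -[leLHS]add0r -addrA lerD//.
  apply: mulr_ge0; first by rewrite mulr_ge0// ltW.
  by rewrite mulr_ge0// sqr_ge0.
(* The loss from the scaling takes the share |v| / (|v| + epsilon) of the quadratic term, so the
   share epsilon / (|v| + epsilon) survives; it and [sc v] are smallest at |v| = [B]. *)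
apply: (@le_trans _ _ (T * (sc v * epsilon / (`|v| + epsilon)) * m ^+ 2)).
  rewrite ler_wpM2r ?sqr_ge0// ler_wpM2l ?(ltW T0)//.
  rewrite -!mulrA ler_pM ?(ltW (scaling_gt0 _ _ _))//.
  - by rewrite divr_ge0// ltW.
  - by apply: scaling_anti => //; rewrite (ger0_norm B0).
  - by rewrite ler_pM2l// lef_pV2 ?posrE// lerD2r.
rewrite -lerBlDl (le_trans _ qge)//.
by rewrite le_eqVlt; apply/orP; left; apply/eqP; field; rewrite gt_eqF.
Qed.

Variables (y m v : R -> 'rV[R]_n) (L B T : R).
Hypotheses (L_gt0 : 0 < L) (T_gt0 : 0 < T)
  (yL : forall s t, `|y s - y t| <= L * `|s - t|)
  (mL : forall s t, `|m s - m t| <= L * `|s - t|)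
  (vL : forall s t, `|v s - v t| <= L * `|s - t|)
  (mB : forall t, `|m t| <= B) (vB : forall t, `|v t| <= B)
  (incl : forall (t : R) (y' m' v' : 'rV[R]_n), 0 < t < 1 ->
    (forall i, is_derive t 1 (fun s => y s 0 i) (y' 0 i)) ->
    (forall i, is_derive t 1 (fun s => m s 0 i) (m' 0 i)) ->
    (forall i, is_derive t 1 (fun s => v s 0 i) (v' 0 i)) ->
    exists d u, [/\ D (y t) d, U (y t, m t, v t) u,
      forall i, y' 0 i = T * (sc (v t 0 i) * (m t 0 i + alpha * d 0 i)),
      forall i, m' 0 i = T * (tau1 * (m t 0 i - d 0 i)) &
      forall i, v' 0 i = T * (tau2 * (v t 0 i - u 0 i))]).

(** The sign condition bounds sgn(v) (v - u) by (1 - kappa) |v|, and the condition relating kappa,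
    gamma, tau2 and tau1 turns the resulting factor (1 - kappa) gamma tau2 into 2 tau1, exactly what
    [lyapunov_rate] can absorb. *)
Lemma scaling_rate_ge (x0 m0 u : 'rV[R]_n) i (s' t : R) :
  U (x0, m0, v t) u ->
  is_derive t 1 (fun s => v s 0 i) (T * (tau2 * (v t 0 i - u 0 i))) ->
  is_derive t 1 (fun s => sc (v s 0 i)) s' ->
  - (2 * tau1) * T * (sc (v t 0 i) * `|v t 0 i| / (`|v t 0 i| + epsilon)) <= s'.
Proof.
move=> Uu dv ds.
have sv := scaling_gt0 gamma epsilon_gt0 (v t 0 i); rewrite -/sc in sv.
have ve : 0 < `|v t 0 i| + epsilon by rewrite ltr_wpDl.
have [vi|vi] := eqVneq (v t 0 i) 0.
  suff -> : s' = 0 by rewrite vi normr0 mulr0 mul0r mulr0.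
  apply: (is_derive_at_max ds) => s.
  by apply: scaling_anti => //; rewrite vi normr0.
have -> := is_derive_unique ds (is_derive_scaling gamma epsilon_gt0 vi dv).
have /andP[_ ku] := U_sign Uu i.
have sgv : Num.sg (v t 0 i) * (v t 0 i - u 0 i) <= (1 - kappa) * `|v t 0 i|.
  by rewrite mulrBr -normrEsg mulrBl mul1r lerD2l lerN2.
rewrite -/sc; set q := sc (v t 0 i) / (`|v t 0 i| + epsilon).
have q0 : 0 <= q by rewrite divr_ge0// ltW.
have -> : - gamma * q * (Num.sg (v t 0 i) * (T * (tau2 * (v t 0 i - u 0 i)))) =
   - (gamma * tau2 * (Num.sg (v t 0 i) * (v t 0 i - u 0 i)) * (T * q)) by ring.
have -> : - (2 * tau1) * T * (sc (v t 0 i) * `|v t 0 i| / (`|v t 0 i| + epsilon)) =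
   - (2 * tau1 * `|v t 0 i| * (T * q)).
  by rewrite /q; field; rewrite gt_eqF.
rewrite lerN2; apply: ler_wpM2r; first by rewrite mulr_ge0// ltW.
rewrite (@le_trans _ _ (gamma * tau2 * ((1 - kappa) * `|v t 0 i|)))//.
  by rewrite ler_wpM2l// mulr_ge0// ltW.
rewrite [leLHS](_ : _ = (1 - kappa) * gamma * tau2 * `|v t 0 i|); last by ring.
by rewrite ler_wpM2r.
Qed.

(** Integrating [lyapunov_rate] bounds a positive multiple of the integral of |m|^2 by the increase
    of [lyapunov], which is assumed to be at most 0. So m vanishes on the interval, its equation
    then forces [d = 0] at almost every time, and the closed graph carries this to time 1, where the
    original window starts. *)
Lemma lyapunov_descent :
  lyapunov (y 1, m 1, v 1) <= lyapunov (y 0, m 0, v 0) -> m 1 = 0 /\ D (y 1) 0.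
Proof.
have Li F (w : R -> 'rV[R]_n) i : w = F -> (forall s t, `|w s - w t| <= L * `|s - t|) ->
    forall s t, `|w s 0 i - w t 0 i| <= L * `|s - t|.
  move=> _ wL s t; rewrite (le_trans _ (wL s t))//.
  by have := ler_coord_norm (w s - w t) i; rewrite !mxE.
have [Ls Ls0 scL] := scaling_lipschitz gamma_ge0 epsilon_gt0.
have B0 : 0 <= B := le_trans (normr_ge0 _) (mB 0).
have miB t i : `|m t 0 i| <= B := le_trans (ler_coord_norm _ _) (mB t).
have viB t i : `|v t 0 i| <= B := le_trans (ler_coord_norm _ _) (vB t).
have sL i s t : `|sc (v s 0 i) - sc (v t 0 i)| <= (Ls * L + 1) * `|s - t|.
  rewrite (le_trans (scL _ _))// mulrDl mul1r ler_wpDr// -mulrA ler_wpM2l//.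
  exact: (Li _ _ _ erefl vL).
have LsL : 0 < Ls * L + 1 by rewrite ltr_wpDl// mulr_ge0// ltW.
pose e0 := epsilon `^ (- gamma).
have scB t i : `|sc (v t 0 i)| <= e0.
  rewrite ger0_norm; last exact/ltW/scaling_gt0.
  exact: scaling_le.
(* As a product of bounded Lipschitz functions, [Q i] is Lipschitz and so is the integral of its
   almost everywhere derivative [wQ i], although the scaling need not be smooth. *)
pose Q i t := m t 0 i * m t 0 i * sc (v t 0 i).
have mmB t i : `|m t 0 i * m t 0 i| <= B * B by rewrite normrM ler_pM.
have mmL i := bounded_lipschitzM (fun t => miB t i) (fun t => miB t i)
  (Li _ _ i erefl mL) (Li _ _ i erefl mL).
have QL0 i := bounded_lipschitzM (fun t => mmB t i) (fun t => scB t i) (mmL i) (sL i).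
pose LQ := B * B * (Ls * L + 1) + (B * L + L * B) * e0 + 1.
have LQ0 : 0 < LQ.
  have L0 := ltW L_gt0; rewrite ltr_wpDl// addr_ge0// ?mulr_ge0 ?(ltW LsL)//.
  - by rewrite addr_ge0 // mulr_ge0.
  - exact: powR_ge0.
have QL i s t : `|Q i s - Q i t| <= LQ * `|s - t|.
  rewrite (le_trans (QL0 i s t))// ler_wpM2r//.
  by rewrite /LQ lerDl.
have [wy wyP] := choice (fun i => lipschitz_ftc L_gt0 (Li _ _ i erefl yL)).
have [wm wmP] := choice (fun i => lipschitz_ftc L_gt0 (Li _ _ i erefl mL)).
have [wv wvP] := choice (fun i => lipschitz_ftc L_gt0 (Li _ _ i erefl vL)).
have [ws wsP] := choice (fun i => lipschitz_ftc LsL (sL i)).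
have [wQ wQP] := choice (fun i => lipschitz_ftc LQ0 (QL i)).
pose c := T * (sc B * epsilon / (B + epsilon)).
have c0 : 0 < c.
  rewrite mulr_gt0// divr_gt0// ?mulr_gt0 ?ltr_wpDl//; exact: scaling_gt0.
pose phi t := \sum_(i < n) m t 0 i ^+ 2.
(* An integrable lower bound for the integrand of the path integral in which the element [d] of [D]
   no longer appears, so that [d] need not be chosen measurably in [t]. *)
pose q t := c * phi t - (2 * tau1)^-1 * \sum_(i < n) wQ i t.
have aeF : Filter (nbhs (almost_everywhere mu)) := ae_filter_ringOfSetsType mu.
have aeD : {ae mu, forall t : R, forall i, 0 < t < 1 ->
  [/\ is_derive t 1 (fun s => y s 0 i) (wy i t),
      is_derive t 1 (fun s => m s 0 i) (wm i t),
      is_derive t 1 (fun s => v s 0 i) (wv i t),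
      is_derive t 1 (fun s => sc (v s 0 i)) (ws i t) &
      is_derive t 1 (Q i) (wQ i t)]}.
  apply: ae_forall_ord => i.
  have [_ _ d1 _] := wyP i; have [_ _ d2 _] := wmP i; have [_ _ d3 _] := wvP i.
  have [_ _ d4 _] := wsP i; have [_ _ d5 _] := wQP i.
  apply: filterS2 (filterI d1 d2) (filterI d3 (filterI d4 d5)) => t [e1 e2] [e3 [e4 e5]] t01.
  by split; [exact: e1|exact: e2|exact: e3|exact: e4|exact: e5].
have key : {ae mu, forall t : R, 0 < t < 1 -> exists d : 'rV[R]_n,
    [/\ D (y t) d, forall i, wm i t = T * (tau1 * (m t 0 i - d 0 i)) &
        q t <= sup [set dotv (derive1 y t) w | w in D (y t)]]}.
  apply: filterS aeD => t Ht t01.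
  pose y' : 'rV[R]_n := \row_i wy i t; pose m' : 'rV[R]_n := \row_i wm i t.
  pose v' : 'rV[R]_n := \row_i wv i t.
  have [||| d [u [Dd Uu y'E m'E v'E]]] := @incl t y' m' v' t01.
  - by move=> i; have [e1 _ _ _ _] := Ht i t01; rewrite mxE.
  - by move=> i; have [_ e1 _ _ _] := Ht i t01; rewrite mxE.
  - by move=> i; have [_ _ e1 _ _] := Ht i t01; rewrite mxE.
  have dy : derive1 y t = y'.
    by apply: derive1_rV => i; have [e1 _ _ _ _] := Ht i t01; rewrite mxE.
  exists d; split => //; first by move=> i; rewrite -m'E mxE.
  rewrite dy (le_trans _ (le_sup_dotv y' (@D_compact (y t)) Dd))//.
  rewrite /q /dotv lerBlDr mulr_sumr /phi mulr_sumr -big_split/=.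
  apply: ler_sum => i _; have [e1 e2 e3 e4 e5] := Ht i t01.
  apply: (@lyapunov_rate T B (m t 0 i) (v t 0 i) (d 0 i) (u 0 i) _ (wm i t) (ws i t)) => //.
  - by rewrite -m'E mxE.
  - apply: (scaling_rate_ge Uu _ e4).
    by rewrite -v'E mxE.
  - have dmm := is_deriveM e2 e2; have dQ := is_deriveM dmm e4.
    rewrite (is_derive_unique e5 dQ) mulrfctE /GRing.scale/=; ring.
have iwQ i : mu.-integrable `[0, 1]%classic (fun t => (wQ i t)%:E).
  by have [mw wL _ _] := wQP i; exact: (bounded_integrable01 mw wL).
have cm i : continuous (fun t => m t 0 i : R^o).
  exact: (@lipschitz_continuous R R^o R^o _ L (Li _ _ i erefl mL)).
have mphi : measurable_fun [set: R] phi.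
  apply: measurable_sum => i.
  apply: measurable_funX; apply: continuous_measurable_fun; exact: cm.
have phi0 t : 0 <= phi t by apply: sumr_ge0 => i _; exact: sqr_ge0.
have iphi : mu.-integrable `[0, 1]%classic (fun t => (phi t)%:E).
  apply: (@bounded_integrable01 _ phi (n%:R * (B ^+ 2))) => // t.
  rewrite ger0_norm// /phi (@le_trans _ _ (\sum_(i < n) B ^+ 2))//.
    apply: ler_sum => i _; rewrite -real_normK ?num_real//.
    by rewrite ler_sqr ?nnegrE.
  by rewrite sumr_const card_ord mulr_natl.
have isum : mu.-integrable `[0, 1]%classic (fun t => (\sum_(i < n) wQ i t)%:E).
  rewrite (_ : (fun t => _) = (fun t => \sum_(i < n) (wQ i t)%:E)%E).
    by apply: integrable_sum => // i _; exact: iwQ.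
  by apply/funext => t; rewrite sumEFin.
have intq : (\int[mu]_(t in `[0%R, 1%R]) (q t)%:E)%E =
    (c%:E * \int[mu]_(t in `[0%R, 1%R]) (phi t)%:E -
     ((2 * tau1)^-1 * \sum_(i < n) (Q i 1 - Q i 0))%:E)%E.
  transitivity (\int[mu]_(t in `[0%R, 1%R])
      (c%:E * (phi t)%:E - (2 * tau1)^-1%:E * (\sum_(i < n) wQ i t)%:E))%E.
    by apply: eq_integral => t _; rewrite -!EFinM -EFinB.
  rewrite integralB//; [|exact: integrableZl|exact: integrableZl].
  rewrite !integralZl//; congr (_ - _)%E; rewrite EFinM; congr (_ * _)%E.
  transitivity (\int[mu]_(t in `[0%R, 1%R]) \sum_(i < n) (wQ i t)%:E)%E.
    by apply: eq_integral => t _; rewrite sumEFin.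
  rewrite integral_sum//= -sumEFin; apply: eq_bigr => i _.
  by have [_ _ _ ->] := wQP i.
have fy := fD (lipschitz_abs_continuous yL) erefl erefl.
(* The path integral runs over the closed interval, while the derivatives are known only inside; the
   two endpoints are null. *)
have ne0 (a : R) : {ae mu, forall t : R, t != a}.
  exists [set a]; split => //; first exact: lebesgue_measure_set1.
  by move=> t /= /negP; rewrite negbK => /eqP.
have qf : (\int[mu]_(t in `[0%R, 1%R]) (q t)%:E <= path_integral D y)%E.
  apply: ae_le_integral_nonmeasurable.
  apply: filterS2 key (filterI (ne0 0) (ne0 1)) => t Ht [t0 t1] /=.
  rewrite in_itv/= => /andP[t0' t1'].
  by have [|d [_ _]] := Ht; rewrite ?lee_fin// lt_neqAle eq_sym t0 t0' lt_neqAle t1 t1'.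
move=> lyap.
have iphi0 : (\int[mu]_(t in `[0%R, 1%R]) `|(phi t)%:E| = 0)%E.
  under eq_integral do rewrite abse_EFin ger0_norm//.
  have : (0 <= \int[mu]_(t in `[0%R, 1%R]) (phi t)%:E)%E.
    by apply: integral_ge0 => t _; rewrite lee_fin.
  rewrite intq in qf; move: qf fy.
  set J := (\int[mu]_(t in _) (phi t)%:E)%E; set PI := path_integral D y.
  move=> qf fy.
  case: PI => [r| |] //= in qf fy *; rewrite ?addeNy ?addey// in fy *.
  move: fy => [fy]; case: J qf => [j| |] //=; last first.
    by rewrite gt0_muley ?lte_fin.
  rewrite -EFinM -EFinB !lee_fin => cj j0.
  have : c * j <= 0.
    have QE t : \sum_(i < n) (m t 0 i ^+ 2 * scaling gamma epsilon (v t 0 i)) =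
        \sum_(i < n) Q i t by apply: eq_bigr => i _; rewrite expr2.
    move: lyap; rewrite /lyapunov/= !QE; move: cj; rewrite sumrB mulrBr fy.
    move: (_ * \sum_(i < n) Q i 1) (_ * \sum_(i < n) Q i 0) (c * j) => a1 a2 a3.
    by lra.
  by rewrite pmulr_rle0// => j0'; congr (_%:E); apply/eqP; rewrite eq_le j0 j0'.
have mphiD : measurable_fun (`[0, 1]%classic : set R) (EFin \o phi).
  exact/measurable_EFinP/measurable_funTS.
have phiae : {ae mu, forall t : R, 0 < t < 1 -> phi t = 0}.
  have := (ae_eq_integral_abs mu (measurable_itv `[0, 1]) mphiD).1 iphi0.
  apply: filterS => t Ht /andP[t0 t1]; have := Ht _; rewrite /= in_itv/= !ltW//.
  by move=> /(_ isT)[].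
(* A nonzero entry of [m t] would stay nonzero within distance [e] of [t] by the Lipschitz bound,
   but [phi] vanishes almost everywhere. *)
have m0 t : 0 <= t <= 1 -> m t = 0.
  move=> /andP[t0 t1]; apply/rowP => i; rewrite mxE; apply: contrapT => /eqP mt0.
  pose e := `|m t 0 i| / L.
  have e0' : 0 < e by rewrite divr_gt0// normr_gt0.
  have me s : t - e < s < t + e -> phi s != 0.
    move=> se; apply/eqP => /eqP; rewrite psumr_eq0 => [|j _]; last exact: sqr_ge0.
    move=> /allP/(_ i); rewrite mem_index_enum sqrf_eq0 => /(_ isT)/eqP msi.
    have := Li _ _ i erefl mL t s; rewrite msi subr0 leNgt => /negP; apply.
    by rewrite mulrC -ltr_pdivlMr// distrC ltr_distl.
  have [|||s /andP[s1 s2] phis] := @ae_exists_itv R _ (Num.max 0 (t - e)) (Num.min 1 (t + e)) _ _ _ phiae.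
  - by rewrite le_max lexx.
  - rewrite gt_max !lt_min ltr01 /=; apply/andP; split; first by rewrite ltr_wpDl.
    by rewrite (lt_le_trans _ t1) ?ltrBlDr ?ltrDl//=; lra.
  - by rewrite ge_min lexx.
  move: s1 s2; rewrite gt_max lt_min => /andP[_ s1] /andP[_ s2].
  by have := me s; rewrite s1 s2 phis eqxx => /(_ isT).
split; first by apply: m0; rewrite ler01 lexx.
(* With [m] identically 0 its derivative [T * (tau1 * (m - d))] is 0 as well, and both factors are
   positive. *)
have D0ae : {ae mu, forall t : R, 0 < t < 1 -> D (y t) 0}.
  apply: filterS2 aeD key => t Ht Hk t01; have [d [Dd dE _]] := Hk t01.
  suff <- : d = 0 by [].
  apply/rowP => i; rewrite mxE; have [_ e2 _ _ _] := Ht i t01.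
  have : is_derive t 1 (fun s => m s 0 i) 0.
    apply: near_eq_is_derive (is_derive_cst (0 : R) t 1).
    near=> s; rewrite m0 ?mxE//; apply/andP; split; apply: ltW; near: s.
      by apply: lt_nbhsr; have /andP[] := t01.
    by apply: lt_nbhsl; have /andP[] := t01.
  move=> /(is_derive_unique e2); rewrite dE m0 ?mxE.
    move/eqP; rewrite !mulf_eq0 (gt_eqF T_gt0) (gt_eqF tau1_gt0)/= sub0r oppr_eq0.
    by move/eqP.
  by have /andP[? ?] := t01; rewrite !ltW.
apply: contrapT => D10.
have near1 : \forall t \near (1 : R), ~ D (y t) 0.
  have cy : {for 1, continuous y} by apply: (@lipschitz_continuous R R^o _ y L).
  have := closed_graph_near_disjoint D_closed (@compact_set1 _ (0 : 'rV[R]_n)) (p := y 1).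
  move=> /(_ _)/wrap[|/cy]; first by move=> w ->.
  move=> H; have {}H : \forall t \near (1 : R), forall w, [set 0] w -> ~ D (y t) w := H.
  by apply: filterS H => t; apply.
have [e /= e0' He] := (nbhs_ballP _ _).1 near1.
have [|||t /andP[t1 t2] Dt] := @ae_exists_itv R _ (Num.max 0 (1 - e)) 1 _ _ _ D0ae => //.
- by rewrite le_max lexx.
- by rewrite gt_max ltr01 /= ltrBlDr ltrDl.
apply: (He t) => //; rewrite -ball_normE/=.
move: t1; rewrite gt_max => /andP[_ t1].
by rewrite ltr_distl; apply/andP; split; lra.
Unshelve. all: by end_near. Qed.

End lyapunov.

(** * Triples of vectors and regularity of the set-valued mapping G *)

Section triples.
Context {R : realType} {n : nat}.
Implicit Types p q : triple R n.

Lemma triple_normE p : `|p| = Num.max (Num.max `|p.1.1| `|p.1.2|) `|p.2|.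
Proof. by rewrite !prod_normE. Qed.

Lemma triple_norm_le p (c : R) :
  (`|p| <= c) = [&& `|p.1.1| <= c, `|p.1.2| <= c & `|p.2| <= c].
Proof. by rewrite triple_normE !ge_max andbA. Qed.

Lemma ler_norm_triple p :
  [/\ `|p.1.1| <= `|p|, `|p.1.2| <= `|p| & `|p.2| <= `|p|].
Proof. by have := lexx `|p|; rewrite {1}triple_norm_le => /and3P. Qed.

Lemma ler_norm_enorm3 p : `|p| <= enorm3 p.
Proof.
have sq (a : R) : 0 <= a ^+ 2 by exact: sqr_ge0.
have le (a b : R) : 0 <= a -> a ^+ 2 <= b -> a <= Num.sqrt b.
  by move=> a0 ab; rewrite -[leLHS]ger0_norm// -sqrtr_sqr ler_wsqrtr.
have e0 (u : 'rV[R]_n) : 0 <= enorm u := sqrtr_ge0 _.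
rewrite triple_norm_le /enorm3; apply/and3P; split; (apply: le_trans (ler_norm_enorm _) _);
  apply: le => //.
- by rewrite -addrA lerDl addr_ge0.
- by rewrite addrAC lerDr addr_ge0.
- by rewrite lerDr addr_ge0.
Qed.

Lemma compact_ball_triple (c : R) : compact [set p : triple R n | `|p| <= c].
Proof.
rewrite (_ : mkset _ = ([set u : 'rV[R]_n | `|u| <= c] `*`
  [set u : 'rV[R]_n | `|u| <= c]) `*` [set u : 'rV[R]_n | `|u| <= c]).
  apply: compact_setX; last exact: compact_ball_rV.
  by apply: compact_setX; exact: compact_ball_rV.
apply/seteqP; split => p /=; rewrite triple_norm_le; first by move=> /and3P[].
by move=> [[-> ->] ->].
Qed.

End triples.

Lemma convex_setI01 (R : realType) (M : lmodType R) (A : set M) :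
  (forall x y (t : R), A x -> A y -> 0 <= t <= 1 -> A (t *: x + (1 - t) *: y)) ->
  convex_set A.
Proof.
move=> cA x y k /set_mem Ax /set_mem Ay; apply/mem_set.
by apply: cA => //; apply/andP; split; [exact: ge0|exact: le1].
Qed.

Lemma locally_bounded_compact (R : realType) (V : topologicalType)
    (W : normedModType R) (G : V -> set W) (K : set V) :
  compact K ->
  (forall p : V, exists M : R, \forall q \near p, forall w, G q w -> `|w| <= M) ->
  exists2 M : R, 0 <= M & forall p w, K p -> G p w -> `|w| <= M.
Proof.
move=> /compact_near_coveringP cK GM.
have H p : K p -> \forall q \near p & M \near +oo%R, forall w, G q w -> `|w| <= M.
  move=> Kp; have [M Mp] := GM p.
  exists ([set q | forall w, G q w -> `|w| <= M], [set M' | M <= M']).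
    by split => //=; exact: (nbhs_pinfty_ge (num_real M)).
  by move=> [q M'] /= [qM MM'] w Gw; rewrite (le_trans (qM _ Gw)).
have HM : \forall M \near +oo%R, K `<=` (fun q => forall w, G q w -> `|w| <= M).
  by apply: cK; exact: H.
near (+oo%R : set_system R) => M; exists M.
  by near: M; exact: (nbhs_pinfty_ge (num_real 0)).
have : K `<=` (fun q => forall w, G q w -> `|w| <= M) by near: M.
by move=> KM p w Kp; exact: KM.
Unshelve. all: by end_near. Qed.

Section adam_map.
Context {R : realType} {n : nat}.
Variables (D : 'rV[R]_n -> set 'rV[R]_n) (U : triple R n -> set 'rV[R]_n).
Variables (alpha gamma epsilon tau1 tau2 : R).
Hypotheses (gamma_ge0 : 0 <= gamma) (epsilon_gt0 : 0 < epsilon)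
  (alpha_ge0 : 0 <= alpha) (tau1_gt0 : 0 < tau1) (tau2_gt0 : 0 < tau2).
Hypotheses (D_closed : closed_graph D) (D_convex : forall x, convex_set (D x))
  (D_bounded : forall x : 'rV[R]_n, exists M : R, \forall q \near x, forall w, D q w -> `|w| <= M)
  (U_closed : closed_graph U) (U_convex : forall z, convex_set (U z))
  (U_bounded : forall z : triple R n, exists M : R, \forall q \near z, forall w, U q w -> `|w| <= M).
Let G := adam_map alpha gamma epsilon tau1 tau2 D U.
Let sc := scaling gamma epsilon.

Lemma adam_mapP (p w : triple R n) : G p w <-> exists d u, [/\ D p.1.1 d, U p u,
  forall i, w.1.1 0 i = sc (p.2 0 i) * (p.1.2 0 i + alpha * d 0 i),
  forall i, w.1.2 0 i = tau1 * (p.1.2 0 i - d 0 i) &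
  forall i, w.2 0 i = tau2 * (p.2 0 i - u 0 i)].
Proof.
case: p w => [[x m] v] [[w1 w2] w3]; rewrite /G/=; split.
  move=> [d [u [Dd Uu [-> -> ->]]]]; exists d, u; split => //= i; rewrite !mxE//.
    by rewrite mulrBr.
  by rewrite mulrBr.
move=> [d [u [Dd Uu e1 e2 e3]]]; exists d, u; split => //.
congr (_, _, _); apply/rowP => i; rewrite !mxE ?e1 ?e2 ?e3//=; first by rewrite mulrBr.
by rewrite mulrBr.
Qed.

(** Since tau1 and tau2 are nonzero, [d] and [u] are functions of [p] and [w]. Without existential
    quantifiers the graph is an intersection of preimages of closed sets under continuous maps. *)
Lemma adam_map_graphE (p w : triple R n) : G p w <->
  [/\ D p.1.1 (p.1.2 - tau1^-1 *: w.1.2), U p (p.2 - tau2^-1 *: w.2) &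
   forall i, w.1.1 0 i - sc (p.2 0 i) *
     (p.1.2 0 i + alpha * (p.1.2 0 i - tau1^-1 * w.1.2 0 i)) = 0].
Proof.
rewrite adam_mapP; split.
  move=> [d [u [Dd Uu e1 e2 e3]]].
  have <- : d = p.1.2 - tau1^-1 *: w.1.2.
    by apply/rowP => i; rewrite !mxE e2 mulKf ?gt_eqF// opprB addrCA subrr addr0.
  have <- : u = p.2 - tau2^-1 *: w.2.
    by apply/rowP => i; rewrite !mxE e3 mulKf ?gt_eqF// opprB addrCA subrr addr0.
  split => // i; rewrite e1 e2 mulKf ?gt_eqF// opprB [p.1.2 0 i + (d 0 i - _)]addrCA.
  by rewrite subrr addr0 subrr.
move=> [Dd Uu e]; exists (p.1.2 - tau1^-1 *: w.1.2), (p.2 - tau2^-1 *: w.2).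
split => // i; rewrite !mxE.
- by apply/eqP; rewrite -subr_eq0 e.
- by rewrite opprB addrCA subrr addr0 mulVKf ?gt_eqF.
- by rewrite opprB addrCA subrr addr0 mulVKf ?gt_eqF.
Qed.

Lemma adam_map_convex p : convex_set (G p).
Proof.
apply: convex_setI01 => w w' t /adam_mapP[d [u [Dd Uu e1 e2 e3]]].
move=> /adam_mapP[d' [u' [Dd' Uu' e1' e2' e3']]] t01; apply/adam_mapP.
exists (t *: d + (1 - t) *: d'), (t *: u + (1 - t) *: u').
split; [exact: (convex_setP (@D_convex _))|exact: (convex_setP (@U_convex _))|..] => i;
  rewrite /= !mxE.
- by rewrite e1 e1'; ring.
- by rewrite e2 e2'; ring.
- by rewrite e3 e3'; ring.
Qed.

Lemma adam_map_closed : closed_graph G.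
Proof.
have fstc (T V W : topologicalType) (h : T -> V * W) :
  continuous h -> continuous (fun t => (h t).1).
  by move=> ch t; apply: cvg_comp (ch t) _; exact: cvg_fst.
have sndc (T V W : topologicalType) (h : T -> V * W) :
  continuous h -> continuous (fun t => (h t).2).
  by move=> ch t; apply: cvg_comp (ch t) _; exact: cvg_snd.
have pairc (T V W : topologicalType) (h : T -> V) (k : T -> W) :
    continuous h -> continuous k -> continuous (fun t => (h t, k t)).
  by move=> ch ck t; exact: cvg_pair (ch t) (ck t).
have subc (T : topologicalType) (a : R) (h k : T -> 'rV[R]_n) :
    continuous h -> continuous k -> continuous (fun t => h t - a *: k t).
  by move=> ch ck t; apply: cvgB; [exact: ch|apply: cvgZr; exact: ck].
pose E := (triple R n * triple R n)%type.
have c1 : continuous (fun p : E => p.1) by apply: fstc => p; exact: cvg_id.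
have c2 : continuous (fun p : E => p.2) by apply: sndc => p; exact: cvg_id.
have c11 := fstc _ _ _ _ c1; have c111 := fstc _ _ _ _ c11.
have c112 := sndc _ _ _ _ c11; have c12 := sndc _ _ _ _ c1.
have c21 := fstc _ _ _ _ c2; have c211 := fstc _ _ _ _ c21.
have c212 := sndc _ _ _ _ c21; have c22 := sndc _ _ _ _ c2.
have coord (F : E -> 'rV[R]_n) i : continuous F -> continuous (fun p => F p 0 i : R^o).
  by move=> cF p; exact: (continuous_comp (cF p) (@coord_continuous R n i (F p))).
rewrite /closed_graph (_ : mkset _ =
  [set p : E | D p.1.1.1 (p.1.1.2 - tau1^-1 *: p.2.1.2)] `&`
  ([set p : E | U p.1 (p.1.2 - tau2^-1 *: p.2.2)] `&`
   \bigcap_(i in [set: 'I_n]) [set p : E | p.2.1.1 0 i - sc (p.1.2 0 i) *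
     (p.1.1.2 0 i + alpha * (p.1.1.2 0 i - tau1^-1 * p.2.1.2 0 i)) = 0])).
  apply: closedI.
    apply: (@preimage_closed _ _ (fun p : E => (p.1.1.1, p.1.1.2 - tau1^-1 *: p.2.1.2))
      [set p | D p.1 p.2]) => // p _.
    by apply: pairc; [exact: c111|exact: subc].
  apply: closedI.
    apply: (@preimage_closed _ _ (fun p : E => (p.1, p.1.2 - tau2^-1 *: p.2.2))
      [set p | U p.1 p.2]) => // p _.
    by apply: pairc; [exact: c1|exact: subc].
  apply: closed_bigI => i _.
  apply: (@preimage_closed _ _ (fun p : E => p.2.1.1 0 i - sc (p.1.2 0 i) *
     (p.1.1.2 0 i + alpha * (p.1.1.2 0 i - tau1^-1 * p.2.1.2 0 i)) : R^o)
     [set x | x = 0]); last exact: closed_eq.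
  move=> p _; apply: cvgB; first exact: coord.
  have [L _ scL] := scaling_lipschitz gamma_ge0 epsilon_gt0.
  apply: cvgM.
    exact: (continuous_comp (coord _ i c12 p) (@lipschitz_continuous R R^o R^o _ L scL _)).
  apply: cvgD; first exact: coord.
  apply: cvgMr; apply: cvgB; first exact: coord.
  by apply: cvgMr; exact: coord.
apply/seteqP; split => p /=; rewrite adam_map_graphE.
  by move=> [Dp Up e]; split => //; split => // i _; exact: e.
by move=> [Dp [Up e]]; split => // i; exact: (e i).
Qed.

Lemma adam_map_bounded (p : triple R n) : exists M : R,
  \forall q \near p, forall w, G q w -> `|w| <= M.
Proof.
have [MD HD] := @D_bounded p.1.1; have [MU HU] := @U_bounded p.
have HD' : \forall q \near p, forall w, D q.1.1 w -> `|w| <= MD.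
  have : (fun q : triple R n => q.1.1) x @[x --> p] --> p.1.1.
    by apply: cvg_comp; [exact: cvg_fst|exact: cvg_fst].
  by move=> /(_ _ HD).
have Hp : \forall q \near p, `|q| < `|p| + 1.
  have /cvgr_lt := @norm_continuous R (triple R n : normedModType R) p.
  by apply; rewrite ltrDl.
pose N := `|p| + 1; pose e0 := epsilon `^ (- gamma).
have N0 : 0 <= N by rewrite addr_ge0.
have e00 : 0 <= e0 by exact: powR_ge0.
pose M1 := e0 * (N + alpha * `|MD|); pose M2 := tau1 * (N + `|MD|).
pose M3 := tau2 * (N + `|MU|).
have M10 : 0 <= M1 by rewrite mulr_ge0// addr_ge0// mulr_ge0.
have M20 : 0 <= M2 by rewrite mulr_ge0 ?(ltW tau1_gt0)// addr_ge0.
have M30 : 0 <= M3 by rewrite mulr_ge0 ?(ltW tau2_gt0)// addr_ge0.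
exists (M1 + M2 + M3).
apply: filterS3 HD' HU Hp => q qD qU /ltW qN w /adam_mapP[d [u [Dd Uu e1 e2 e3]]].
have [_ q2 q3] := ler_norm_triple q.
have di i : `|d 0 i| <= `|MD|.
  by rewrite (le_trans (ler_coord_norm d i))// (le_trans (qD _ Dd))// ler_norm.
have ui i : `|u 0 i| <= `|MU|.
  by rewrite (le_trans (ler_coord_norm u i))// (le_trans (qU _ Uu))// ler_norm.
have mi i : `|q.1.2 0 i| <= N.
  by rewrite (le_trans (ler_coord_norm _ i))// (le_trans q2).
have vi i : `|q.2 0 i| <= N.
  by rewrite (le_trans (ler_coord_norm _ i))// (le_trans q3).
rewrite triple_norm_le; apply/and3P; split; apply: rV_norm_le; rewrite ?addr_ge0//= => i.
- rewrite e1 (@le_trans _ _ M1)//; last by rewrite -addrA lerDl addr_ge0.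
  rewrite normrM ler_pM//.
    by rewrite ger0_norm ?scaling_le// ltW// scaling_gt0.
  rewrite (le_trans (ler_normD _ _))// lerD// normrM (ger0_norm alpha_ge0).
  by rewrite ler_wpM2l.
- rewrite e2 (@le_trans _ _ M2)//; last by rewrite addrAC lerDr addr_ge0.
  rewrite normrM gtr0_norm// ler_pM2l// (le_trans (ler_normB _ _))//.
  by rewrite lerD.
- rewrite e3 (@le_trans _ _ M3)//; last by rewrite lerDr addr_ge0.
  rewrite normrM gtr0_norm// ler_pM2l// (le_trans (ler_normB _ _))//.
  by rewrite lerD.
Qed.

End adam_map.

(** * Convergence for deterministic noise paths *)

Lemma closed_approx (R : realType) (V : normedModType R) (A : set V) (p : V) :
  closed A -> (forall e : R, 0 < e -> exists2 w, A w & `|p - w| < e) -> A p.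
Proof.
move=> cA Ap; apply: cA => B /nbhs_ballP[e /= e0 eB].
by have [w Aw pw] := Ap _ e0; exists w; split => //; apply: eB; rewrite -ball_normE.
Qed.

(** A 1-Lipschitz retraction of the line onto the unit interval, used to extend a curve controlled
    only there to a Lipschitz curve on the whole line. *)
Lemma clampP (R : realType) : exists c : R -> R,
  [/\ forall t, 0 <= c t <= 1, forall t, 0 <= t <= 1 -> c t = t &
      forall s t, `|c s - c t| <= `|s - t|].
Proof.
exists (fun t => if t <= 0 then 0 else if t <= 1 then t else 1); split => [t|t|s t].
- by case: (leP t 0) => [_|t0]; [|case: (leP t 1) => [t1|_]];
    rewrite ?lexx ?ler01 ?t1 ?(ltW t0).
- by move=> /andP[t0 ->]; case: leP => // t0'; apply/eqP; rewrite eq_le t0.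
wlog st : s t / s <= t.
  by move=> H; have [/H//|/ltW/H] := leP s t; rewrite distrC (distrC s).
rewrite [leRHS]distrC [leRHS]ger0_norm ?subr_ge0// ler_norml.
by case: (leP s 0); case: (leP t 0); case: (leP t 1); case: (leP s 1) => *;
  apply/andP; split; lra.
Qed.

(** Counterpart of extracting a subsequence inside a set that is visited infinitely often. *)
Lemma ultra_frequent (T : Type) (F : set_system T) (S : set T) :
  ProperFilter F -> ~ F (~` S) ->
  exists V, [/\ UltraFilter V, F `<=` V & V S].
Proof.
move=> FF nFS.
have FS : ProperFilter (within S F).
  split; last exact: within_filter.
  by rewrite /within/= => F0; apply: nFS; apply: filterS F0 => x + Sx; exact.
have [V [VV FV]] := ultraFilterLemma FS.
exists V; split => // [A FA|]; first by apply: FV; apply: filterS FA.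
by apply: FV; exact: (@filterE _ F).
Qed.

Lemma cvg_ultra (T : Type) (E : topologicalType) (F : set_system T) (f : T -> E) (l : E) :
  ProperFilter F ->
  (forall V, UltraFilter V -> F `<=` V -> f x @[x --> V] --> l) ->
  f x @[x --> F] --> l.
Proof.
move=> FF fl B Bl; apply: contrapT => nB.
have [|V [VV FV VnB]] := @ultra_frequent T F (~` (f @^-1` B)) FF.
  by rewrite setCK.
have VB := fl V VV FV B Bl.
by have [x [/= Bx]] := @filter_ex _ V _ _ (@filterI _ V _ _ _ VB VnB).
Qed.

Lemma real_limit_unique (R : realType) (T : Type) (F : set_system T) (u : T -> R)
    (a b : R) : ProperFilter F ->
  u x @[x --> F] --> a -> u x @[x --> F] --> b -> a = b.
Proof.
move=> FF ua ub.
by rewrite -(cvg_lim (@Rhausdorff R) ua) -(cvg_lim (@Rhausdorff R) ub).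
Qed.

Lemma cvg_triple1 (R : realType) (n : nat) (T : Type) (F : set_system T)
    (u : T -> triple R n) (p : triple R n) : Filter F ->
  u x @[x --> F] --> p -> (u x).1.1 @[x --> F] --> p.1.1.
Proof.
move=> FF up; have p1 : q.1.1 @[q --> p] --> p.1.1.
  by apply: cvg_comp; [exact: cvg_fst|exact: cvg_fst].
exact: cvg_comp up p1.
Qed.

(** [e] is the first index from [k] on at level at least [c2], and [s] is the last one before [e] at
    level at most [c1]. *)
Lemma upcrossing (R : realType) (h : nat -> R) (c1 c2 : R) (k l : nat) :
  (k <= l)%N -> h k <= c1 -> c1 < c2 -> c2 <= h l ->
  exists s e, [/\ (k <= s)%N, (s < e)%N, h s <= c1, c2 <= h e &
    forall i, (s < i < e)%N -> c1 < h i < c2].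
Proof.
move=> kl hk c12 hl.
have : exists e, (k <= e)%N && (c2 <= h e) by exists l; rewrite kl.
move=> /ex_minnP[e /andP[ke c2e] emin].
pose P i := [&& (k <= i)%N, (i < e)%N & h i <= c1].
have Pk : exists i, P i.
  exists k; rewrite /P leqnn hk andbT ltn_neqAle ke andbT.
  by apply: contraTneq c2e => <-; rewrite -ltNge (le_lt_trans hk).
have Pe i : P i -> (i <= e)%N by move=> /and3P[_ /ltnW].
case: (ex_maxnP Pk Pe) => s /and3P[ks se hs] smax.
exists s, e; split => // i /andP[si ie].
have ki := leq_trans ks (ltnW si).
rewrite !ltNge; apply/andP; split; apply/negP => hi.
  by have := smax i; rewrite /P ki ie hi leqNgt si => /(_ isT).
by have := emin i; rewrite ki hi leqNgt ie => /(_ isT).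
Qed.

Lemma empty_interior_between (R : realType) (A : set R) (a b : R) :
  A^° = set0 -> a < b -> exists2 c, a < c < b & ~ A c.
Proof.
move=> A0 ab; apply: contrapT => nc.
have abA : `]a, b[ `<=` A.
  move=> c; rewrite /= in_itv/= => acb; apply: contrapT => nA.
  by apply: nc; exists c.
suff : A^° ((a + b) / 2) by rewrite A0.
apply: filterS abA _; apply: near_in_itvoo.
by rewrite in_itv/= !midf_lt.
Qed.

Section adam_flow.
Context {R : realType} {n : nat}.
Variables (f : 'rV[R]_n -> R) (D : 'rV[R]_n -> set 'rV[R]_n)
  (U : triple R n -> set 'rV[R]_n).
Variables (alpha gamma epsilon tau1 tau2 kappa : R).
Hypotheses (f_lip : locally_lipschitz f) (fD : is_potential f D)
  (D_closed : closed_graph D) (D_compact : forall x, compact (D x))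
  (D_convex : forall x, convex_set (D x)) (D_nonempty : forall x, D x !=set0).
Hypotheses (U_closed : closed_graph U) (U_convex : forall p, convex_set (U p))
  (U_bounded : forall p : triple R n, exists M : R,
     \forall q \near p, forall w, U q w -> `|w| <= M).
Hypotheses (alpha_ge0 : 0 <= alpha) (gamma_ge0 : 0 <= gamma)
  (epsilon_gt0 : 0 < epsilon) (tau1_gt0 : 0 < tau1) (tau2_gt0 : 0 < tau2)
  (U_sign : forall x0 m0 v0 u, U (x0, m0, v0) u -> forall i : 'I_n,
     0 <= kappa * `|v0 0 i| <= Num.sg (v0 0 i) * u 0 i)
  (kappa_cond : (1 - kappa) * gamma * tau2 <= 2 * tau1).
Let G := adam_map alpha gamma epsilon tau1 tau2 D U.
Let lyap := lyapunov f gamma epsilon tau1.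

Let G_closed : closed_graph G.
Proof. exact: adam_map_closed. Qed.

Let G_bounded (p : triple R n) : exists M : R, \forall q \near p, forall w, G q w -> `|w| <= M.
Proof.
by apply: adam_map_bounded => //; apply: (conservative_locally_bounded f_lip fD).
Qed.

Let G_convex p : convex_set (G p).
Proof. exact: adam_map_convex. Qed.

Let G_closed_value p : closed (G p).
Proof.
apply: (@preimage_closed _ _ (fun w => (p, w)) [set q | G q.1 q.2]) => // w _.
exact: cvg_pair (@cvg_cst _ p _ _ _) (@cvg_id _ _).
Qed.

Let G_compact p : compact (G p).
Proof.
have [M /nbhs_singleton GM] := G_bounded p.
rewrite (_ : G p = [set q : triple R n | `|q| <= M] `&` G p).
  by apply: compact_closedI => //; exact: (@compact_ball_triple R n M).
by apply/seteqP; split => [w Gw|w []//]; split => //; exact: GM.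
Qed.

Let G_usc (p : triple R n) (e : R) : 0 < e ->
  \forall q \near p, forall w, G q w -> exists2 u, G p u & `|w - u| < e.
Proof.
have [M GM] := G_bounded p.
exact: closed_graph_usc G_closed (@compact_ball_triple R n M) GM.
Qed.

Variables (z y g r zeta : nat -> triple R n) (eta : nat -> R) (M : R).
Hypotheses (z_rec : forall k,
    z k.+1 = z k - eta k *: g k - eta k *: r k - zeta k)
  (gG : forall k, G (y k) (g k))
  (zM : forall k, `|z k| <= M) (yM : forall k, `|y k| <= M)
  (yz : (y k - z k) @[k --> \oo] --> (0 : triple R n))
  (r0 : r k @[k --> \oo] --> (0 : triple R n))
  (eta0 : forall k, 0 < eta k) (eta_cvg : eta k @[k --> \oo] --> (0 : R))
  (eta_sum : series eta @ \oo --> +oo)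
  (noise : forall e : R, 0 < e -> \forall a \near \oo, forall b,
    (a <= b)%N -> elapsed eta a b <= 1 -> `|\sum_(a <= i < b) zeta i| <= e).

Lemma direction_bounded : exists C : R, forall k, `|g k| <= C.
Proof.
have [C _ CP] := locally_bounded_compact (@compact_ball_triple R n M) G_bounded.
by exists C => k; exact: CP (yM k) (gG k).
Qed.

Variable idx : nat -> R -> nat.
Hypothesis idxP : forall s t, 0 <= t ->
  [/\ (s <= idx s t)%N, elapsed eta s (idx s t) <= t & t < elapsed eta s (idx s t).+1].

(** Read backwards on [[0, T]], the limit curve ends at [p], and [lyapunov_descent] applies. The
    inclusion is known for right quotients of the limit curve, which are left quotients of the
    reversed one; where the latter is differentiable this is enough, the values of [G] being
    closed. *)
Lemma flow_critical (V : set_system nat) (p : triple R n) (T : R) :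
  UltraFilter V -> (\oo : set_system nat) `<=` V -> z s @[s --> V] --> p ->
  0 < T <= 1 -> lyap p <= lyap (limit_curve z idx V T) ->
  p.1.2 = 0 /\ D p.1.1 0.
Proof.
move=> VV Voo zp /andP[T0 T1] lyap_le.
have [C gC] := direction_bounded.
have C0 : 0 <= C := le_trans (normr_ge0 _) (gC 0%N).
have cK := @compact_ball_triple R n M.
pose Y := limit_curve z idx V; have Y0 : Y 0 = p by exact: limit_curve0 zp.
have Ylip s t : 0 <= s <= 1 -> 0 <= t <= 1 -> `|Y s - Y t| <= C * `|s - t|.
  by apply: (@limit_curve_lipschitz R _ z g r zeta eta _ C _ _ _ cK).
have Yinc t e : 0 <= t < 1 -> 0 < e -> \forall h \near 0^'+, exists2 w, G (Y t) w &
    `|h^-1 *: (Y (t + h) - Y t) + w| <= e.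
  by apply: (@limit_curve_inclusion R _ G z y g r zeta eta _ C _ _ _ _ _ _ _ _ cK).
have [c [c01 cid clip]] := clampP R.
(* The estimates on [Y] hold only on the unit interval; the retraction [c] makes [path] Lipschitz
   and bounded on the whole line. *)
pose path t := Y (T * (1 - c t)).
have Tc t : 0 <= T * (1 - c t) <= 1.
  have /andP[c0 c1] := c01 t.
  by rewrite mulr_ge0 ?(ltW T0) ?subr_ge0// mulr_ile1 ?(ltW T0) ?subr_ge0// gerBl.
have path1 : path 1 = p by rewrite /path cid ?ler01 ?lexx// subrr mulr0.
have path0 : path 0 = Y T by rewrite /path cid ?ler01 ?lexx// subr0 mulr1.
have pathL s t : `|path s - path t| <= (C + 1) * `|s - t|.
  rewrite (le_trans (Ylip _ _ (Tc s) (Tc t)))//.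
  rewrite (_ : T * (1 - c s) - T * (1 - c t) = T * (c t - c s)); last by ring.
  rewrite normrM (gtr0_norm T0) distrC mulrCA (le_trans (ler_piMl _ T1))//.
    by rewrite mulr_ge0.
  by rewrite ler_pM// lerDl.
have pathB t : `|path t| <= `|p| + C.
  rewrite -[path t](subrK p) addrC (le_trans (ler_normD _ _))// lerD2l -Y0.
  have t01 := Tc t; rewrite (le_trans (Ylip _ _ t01 _)) ?lexx ?ler01// subr0.
  by move/andP: t01 => [/ger0_norm-> t1]; rewrite ler_piMr.
have C1 : 0 < C + 1 by rewrite ltr_wpDl.
have lip1 s t : `|(path s).1.1 - (path t).1.1| <= (C + 1) * `|s - t|.
  by rewrite (le_trans _ (pathL s t))//; have [] := ler_norm_triple (path s - path t).
have lip2 s t : `|(path s).1.2 - (path t).1.2| <= (C + 1) * `|s - t|.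
  by rewrite (le_trans _ (pathL s t))//; have [] := ler_norm_triple (path s - path t).
have lip3 s t : `|(path s).2 - (path t).2| <= (C + 1) * `|s - t|.
  by rewrite (le_trans _ (pathL s t))//; have [] := ler_norm_triple (path s - path t).
have bd2 t : `|(path t).1.2| <= `|p| + C.
  by rewrite (le_trans _ (pathB t))//; have [] := ler_norm_triple (path t).
have bd3 t : `|(path t).2| <= `|p| + C.
  by rewrite (le_trans _ (pathB t))//; have [] := ler_norm_triple (path t).
have := @lyapunov_descent R n f D U alpha gamma epsilon tau1 tau2 kappa fD D_closed
  D_compact alpha_ge0 gamma_ge0 epsilon_gt0 tau1_gt0 tau2_gt0 U_sign kappa_cond
  (fun t => (path t).1.1) (fun t => (path t).1.2) (fun t => (path t).2)
  (C + 1) (`|p| + C) T C1 T0 lip1 lip2 lip3 bd2 bd3.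
rewrite /= -!surjective_pairing path1 path0; apply; last exact: lyap_le.
move=> t y' m' v' t01 dy dm dv.
set q : triple R n := (y', m', v').
have quot : h^-1 *: (path (t + h) - path t) @[h --> 0^'] --> q.
  exact: cvg_pair (cvg_pair (rV_quotient_cvg dy) (rV_quotient_cvg dm)) (rV_quotient_cvg dv).
suff /adam_mapP[d [u [Dd Uu e1 e2 e3]]] : G (path t) (T^-1 *: q).
  have e (a b : R) : T^-1 * a = b -> a = T * b by move=> <-; rewrite mulVKf ?gt_eqF.
  exists d, u; rewrite -!surjective_pairing; split => // i; apply: e.
  - by rewrite -e1 mxE.
  - by rewrite -e2 mxE.
  - by rewrite -e3 mxE.
apply: (@closed_approx R (triple R n) (G (path t)) _ (@G_closed_value (path t))) => e e0.
have e20 : 0 < e / 2 by rewrite divr_gt0.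
have Te20 : 0 < T * (e / 2) by rewrite mulr_gt0.
move/cvgrPdist_lt/(_ _ Te20)/(nbhs_ballP _ _).1 : quot => [r1 /= r10 Hr1].
have ct : c t = t by apply: cid; move/andP: t01 => [/ltW-> /ltW->].
have t'01 : 0 <= T * (1 - t) < 1.
  case/andP: t01 => t0 t1; rewrite mulr_ge0 ?(ltW T0) ?subr_ge0 ?(ltW t1)//=.
  by rewrite (@lt_le_trans _ _ T)// gtr_pMr// gtrBl.
near ((0 : R)^'+) => h.
have h0 : 0 < h by near: h; exact: nbhs_right_gt.
have hr : h / T < r1.
  by rewrite ltr_pdivrMr//; near: h; apply: nbhs_right_lt; rewrite mulr_gt0.
have ht : h / T <= t.
  rewrite ler_pdivrMr//; near: h; apply: nbhs_right_le; rewrite mulr_gt0//.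
  by case/andP: t01.
have [w Gw Hw] : exists2 w, G (Y (T * (1 - t))) w &
    `|h^-1 *: (Y (T * (1 - t) + h) - Y (T * (1 - t))) + w| <= e / 2.
  by near: h; exact: Yinc.
have hT : 0 < h / T by rewrite divr_gt0.
(* The increment [- (h / T)] in the time of [path] is the forward increment [h] in the time of
   [Y]. *)
have := Hr1 (- (h / T)); rewrite /= -ball_normE/= sub0r opprK (gtr0_norm hT) oppr_eq0.
rewrite gt_eqF// => /(_ hr isT).
have -> : path t = Y (T * (1 - t)) by rewrite /path ct.
have -> : path (t - h / T) = Y (T * (1 - t) + h).
  rewrite /path cid; last first.
    rewrite subr_ge0 ht/= (@le_trans _ _ t)//; last by have /andP[_ /ltW] := t01.
    by rewrite gerBl ltW.
  by congr Y; field; rewrite gt_eqF.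
set X := Y _ - _ in Hw *.
rewrite invrN scaleNr opprK invfM invrK => HX.
exists w => //.
have -> : T^-1 *: q - w = T^-1 *: (q + (h^-1 * T) *: X) - (h^-1 *: X + w).
  rewrite scalerDr scalerA mulrCA mulVf ?gt_eqF// mulr1 opprD addrA.
  by rewrite addrK.
rewrite (le_lt_trans (ler_normB _ _))// [e]splitr ltr_leD//.
by rewrite normrZ gtr0_norm ?invr_gt0// ltr_pdivrMl.
Unshelve. all: by end_near. Qed.

Lemma lyapunov_continuous : continuous lyap.
Proof.
have fc : continuous f := locally_lipschitz_continuous f_lip.
have [L _ scL] := scaling_lipschitz gamma_ge0 epsilon_gt0.
have fst1 (p : triple R n) : q.1.1 @[q --> p] --> p.1.1.
  by apply: cvg_comp; [exact: cvg_fst|exact: cvg_fst].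
have fst2 (p : triple R n) : q.1.2 @[q --> p] --> p.1.2.
  by apply: cvg_comp; [exact: cvg_fst|exact: cvg_snd].
have snd2 (p : triple R n) : q.2 @[q --> p] --> p.2 by exact: cvg_snd.
move=> p; apply: cvgD; first exact: (@continuous_comp _ _ _ _ f _ (fst1 p) (fc p.1.1)).
apply: cvgMr; apply: cvg_sumr => i.
have m_cvg : (fun q : triple R n => q.1.2 0 i : R^o) q @[q --> p] --> (p.1.2 0 i : R^o).
  exact: (continuous_comp (fst2 p) (@coord_continuous R n i p.1.2)).
apply: cvgM; first by rewrite expr2; apply: cvgM.
apply: continuous_comp (@lipschitz_continuous R R^o R^o _ L scL (p.2 0 i)).
exact: (continuous_comp (snd2 p) (@coord_continuous R n i p.2)).
Qed.

Lemma increment_cvg0 : (z k.+1 - z k) @[k --> \oo] --> (0 : triple R n).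
Proof.
have [C gC] := direction_bounded.
have C0 : 0 <= C := le_trans (normr_ge0 _) (gC 0%N).
have C1 : 0 < C + 1 by rewrite ltr_wpDl.
apply/cvgrPdist_le => e e0; have e20 : 0 < e / 2 by rewrite divr_gt0.
have eC0 : 0 < e / 2 / (C + 1) by rewrite divr_gt0.
have H := displacement_le z_rec gC r0 eta0 noise e20.
apply: filterS3 H (eta_near_le eta_cvg ltr01) (eta_near_le eta_cvg eC0) => k Hk k1 kC.
have := Hk k.+1 (leqnSn k); rewrite /elapsed big_nat1 sub0r normrN => /(_ k1).
move=> /le_trans; apply; rewrite [leRHS]splitr lerD2r.
by rewrite (le_trans (ler_wpM2l C0 kC))// mulrCA ler_piMr ?(ltW e20)// ler_pdivrMr// mul1r lerDl.
Qed.

Lemma ultra_limit (V : set_system nat) (s : nat -> nat) : UltraFilter V ->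
  exists p : triple R n, z (s k) @[k --> V] --> p.
Proof.
move=> VV; apply: (@ultra_compact_cvg _ V _ [set q | `|q| <= M] _ VV).
  exact: (@compact_ball_triple R n M).
by apply: filterE => k; exact: zM.
Qed.

Lemma lyapunov_value_cvg (V : set_system nat) (s : nat -> nat) (p : triple R n) :
  Filter V ->
  z (s k) @[k --> V] --> p -> lyap (z (s k)) @[k --> V] --> lyap p.
Proof.
by move=> VV zp; apply: cvg_comp zp _; apply: lyapunov_continuous.
Qed.

Lemma ultra_cvg_infty (V : set_system nat) (s : nat -> nat) :
  Filter V -> (\oo : set_system nat) `<=` V -> (forall k, (k <= s k)%N) ->
  forall P : nat -> Prop, (\forall k \near \oo, P k) -> V (fun k => P (s k)).
Proof.
move=> VV Voo sk P [N _ NP]; apply: Voo; exists N => // k /= Nk.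
by apply: NP; exact: leq_trans Nk (sk k).
Qed.

Lemma ultra_upcrossing (V : set_system nat) (e : nat -> nat) (c1 c2 : R) :
  UltraFilter V -> (\oo : set_system nat) `<=` V -> c1 < c2 ->
  V [set s | [/\ (s < e s)%N, lyap (z s) <= c1, c2 <= lyap (z (e s)) &
    forall i, (s < i < e s)%N -> c1 < lyap (z i) < c2]] ->
  exists p : triple R n, [/\ p.1.2 = 0, D p.1.1 0 & lyap p = c1].
Proof.
move=> VV Voo c12 Ve.
have [p zp] := @ultra_limit V id VV.
have le_c1 : lyap p <= c1.
  apply: (cvgr_to_le (@lyapunov_value_cvg V id p _ zp)).
  by apply: filterS Ve => s [].
(* One step later the iterates have the same limit, and their values already exceed [c1]. *)
have ge_c1 : c1 <= lyap p.
  have zp' : z k.+1 @[k --> V] --> p.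
    rewrite -[p in X in _ --> X]add0r.
    have -> : (fun k => z k.+1) = (fun k => (z k.+1 - z k) + z k).
      by apply/funext => k; rewrite subrK.
    apply: cvgD => //; exact: cvg_trans (cvg_app _ Voo) increment_cvg0.
  apply: (cvgr_to_ge (@lyapunov_value_cvg V S p _ zp')).
  apply: filterS Ve => s [se _ c2e cs].
  have [es|ne] := eqVneq s.+1 (e s); first by rewrite es (le_trans (ltW c12)).
  have /andP[/ltW//] : c1 < lyap (z s.+1) < c2.
    by apply: cs; rewrite ltnSn/= ltn_neqAle ne.
have pc1 : lyap p = c1 by apply/eqP; rewrite eq_le le_c1 ge_c1.
(* If the windows last longer than [T] along [V], the index at time [T] lies strictly inside them,
   where the values exceed [c1]; hence the limit curve has value at least [c1] at time [T]. *)
suff [T T01 VT] : exists2 T, 0 < T <= 1 & V [set s | T < elapsed eta s (e s)].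
  exists p; suff [] : p.1.2 = 0 /\ D p.1.1 0 by split.
  apply: (flow_critical VV Voo zp T01); rewrite pc1.
  have /andP[T0 _] := T01.
  have cY : z (idx s T) @[s --> V] --> limit_curve z idx V T.
    by apply: (limit_curve_cvg (@compact_ball_triple R n M) zM).
  apply: (cvgr_to_ge (@lyapunov_value_cvg V (idx^~ T) _ _ cY)).
  have VT' := Voo _ (eta_near_le eta_cvg T0).
  apply: filterS3 Ve VT VT' => s [se _ c2e cs] /= Ts etaT.
  have [si iT Ti] := idxP s (ltW T0).
  have ie : (idx s T < e s)%N.
    rewrite ltnNge; apply/negP => ei.
    by have := lt_le_trans Ts (le_trans (elapsed_le eta0 (ltnW se) ei) iT); rewrite ltxx.
  have si' : (s < idx s T)%N.
    rewrite ltn_neqAle si andbT; apply: contraTneq Ti => <-.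
    by rewrite /elapsed big_nat1 -leNgt.
  have /andP[/ltW//] : c1 < lyap (z (idx s T)) < c2 by apply: cs; rewrite si' ie.
(* If instead the durations tend to 0 along [V], the ends of the windows converge to [p] too, which
   gives [c2 <= lyap p] and contradicts [lyap p = c1]. *)
apply: contrapT => nT.
have VT T : 0 < T <= 1 -> V [set s | elapsed eta s (e s) <= T].
  move=> T01; have [VT|VT] := in_ultra_setVsetC [set s | T < elapsed eta s (e s)] VV.
    by exfalso; apply: nT; exists T.
  by apply: filterS VT => s /= /negP; rewrite -leNgt.
have : c2 <= lyap p; last by rewrite pc1 leNgt c12.
suff zep : z (e k) @[k --> V] --> p.
  apply: (cvgr_to_ge (@lyapunov_value_cvg V e p _ zep)).
  by apply: filterS Ve => s [].
rewrite -[p in X in _ --> X]add0r.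
have -> : (fun k => z (e k)) = (fun k => (z (e k) - z k) + z k).
  by apply/funext => k; rewrite subrK.
apply: cvgD => //; apply/cvgrPdist_le => a a0.
have [C gC] := direction_bounded.
have C0 : 0 <= C := le_trans (normr_ge0 _) (gC 0%N).
have C1 : 0 < C + 1 by rewrite ltr_wpDl.
have a20 : 0 < a / 2 by rewrite divr_gt0.
have aC0 : 0 < a / 2 / (C + 1) by rewrite divr_gt0.
have T01 : 0 < Num.min 1 (a / 2 / (C + 1)) <= 1.
  by rewrite lt_min ltr01 aC0 ge_min lexx.
have H := Voo _ (displacement_le z_rec gC r0 eta0 noise a20).
apply: filterS3 H (VT _ T01) Ve => s Hs /= eT [se _ _ _].
rewrite sub0r normrN; move: eT; rewrite le_min => /andP[eT1 eTC].
rewrite (le_trans (Hs _ (ltnW se) eT1))// [leRHS]splitr lerD2r.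
by rewrite (le_trans (ler_wpM2l C0 eTC))// mulrCA ler_piMr ?(ltW a20)// ler_pdivrMr// mul1r lerDl.
Qed.

Hypothesis f_crit : (f @` [set x | D x 0])^° = set0.

Lemma lyapunov_momentum0 (p : triple R n) : p.1.2 = 0 -> lyap p = f p.1.1.
Proof.
move=> p0; rewrite /lyap /lyapunov p0 big1 ?mulr0 ?addr0// => i _.
by rewrite mxE expr0n mul0r.
Qed.

Lemma lyapunov_cvg : cvg (lyap (z k) @[k --> \oo]).
Proof.
have ultra_value V : UltraFilter V -> exists l, lyap (z k) @[k --> V] --> (l : R).
  move=> VV; have [p zp] := @ultra_limit V id VV.
  by exists (lyap p); exact: lyapunov_value_cvg zp.
have [V [VV Voo _]] : exists V, [/\ UltraFilter V, (\oo : set_system nat) `<=` V & V setT].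
  by apply: ultra_frequent; rewrite setCT => /filter_ex[].
have [l Vl] := ultra_value V VV.
apply/cvg_ex; exists l; apply: cvg_ultra => W WW Woo.
have [l' Wl'] := ultra_value W WW.
suff -> : l = l' by [].
have no_gap (V1 V2 : set_system nat) (a b : R) : UltraFilter V1 -> UltraFilter V2 ->
    (\oo : set_system nat) `<=` V1 -> (\oo : set_system nat) `<=` V2 ->
    lyap (z k) @[k --> V1] --> a -> lyap (z k) @[k --> V2] --> b -> b <= a.
  move=> VV1 VV2 Voo1 Voo2 V1a V2b; rewrite leNgt; apply/negP => ab.
  have [c1 /andP[ac1 c1b] nc1] := empty_interior_between f_crit ab.
  have c12 : c1 < (c1 + b) / 2 by rewrite midf_lt.
  pose c2 := (c1 + b) / 2.
  pose P s e := [/\ (s < e)%N, lyap (z s) <= c1, c2 <= lyap (z e) &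
    forall i, (s < i < e)%N -> c1 < lyap (z i) < c2].
  (* Upcrossings start beyond every [N]: [V1] provides a value at most [c1] past [N], and [V2] a
     later one at least [c2]. *)
  have nP : ~ (\oo : set_system nat) (~` [set s | exists e, P s e]).
    move=> [N _ HN].
    have [k [/= kc1 Nk]] : exists k, lyap (z k) <= c1 /\ (N <= k)%N.
      apply: (@filter_ex _ V1); apply: filterI (Voo1 _ (nbhs_infty_ge N)).
      exact: (cvgr_le _ V1a _ ac1).
    have [j [/= jc2 kj]] : exists j, c2 <= lyap (z j) /\ (k <= j)%N.
      apply: (@filter_ex _ V2); apply: filterI (Voo2 _ (nbhs_infty_ge k)).
      by apply: (cvgr_ge _ V2b); rewrite /c2 midf_lt.
    have [s [e [ks se hs he hi]]] := @upcrossing R (fun k => lyap (z k)) c1 c2 k j kj kc1 c12 jc2.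
    by apply: (HN s (leq_trans Nk ks)); exists e.
  have [V3 [VV3 Voo3 V3P]] := ultra_frequent _ nP.
  have [|e eP] := @choice nat nat (fun s e => (exists e', P s e') -> P s e).
    by move=> s; have [[e Pe]|nPe] := pselect (exists e, P s e); [exists e|exists 0%N].
  have Ve : V3 [set s | P s (e s)] by apply: filterS V3P => s /eP.
  have [p [p0 Dp pc1]] := ultra_upcrossing VV3 Voo3 c12 Ve.
  by apply: nc1; exists p.1.1; rewrite // -pc1 lyapunov_momentum0.
by apply/eqP; rewrite eq_le (no_gap W V)// (no_gap V W).
Qed.

Lemma ultra_limit_critical (V : set_system nat) (p : triple R n) :
  UltraFilter V -> (\oo : set_system nat) `<=` V -> z k @[k --> V] --> p ->
  p.1.2 = 0 /\ D p.1.1 0.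
Proof.
move=> VV Voo zp; have /cvg_ex[l zl] := lyapunov_cvg.
have value (q : triple R n) (s : nat -> nat) : (forall k, (k <= s k)%N) ->
    z (s k) @[k --> V] --> q -> lyap q = l.
  move=> sk zq; have Vq : lyap (z (s k)) @[k --> V] --> lyap q by exact: lyapunov_value_cvg zq.
  have Vl : lyap (z (s k)) @[k --> V] --> l by move=> B /zl; exact: ultra_cvg_infty.
  exact: real_limit_unique Vq Vl.
apply: (@flow_critical V p 1) => //; first by rewrite ltr01 lexx.
rewrite (value p id)//.
rewrite (value _ (idx^~ 1)); first exact: lexx.
  by move=> k; have [] := idxP k ler01.
exact: (limit_curve_cvg (@compact_ball_triple R n M) zM).
Qed.

(** Clustering concerns only the component x. An ultrafilter of indices at which x stays within
    [e / 2] of the cluster point gives the whole triple a limit, and that limit is critical. *)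
Lemma cluster_critical : cluster ((z k).1.1 @[k --> \oo]) `<=` [set p | D p 0].
Proof.
move=> x xcl; apply: contrapT => /= nDx.
have Dcl : closed [set p | D p 0].
  apply: (@preimage_closed _ _ (fun p => (p, 0)) [set q | D q.1 q.2]) => // p _.
  exact: (cvg_pair (@cvg_id 'rV[R]_n (nbhs p)) (@cvg_cst _ (0 : 'rV[R]_n) _ (nbhs p) _)).
have /nbhs_ballP[e /= e0 eD] : nbhs x (~` [set p | D p 0]).
  by apply: open_nbhs_nbhs; split => //; exact: closed_openC.
have e20 : 0 < e / 2 by rewrite divr_gt0.
have nS : ~ (\oo : set_system nat) (~` [set k | `|x - (z k).1.1| <= e / 2]).
  move=> nS; have [w []] := xcl (~` [set w | `|x - w| <= e / 2]) _ nS (nbhsx_ballx x (e / 2) e20).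
  by move=> /= nw; rewrite -ball_normE/= => /ltW.
have [V [VV Voo VS]] := ultra_frequent _ nS.
have [p zp] := @ultra_limit V id VV.
have [_ Dp] := ultra_limit_critical VV Voo zp.
apply: (eD p.1.1) => //; rewrite -ball_normE/=.
apply: (@le_lt_trans _ _ (e / 2)); last by rewrite ltr_pdivrMr// ltr_pMr// ltr1n.
have xzp : `|x - (z k).1.1| @[k --> V] --> `|x - p.1.1|.
  apply: cvg_norm; apply: cvgB; first exact: cvg_cst.
  exact: cvg_triple1 zp.
exact: (cvgr_to_le xzp).
Qed.

(** Every ultrafilter limit of the iterates has m = 0, so there f takes the limit value of the
    Lyapunov function. *)
Lemma value_cvg : cvg (f (z k).1.1 @[k --> \oo]).
Proof.
have /cvg_ex[l zl] := lyapunov_cvg.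
apply/cvg_ex; exists l; apply: cvg_ultra => V VV Voo.
have [p zp] := @ultra_limit V id VV.
have [p0 Dp] := ultra_limit_critical VV Voo zp.
have <- : lyap p = l.
  have Vq : lyap (z k) @[k --> V] --> lyap p by exact: (@lyapunov_value_cvg V id p _ zp).
  have Vl : lyap (z k) @[k --> V] --> l by move=> B /zl; exact: Voo.
  exact: real_limit_unique Vq Vl.
rewrite lyapunov_momentum0//.
have zp1 : (z k).1.1 @[k --> V] --> p.1.1.
  exact: cvg_triple1 zp.
apply: cvg_comp zp1 _; exact: (locally_lipschitz_continuous f_lip).
Qed.

End adam_flow.

Lemma near_ln_ge1 (R : realType) : \forall k \near \oo, 1 <= ln (k%:R : R).
Proof.
near=> k; rewrite -ler_expR lnK; first by near: k; exact: nbhs_infty_ger.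
by rewrite posrE ltr0n; near: k; exact: nbhs_infty_gt.
Unshelve. all: by end_near. Qed.

Lemma stepsize_cvg0 (R : realType) (eta : nat -> R) : (forall k, 0 < eta k) ->
  eta k * ln k%:R @[k --> \oo] --> 0 -> eta k @[k --> \oo] --> 0.
Proof.
move=> eta0 eta_log; apply: (@squeeze_cvgr _ _ _ _ (fun=> 0) (fun k => eta k * ln k%:R)) => //.
  apply: filterS (near_ln_ge1 R) => k k1.
  by rewrite (ltW (eta0 k))/= ler_peMr// ltW.
exact: cvg_cst.
Qed.

Lemma norm_cvg0_le (R : realType) (V : normedModType R) (u : nat -> V) (b : nat -> R) :
  (forall k, `|u k| <= b k) -> b k @[k --> \oo] --> 0 -> u k @[k --> \oo] --> (0 : V).
Proof.
move=> ub /cvgrPdist_le b0; apply/cvgrPdist_le => e e0.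
apply: filterS (b0 e e0) => k; rewrite !sub0r !normrN => be.
by rewrite (le_trans (ub k))// (le_trans (ler_norm _)).
Qed.

Section adam_deterministic.
Context {R : realType} {n : nat}.

Lemma expansion_approx (G : triple R n -> set (triple R n)) (delta : R) (p w : triple R n) :
  0 < delta -> expansion enorm3 G delta p w ->
  exists q g, [/\ `|q - p| <= delta, G q g & `|w - g| <= 2 * delta].
Proof.
move=> delta0 [q qp wd].
(* The distance is an infimum that may not be attained; the factor 2 gives room for an actual
   element, and a finite distance rules out an empty value. *)
have : (Defs.edist enorm3 w (G q) < (2 * delta)%:E)%E.
  by apply: le_lt_trans wd _; rewrite lte_fin ltr_pMl// ltr1n.
move=> /ereal_inf_lt[_ [g Gg <-]]; rewrite lte_fin => /ltW wg.
exists q, g; split => //; first exact: le_trans (ler_norm_enorm3 _) qp.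
exact: le_trans (ler_norm_enorm3 _) wg.
Qed.

Lemma adam_deterministic (f : 'rV[R]_n -> R) (D : 'rV[R]_n -> set 'rV[R]_n)
    (U : triple R n -> set 'rV[R]_n) (alpha gamma epsilon tau1 tau2 kappa : R)
    (x m v : nat -> 'rV[R]_n) (d xi : nat -> triple R n) (eta theta delta : nat -> R) :
  locally_lipschitz f -> is_potential f D -> closed_graph D ->
  (forall p, compact (D p)) -> (forall p, convex_set (D p)) ->
  (forall p, D p !=set0) -> (f @` [set p | D p 0])^° = set0 ->
  locally_bounded U -> (forall p, convex_set (U p)) -> closed_graph U ->
  (forall x0 m0 v0 u, U (x0, m0, v0) u -> forall i : 'I_n,
     0 <= kappa * `|v0 0 i| <= Num.sg (v0 0 i) * u 0 i) ->
  0 <= alpha -> 0 <= gamma -> 0 < epsilon -> 0 < tau1 -> 0 < tau2 ->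
  (1 - kappa) * gamma * tau2 <= 2 * tau1 ->
  (forall k, (x k.+1, m k.+1, v k.+1) = (x k, m k, v k) - eta k *: d k - theta k *: xi k) ->
  has_ubound (range (fun k => enorm (x k) + enorm (m k) + enorm (v k))) ->
  (forall k, 0 < delta k) -> delta k @[k --> \oo] --> 0 ->
  (forall k, expansion enorm3 (adam_map alpha gamma epsilon tau1 tau2 D U) (delta k)
     (x k, m k, v k) (d k)) ->
  (forall k, 0 < eta k) -> series eta @ \oo --> +oo ->
  eta k * ln k%:R @[k --> \oo] --> 0 ->
  (forall e : R, 0 < e -> \forall a \near \oo, forall b, (a <= b)%N ->
     elapsed eta a b <= 1 -> `|\sum_(a <= i < b) theta i *: xi i| <= e) ->
  cluster (x k @[k --> \oo]) `<=` [set p | D p 0] /\ cvg (f (x k) @[k --> \oo]).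
Proof.
move=> f_lip fD D_closed D_compact D_convex D_nonempty f_crit U_loc U_convex U_closed
  U_sign alpha0 gamma0 epsilon0 tau10 tau20 kappa_cond rec [M Mub] delta0
  delta_cvg d_in eta0 eta_sum eta_log noise.
have U_bounded (p : triple R n) : exists B : R,
    \forall q \near p, forall w, U q w -> `|w| <= B.
  have [N pN UN] := U_loc p; have [B UB] := @filter_ex _ _ (@proper_pinfty_nbhs R) _ UN.
  by exists B; apply: filterS pN => q Nq w Uw; apply: UB; exists q.
pose z k : triple R n := (x k, m k, v k).
have zM k : `|z k| <= M.
  have : enorm (x k) + enorm (m k) + enorm (v k) <= M by apply: Mub; exists k.
  have e0 (u : 'rV[R]_n) : 0 <= enorm u := sqrtr_ge0 _.
  move=> zM; rewrite triple_norm_le; apply/and3P; split; apply: le_trans (ler_norm_enorm _) _;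
    apply: le_trans zM => /=.
  - by rewrite -addrA lerDl addr_ge0.
  - by rewrite addrAC lerDr addr_ge0.
  - by rewrite lerDr addr_ge0.
have [y yP] := choice (fun k => expansion_approx (delta0 k) (d_in k)).
have [g gP] := choice yP.
have [B deltaB] : exists B : R, forall k, delta k <= B.
  have /cvg_seq_bounded[B [_ HB]] : cvgn delta by apply/cvg_ex; exists 0.
  exists (B + 1) => k; rewrite (le_trans (ler_norm _))//.
  by apply: HB => //; rewrite ltrDl.
have delta2 : 2 * delta k @[k --> \oo] --> 0.
  by rewrite -[X in _ --> X](mulr0 2); apply: cvgMr.
have [idx idxP] := elapsed_indexE eta_sum.
(* The expansion error [d k - g k] plays the part of the vanishing error [r k]. *)
have rec' k : z k.+1 = z k - eta k *: g k - eta k *: (d k - g k) - theta k *: xi k.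
  by rewrite /z rec; congr (_ - _); rewrite scalerBr opprB addrA subrK.
have gG k : adam_map alpha gamma epsilon tau1 tau2 D U (y k) (g k) by have [] := gP k.
have MB k : `|z k| <= M + B.
  by rewrite (le_trans (zM k))// lerDl (le_trans (ltW (delta0 k))).
have yM k : `|y k| <= M + B.
  rewrite -[y k](subrK (z k)) addrC (le_trans (ler_normD _ _))// lerD//.
  by have [yz _ _] := gP k; rewrite (le_trans yz).
have yz : (y k - z k) @[k --> \oo] --> (0 : triple R n).
  by apply: norm_cvg0_le delta_cvg => k; have [] := gP k.
have r0 : (d k - g k) @[k --> \oo] --> (0 : triple R n).
  by apply: norm_cvg0_le delta2 => k; have [] := gP k.
have eta_cvg := stepsize_cvg0 eta0 eta_log.
split.
  apply: (@cluster_critical R n f D U alpha gamma epsilon tau1 tau2 kappa f_lip fD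
    D_closed D_compact D_convex D_nonempty U_closed U_convex U_bounded alpha0 gamma0
    epsilon0 tau10 tau20 U_sign kappa_cond z y g (fun k => d k - g k)
    (fun k => theta k *: xi k) eta (M + B) rec' gG MB yM yz r0 eta0 eta_cvg
    noise idx idxP f_crit).
apply: (@value_cvg R n f D U alpha gamma epsilon tau1 tau2 kappa f_lip fD
    D_closed D_compact D_convex D_nonempty U_closed U_convex U_bounded alpha0 gamma0
    epsilon0 tau10 tau20 U_sign kappa_cond z y g (fun k => d k - g k)
    (fun k => theta k *: xi k) eta (M + B) rec' gG MB yM yz r0 eta0 eta_cvg
    noise idx idxP f_crit).
Qed.

End adam_deterministic.

(** * The martingale noise *)

(** From exp y <= 1 / (1 - y) and (1 - y) (1 + y + 2 y^2) = 1 + y^2 (1 - 2 y) >= 1. *)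
Lemma expR_le_quad (R : realType) (y : R) : `|y| <= 1 / 2 ->
  expR y <= 1 + y + 2 * y ^+ 2.
Proof.
rewrite ler_norml => /andP[y1 y2].
have ny : 0 < 1 - y by lra.
have : expR y <= (1 - y)^-1.
  rewrite -[y in leLHS]opprK expRN lef_pV2 ?posrE ?expR_gt0//.
  by have := expR_ge1Dx (- y).
move=> /le_trans; apply; rewrite -[leLHS]mul1r ler_pdivrMr//.
rewrite [leRHS](_ : _ = 1 + y ^+ 2 * (1 - 2 * y)); last by ring.
by rewrite lerDl mulr_ge0 ?sqr_ge0//; lra.
Qed.

(* The correction [- 2 * b ^+ 2] absorbs the quadratic term, which leaves an upper
   bound that is affine in [y], hence of mean at most 1 when [y] is centered. *)
Lemma expR_compensated_le (R : realType) (y b : R) : `|y| <= b -> b <= 1 / 2 ->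
  expR (y - 2 * b ^+ 2) <= 1 + expR (- (2 * b ^+ 2)) * y.
Proof.
move=> yb b1; rewrite expRD mulrC.
have yb2 : y ^+ 2 <= b ^+ 2.
  by rewrite -real_normK ?num_real// ler_pXn2r ?nnegrE// (le_trans (normr_ge0 y)).
have E0 := @expR_gt0 R (- (2 * b ^+ 2)).
rewrite (le_trans (ler_wpM2l (ltW E0) (expR_le_quad (le_trans yb b1))))//.
rewrite addrAC mulrDr lerD2r.
rewrite (@le_trans _ _ (expR (- (2 * b ^+ 2)) * expR (2 * b ^+ 2)))//; last first.
  by rewrite expRN mulVf// gt_eqF// expR_gt0.
rewrite ler_wpM2l ?(ltW E0)// (le_trans _ (expR_ge1Dx _))//.
by rewrite lerD2l ler_wpM2l.
Qed.

(** The sum is the integer part of [t], written as the number of levels reached so that each term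
    becomes the indicator of a level set. *)
Lemma staircase_le (R : realType) (J : nat) (t : R) : 0 <= t <= J%:R ->
  `|t - \sum_(j < J) ((j.+1%:R <= t)%R : nat)%:R| <= 1.
Proof.
elim: J t => [|J IH] t.
  by rewrite -eq_le => /eqP <-; rewrite big_ord0 subr0 normr0.
move=> /andP[t0 tJ]; rewrite big_ord_recr/=.
have [tJ'|Jt] := leP t J%:R.
  rewrite (_ : _ <= t = false) ?addr0; first by apply: IH; rewrite t0.
  by apply/negbTE; rewrite -ltNge (le_lt_trans tJ')// ltr_nat.
rewrite (eq_bigr (fun=> 1)) => [|j _]; last first.
  by rewrite (le_trans _ (ltW Jt))// ler_nat.
rewrite sumr_const card_ord.
have [Jt'|_] := leP J.+1%:R t.
  have -> : t = J.+1%:R by apply/eqP; rewrite eq_le tJ.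
  by rewrite -natr1 subrr normr0.
by rewrite addr0 ger0_norm ?subr_ge0 ?(ltW Jt)// lerBlDl natr1.
Qed.

Section sub_sigma_algebra.
Context {d : measure_display} {T : measurableType d} {R : realType}.
Variable P : probability T R.
Implicit Types (G : set (set T)) (f xi : T -> R).

Definition sub_measurable G f : Prop :=
  forall B : set R, measurable B -> G (f @^-1` B).

Lemma sub_measurableP G f : sigma_algebra [set: T] G ->
  sub_measurable G f <->
  measurable_fun [set: g_sigma_algebraType G] (f : g_sigma_algebraType G -> R).
Proof.
move=> sG; have E (A : set T) : (G.-sigma.-measurable A) = G A.
  by rewrite /measurable/= (sigma_algebra_id sG).
split=> [fG _ B mB|fG B mB].
  by rewrite setTI; have := fG B mB; rewrite -E.
by rewrite -E; have := fG measurableT B mB; rewrite setTI.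
Qed.

Lemma sub_measurableS G G' f : G `<=` G' -> sub_measurable G f -> sub_measurable G' f.
Proof. by move=> GG' fG B mB; apply: GG'; exact: fG. Qed.

Lemma sub_measurableT G f : G `<=` measurable -> sub_measurable G f ->
  measurable_fun [set: T] f.
Proof. by move=> Gm fG _ B mB; rewrite setTI; apply: Gm; exact: fG. Qed.

Lemma bounded_integrable f (K : R) : measurable_fun [set: T] f ->
  (forall w, `|f w| <= K) -> P.-integrable [set: T] (EFin \o f).
Proof.
move=> mf fK; apply: measurable_bounded_integrable => //.
  by rewrite (le_lt_trans (probability_le1 P measurableT)) ?ltry.
by exists K; split; [exact: num_real|move=> x Kx w _ /=; exact: le_trans (fK w) (ltW Kx)].
Qed.

Lemma bounded_Rintegral_le f (K : R) : measurable_fun [set: T] f ->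
  (forall w, `|f w| <= K) -> `|\int[P]_w f w| <= K.
Proof.
move=> mf fK; rewrite (le_trans (le_normr_Rintegral _ (bounded_integrable mf fK)))//.
rewrite (@le_trans _ _ (\int[P]_w K))//.
  apply: le_Rintegral => // [|].
    apply: (@bounded_integrable _ K); last by move=> w; rewrite normr_id.
    by apply: measurableT_comp => //; exact: measurable_normr.
  apply: (@bounded_integrable _ `|K|) => //; exact: measurable_cst.
by rewrite Rintegral_cst//= [P _](@probability_setT _ _ _ P) mulr1.
Qed.

Lemma Rintegral_indicM (A : set T) xi :
  \int[P]_w (\1_A w * xi w) = \int[P]_(w in A) xi w.
Proof.
rewrite [RHS]Rintegral_mkcond; apply: eq_Rintegral => w _.
by rewrite /patch indicE; case: ifP; rewrite ?mul1r ?mul0r.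
Qed.

(* [H] is replaced by staircase approximations built from its level sets, which
   belong to [G]. *)
Lemma orthogonal_bounded G (H xi : T -> R) (K M : R) :
  G `<=` measurable -> sub_measurable G H -> (forall w, 0 <= H w <= K) ->
  measurable_fun [set: T] xi -> (forall w, `|xi w| <= M) ->
  (forall A, G A -> \int[P]_(w in A) xi w = 0) ->
  \int[P]_w (H w * xi w) = 0.
Proof.
move=> Gm GH HK mxi xiM xi0.
have mH := sub_measurableT Gm GH.
have M0 : 0 <= M := le_trans (normr_ge0 _) (xiM point).
have iHxi : P.-integrable [set: T] (EFin \o (fun w => H w * xi w)).
  apply: (@bounded_integrable _ (K * M)); first exact: measurable_funM.
  move=> w; rewrite normrM ler_pM//.
  by have /andP[h0 hK] := HK w; rewrite ger0_norm.
(* The staircase approximates [N.+1%:R * H] up to 1 whatever [N] is, and it is orthogonal to [xi];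
   letting [N] grow forces the integral to vanish. *)
suff le N : `|N.+1%:R * \int[P]_w (H w * xi w)| <= M.
  apply/eqP; rewrite -normr_le0 leNgt; apply/negP => i0.
  set I := `|_| in i0.
  have [N] : exists N : nat, M / I < N.+1%:R.
    exists (Num.truncn (M / I)); exact: truncnS_gt.
  rewrite ltr_pdivrMr// ltNge => /negP; apply.
  by have := le N; rewrite normrM ger0_norm.
have [J KJ] : exists J : nat, N.+1%:R * K <= J%:R.
  by exists (Num.truncn (N.+1%:R * K)).+1; exact/ltW/truncnS_gt.
pose A (j : nat) := [set w | (j.+1%:R <= N.+1%:R * H w)%R].
have GA j : G (A j).
  rewrite (_ : A j = H @^-1` [set x | j.+1%:R / N.+1%:R <= x]).
    by apply: GH; rewrite -set_itvcy; exact: measurable_itv.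
  by apply/seteqP; split => w /=; rewrite /A/= ler_pdivrMr// mulrC.
pose g J' w : R := \sum_(j < J') \1_(A j) w.
have gS J' w : g J'.+1 w = g J' w + \1_(A J') w by rewrite /g big_ord_recr.
have mA j : measurable_fun [set: T] (\1_(A j) : T -> R).
  exact/measurable_indic/Gm/GA.
have mg J' : measurable_fun [set: T] (g J').
  by apply: measurable_sum => j; exact: mA.
have gJ J' w : `|g J' w| <= J'%:R.
  rewrite (le_trans (ler_norm_sum _ _ _))//.
  rewrite (le_trans (ler_sum _ (G := fun=> 1) _))//; last by rewrite sumr_const card_ord.
  by move=> j _; rewrite indicE; case: (_ \in _); rewrite ?normr1 ?normr0.
have igxi J' : P.-integrable [set: T] (EFin \o (fun w => g J' w * xi w)).
  apply: (@bounded_integrable _ (J'%:R * M)); first exact: measurable_funM.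
  by move=> w; rewrite normrM ler_pM.
have iAxi j : P.-integrable [set: T] (EFin \o (fun w => \1_(A j) w * xi w)).
  apply: (@bounded_integrable _ M); first exact: measurable_funM.
  move=> w; rewrite normrM indicE; case: (_ \in _).
    by rewrite normr1 mul1r.
  by rewrite normr0 mul0r.
have g0 J' : \int[P]_w (g J' w * xi w) = 0.
  elim: J' => [|J' IH].
    rewrite (_ : (fun _ => _) = (fun=> 0)) ?Rintegral_cst ?mul0r//.
    by apply/funext => w; rewrite /g big_ord0 mul0r.
  under eq_Rintegral do rewrite gS mulrDl.
  by rewrite RintegralD// IH add0r Rintegral_indicM xi0.
have iN : P.-integrable [set: T] (EFin \o (fun w => N.+1%:R * (H w * xi w))).
  apply: (@bounded_integrable _ (N.+1%:R * (K * M))).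
    by apply: measurable_funM => //; exact: measurable_funM.
  move=> w; rewrite !normrM ger0_norm// ler_wpM2l// ler_pM//.
  by have /andP[h0 hK] := HK w; rewrite ger0_norm.
rewrite -RintegralZl// -[X in `|X|]subr0 -(g0 J) -RintegralB//.
apply: bounded_Rintegral_le.
  by apply: measurable_funB; apply: measurable_funM => //; exact: measurable_funM.
move=> w; rewrite mulrA -mulrBl normrM -[leRHS]mul1r ler_pM//.
have -> : g J w = \sum_(j < J) ((j.+1%:R <= N.+1%:R * H w)%R : nat)%:R.
  by apply: eq_bigr => j _; rewrite indicE mem_setE.
apply: staircase_le; have /andP[h0 hK] := HK w.
by rewrite mulr_ge0//= (le_trans _ KJ)// ler_wpM2l.
Qed.

End sub_sigma_algebra.

Section stopped_exponential.
Context {d : measure_display} {T : measurableType d} {R : realType}.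
Variables (P : probability T R) (F : nat -> set (set T)) (xi : nat -> T -> R) (M : R).
Hypotheses (F_filtration : filtration F)
  (xi_measurable : forall k, sub_measurable (F k) (xi k))
  (xi_bounded : forall k w, `|xi k w| <= M)
  (xi_mean0 : forall k, (1 <= k)%N -> forall A, F k.-1 A ->
     \int[P]_(w in A) xi k w = 0).
Variables (a : nat -> R) (c : R) (s : nat).
Hypotheses (a_ge0 : forall i, (s <= i)%N -> 0 <= a i)
  (aM : forall i, (s <= i)%N -> a i * M <= 1 / 2)
  (c_gt0 : 0 < c) (s_gt0 : (0 < s)%N).

Definition compensated (i : nat) (w : T) : R := a i * xi i w - 2 * (a i * M) ^+ 2.

(* Stopping when level [c] is reached turns the maximal inequality into Markov's
   inequality at the final time. *)
Fixpoint stopped_exp (j : nat) (w : T) : R :=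
  if j is i.+1 then
    if stopped_exp i w < c then stopped_exp i w * expR (compensated (s + i) w)
    else stopped_exp i w
  else 1.

Lemma stopped_expE j w :
  stopped_exp j w = expR (\sum_(s <= i < s + j) compensated i w) \/ c <= stopped_exp j w.
Proof.
elim: j => [|j [IH|IH]]; first by left; rewrite addn0 big_geq//= expR0.
  rewrite /=; case: ltP => [_|]; last by right.
  by left; rewrite addnS big_nat_recr ?leq_addr//= [in RHS]expRD IH.
by right; rewrite /= ltNge IH.
Qed.

Lemma stopped_exp_hit j N w : (j <= N)%N ->
  c <= expR (\sum_(s <= i < s + j) compensated i w) -> c <= stopped_exp N w.
Proof.
move=> jN cj.
have {}cj : c <= stopped_exp j w by case: (stopped_expE j w) => // ->.
elim: N jN => [|N IH]; first by rewrite leqn0 => /eqP <-.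
rewrite leq_eqVlt => /predU1P[<-//|]; rewrite ltnS => /IH cN.
by rewrite /= ltNge cN.
Qed.

Lemma stopped_exp_gt0 j w : 0 < stopped_exp j w.
Proof. by elim: j => //= j IH; case: ifP => // _; rewrite mulr_gt0 ?expR_gt0. Qed.

Lemma scaled_le i w : (s <= i)%N -> `|a i * xi i w| <= a i * M.
Proof. by move=> si; rewrite normrM (ger0_norm (a_ge0 si)) ler_wpM2l ?a_ge0. Qed.

Lemma stopped_exp_bounded j : exists K, forall w, stopped_exp j w <= K.
Proof.
elim: j => [|j [K IH]]; first by exists 1.
exists (K * expR (1 / 2)) => w /=.
have sj := leq_addr j s.
have K0 : 0 < K := lt_le_trans (stopped_exp_gt0 j w) (IH w).
case: ifP => _; last first.
  by rewrite (le_trans (IH w))// ler_peMr ?(ltW K0)// -expR0 ler_expR divr_ge0.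
rewrite ler_pM ?(ltW (stopped_exp_gt0 _ _)) ?expR_ge0// ler_expR.
rewrite lerBlDr (le_trans _ (lerD (aM sj) (mulr_ge0 _ (sqr_ge0 _))))// addr0.
exact: le_trans (ler_norm _) (scaled_le _ sj).
Qed.

(** After [j] steps only noise of index below [s + j] has been used, so the process is known before
    the increment [xi (s + j)]. *)
Lemma stopped_exp_measurable j : sub_measurable (F (s + j).-1) (stopped_exp j).
Proof.
have [sF _ FS] := F_filtration.
elim: j => [|j IH].
  by apply/(sub_measurableP _ (sF _)); exact: measurable_cst.
have {}IH : sub_measurable (F (s + j)) (stopped_exp j).
  by apply: sub_measurableS IH; apply: FS; exact: leq_pred.
have mxi := xi_measurable (s + j).
move: IH mxi; rewrite addnS/= !sub_measurableP// => IH mxi.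
apply: measurable_fun_ifT => //.
  by apply: measurable_fun_ltr => //; exact: measurable_cst.
apply: measurable_funM => //; apply: measurableT_comp; first exact: measurable_expR.
apply: measurable_funB; last exact: measurable_cst.
by apply: measurable_funM => //; exact: measurable_cst.
Qed.

Let F_sub k : F k `<=` measurable.
Proof. by case: F_filtration. Qed.

Lemma stopped_exp_integrable j : P.-integrable [set: T] (EFin \o stopped_exp j).
Proof.
have [K HK] := stopped_exp_bounded j.
apply: (@bounded_integrable _ _ _ P _ K).
  exact: sub_measurableT (@F_sub _) (stopped_exp_measurable j).
by move=> w; rewrite gtr0_norm ?stopped_exp_gt0.
Qed.

Lemma stopped_exp_mean j : \int[P]_w stopped_exp j w <= 1.
Proof.
elim: j => [|j IH].
  by rewrite Rintegral_cst//= [P _](@probability_setT _ _ _ P) mulr1.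
apply: le_trans IH.
(* Stopping bounds this factor by [c], and it belongs to the past of [xi (s + j)], so orthogonality
   applies to their product. *)
pose H w := if stopped_exp j w < c then stopped_exp j w else 0.
have sj := leq_addr j s.
have [sF _ _] := F_filtration.
have mH : sub_measurable (F (s + j).-1) H.
  have := @stopped_exp_measurable j; rewrite !sub_measurableP// => mZ.
  apply: measurable_fun_ifT => //.
  by apply: measurable_fun_ltr => //; exact: measurable_cst.
have HK w : 0 <= H w <= c.
  by rewrite /H; case: ltP => [/ltW->|_]; rewrite ?(ltW (stopped_exp_gt0 _ _))// lexx ltW.
have mxi : measurable_fun [set: T] (xi (s + j)).
  exact: sub_measurableT (@F_sub _) (xi_measurable _).
have mHxi : measurable_fun [set: T] (fun w => H w * xi (s + j) w).
  by apply: measurable_funM => //; exact: sub_measurableT (@F_sub _) mH.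
have Hxi0 : \int[P]_w (H w * xi (s + j) w) = 0.
  apply: (orthogonal_bounded (@F_sub _) mH HK mxi (xi_bounded _)).
  by move=> A; apply: xi_mean0; rewrite addn_gt0 s_gt0.
have HxiK w : `|H w * xi (s + j) w| <= c * M.
  by rewrite normrM ler_pM//; have /andP[h0 hc] := HK w; rewrite ger0_norm.
pose k := expR (- (2 * (a (s + j) * M) ^+ 2)) * a (s + j).
have ik : P.-integrable [set: T] (EFin \o (fun w => k * (H w * xi (s + j) w))).
  apply: (@bounded_integrable _ _ _ P _ (`|k| * (c * M))).
    by apply: measurable_funM => //; exact: measurable_cst.
  by move=> w; rewrite normrM ler_wpM2l.
have step w : stopped_exp j.+1 w <= stopped_exp j w + k * (H w * xi (s + j) w).
  rewrite /= /H; case: ifP => _; last by rewrite mul0r mulr0 addr0.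
  rewrite mulrCA -[X in _ <= X + _]mulr1 -mulrDr ler_wpM2l ?(ltW (stopped_exp_gt0 _ _))//.
  by rewrite /k -mulrA expR_compensated_le ?scaled_le ?aM.
rewrite (@le_trans _ _ (\int[P]_w (stopped_exp j w + k * (H w * xi (s + j) w))))//.
  apply: le_Rintegral => //; first exact: stopped_exp_integrable.
  move: (integrableD measurableT (stopped_exp_integrable j) ik).
  by apply: eq_integrable => // w _; rewrite /= EFinD.
rewrite RintegralD//; last exact: stopped_exp_integrable.
rewrite RintegralZl// ?Hxi0 ?mulr0 ?addr0//.
exact: bounded_integrable mHxi HxiK.
Qed.

Lemma stopped_exp_maximal N : measurable [set w | c <= stopped_exp N w] /\
  (P [set w | (c <= stopped_exp N w)%R] <= (c^-1)%:E)%E.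
Proof.
have mZ := sub_measurableT (@F_sub _) (stopped_exp_measurable N).
have mA : measurable [set w | c <= stopped_exp N w].
  rewrite (_ : mkset _ = [set: T] `&` stopped_exp N @^-1` [set x | c <= x]).
    by apply: mZ => //; rewrite -set_itvcy; exact: measurable_itv.
  by rewrite setTI.
split => //; rewrite -[P _]fineK ?fin_num_measure//.
rewrite lee_fin -[leRHS]mul1r ler_pdivlMr// mulrC -Rintegral_cst//.
rewrite -Rintegral_indicM (le_trans _ (stopped_exp_mean N))//.
apply: le_Rintegral => //; last 2 first.
- exact: stopped_exp_integrable.
- move=> w _; rewrite indicE; have [/set_mem/= cZ|_] := boolP (w \in _); rewrite ?mul1r//.
  by rewrite mul0r; exact/ltW/stopped_exp_gt0.
apply: (@bounded_integrable _ _ _ P _ c).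
  by apply: measurable_funM; [exact: measurable_indic|exact: measurable_cst].
move=> w; rewrite normrM (gtr0_norm c_gt0) ler_piMl ?(ltW c_gt0)//.
by rewrite indicE; case: (_ \in _); rewrite ?normr1 ?normr0.
Qed.

End stopped_exponential.

(** * Borel-Cantelli over the starting indices of windows *)

Lemma measure_series_lty d (T : measurableType d) (R : realType)
    (P : {measure set T -> \bar R}) (B : nat -> set T) (t : nat -> R) :
  (forall k, 0 <= t k) -> (forall k, (P (B k) <= (t k - t k.+1)%:E)%E) ->
  (\sum_(k <oo) P (B k) < +oo)%E.
Proof.
move=> t0 PB; apply: (@le_lt_trans _ _ (t 0%N)%:E); last exact: ltry.
apply: lime_le; first by apply: is_cvg_nneseries => k _ _; exact: measure_ge0.
apply: nearW => n; rewrite (@le_trans _ _ (\sum_(0 <= k < n) (t k - t k.+1)%:E)%E)//.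
  by apply: lee_sum => k _; exact: PB.
rewrite sumEFin lee_fin; under eq_bigr do rewrite -opprB.
by rewrite sumrN telescope_sumr// opprB gerBl.
Qed.

Lemma borel_cantelli_ae d (T : measurableType d) (R : realType)
    (P : {measure set T -> \bar R}) (B : nat -> set T) :
  (forall k, measurable (B k)) -> (\sum_(k <oo) P (B k) < +oo)%E ->
  {ae P, forall w, \forall k \near \oo, ~ B k w}.
Proof.
move=> mB PB.
have ms : measurable (lim_sup_set B).
  by apply: bigcap_measurable => // n _; apply: bigcup_measurable => k _; exact: mB.
have : P.-negligible (lim_sup_set B).
  by apply/negligibleP => //; exact: lim_sup_set_cvg0.
apply: negligibleS => w /= nw N _; apply: contrapT => nB; apply: nw.
by exists N => // k /= Nk Bk; apply: nB; exists k.
Qed.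

Section noise.
Context {d : measure_display} {T : measurableType d} {R : realType}.
Variables (P : probability T R) (F : nat -> set (set T)) (M : R).
Variables (eta theta : nat -> R).
Hypotheses (F_filtration : filtration F) (M_gt0 : 0 < M)
  (eta_gt0 : forall k, 0 < eta k) (theta_gt0 : forall k, 0 < theta k)
  (eta_sum : series eta @ \oo --> +oo)
  (eta_log : eta k * ln k%:R @[k --> \oo] --> 0)
  (theta_log : theta k ^+ 2 / eta k * ln k%:R @[k --> \oo] --> 0).

(* The exponent used on the window starting at [s] is [3 / r * ln s]: an excess over
   [r] makes the exponential at least [s ^ 2], and the resulting bound [s ^ - 2] is
   summable. *)
Lemma near_good_start (r : R) : 0 < r -> \forall s \near \oo,
  [/\ (2 <= s)%N, 1 <= ln (s%:R : R),
    forall i, (s <= i)%N -> 3 / r * ln s%:R * theta i * M <= 1 / 2 &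
    forall i, (s <= i)%N -> 2 * (3 / r * ln s%:R * theta i * M) ^+ 2 <= ln s%:R * eta i].
Proof.
move=> r0.
(* The two thresholds are solved from the conclusions: 3 M / r times r / (6 M) is 1 / 2, and 2 (3 M
   / r)^2 times r^2 / (18 M^2) is 1. *)
have q0 : 0 < r / (6 * M) by rewrite divr_gt0// mulr_gt0.
have u0 : 0 < r ^+ 2 / (18 * M ^+ 2) by rewrite divr_gt0 ?mulr_gt0 ?exprn_gt0.
have [N1 _ H1] := cvgr_le _ eta_log _ q0.
have [N2 _ H2] := cvgr_le _ theta_log _ q0.
have [N3 _ H3] := cvgr_le _ theta_log _ u0.
have [N4 _ H4] := near_ln_ge1 R.
exists (maxn 2 (maxn (maxn N1 N2) (maxn N3 N4))) => // s /=.
rewrite !geq_max => /and3P[s2 /andP[s1 s2'] /andP[s3 s4]].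
have ls : 1 <= ln (s%:R : R) by exact: H4.
have ls0 : 0 < ln (s%:R : R) by exact: lt_le_trans ls.
have lsi i : (s <= i)%N -> ln (s%:R : R) <= ln i%:R.
  move=> si; rewrite ler_ln ?posrE ?ltr0n ?ler_nat//; first exact: ltn_trans s2.
  by apply: leq_trans si; exact: ltn_trans s2.
split => // i si.
- have e1 : eta i * ln i%:R <= r / (6 * M) by apply: H1; exact: leq_trans s1 si.
  have e2 : theta i ^+ 2 / eta i * ln i%:R <= r / (6 * M).
    by apply: H2; exact: leq_trans s2' si.
  (* The square of theta_i ln i is the product of the quantities in the two stepsize conditions, and
     each of them is small. *)
  have lti : theta i * ln s%:R <= r / (6 * M).
    rewrite -(@ler_pXn2r _ 2)// ?nnegrE ?(ltW q0) ?mulr_ge0 ?(ltW (theta_gt0 _)) ?(ltW ls0)//.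
    rewrite (@le_trans _ _ ((theta i ^+ 2 / eta i * ln i%:R) * (eta i * ln i%:R)))//.
      rewrite [leRHS](_ : _ = (theta i * ln i%:R) ^+ 2).
        have li0 : 0 <= ln (i%:R : R) by rewrite (le_trans (ltW ls0))// lsi.
        rewrite ler_pXn2r ?nnegrE ?mulr_ge0 ?(ltW (theta_gt0 _)) ?(ltW ls0)//.
        by rewrite ler_wpM2l ?lsi// ltW.
      by field; rewrite gt_eqF.
    have li : 0 <= ln (i%:R : R) by rewrite (le_trans (ltW ls0))// lsi.
    rewrite [leRHS]expr2; have [ei ti] := (ltW (eta_gt0 i), ltW (theta_gt0 i)).
    by apply: ler_pM => //; apply: mulr_ge0 => //; apply: divr_ge0 => //; exact: sqr_ge0.
  rewrite [leLHS](_ : _ = 3 * M / r * (theta i * ln s%:R)); last by ring.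
  rewrite (le_trans (ler_wpM2l _ lti))//; first by rewrite divr_ge0 ?mulr_ge0 ?ltW.
  by rewrite le_eqVlt; apply/orP; left; apply/eqP; field; rewrite !gt_eqF.
have e3 : theta i ^+ 2 / eta i * ln i%:R <= r ^+ 2 / (18 * M ^+ 2).
  by apply: H3; exact: leq_trans s3 si.
have e3' : theta i ^+ 2 * ln s%:R <= r ^+ 2 / (18 * M ^+ 2) * eta i.
  rewrite -ler_pdivrMr// mulrAC (le_trans _ e3)// ler_wpM2l ?lsi//.
  by rewrite divr_ge0 ?sqr_ge0// ltW.
rewrite [leLHS](_ : _ = ln s%:R * (18 * M ^+ 2 / r ^+ 2 * (theta i ^+ 2 * ln s%:R))); last first.
  by field; rewrite gt_eqF.
rewrite ler_pM2l// (le_trans (ler_wpM2l _ e3'))//.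
  by apply: divr_ge0; [apply: mulr_ge0 => //|]; exact: sqr_ge0.
by rewrite le_eqVlt; apply/orP; left; apply/eqP; field; rewrite !gt_eqF.
Qed.

Lemma noise_upper (xi : nat -> T -> R) (r : R) :
  (forall k, sub_measurable (F k) (xi k)) -> (forall k w, `|xi k w| <= M) ->
  (forall k, (1 <= k)%N -> forall A, F k.-1 A -> \int[P]_(w in A) xi k w = 0) ->
  0 < r ->
  {ae P, forall w, \forall s \near \oo, forall b, (s <= b)%N -> elapsed eta s b <= 1 ->
    \sum_(s <= i < b) theta i * xi i w <= r}.
Proof.
move=> mxi xiM xi0 r0.
have [s0 _ good] := near_good_start r0.
have [idx idxP] := elapsed_indexE eta_sum.
pose a s i := 3 / r * ln s%:R * theta i.
pose c s : R := s%:R ^+ 2.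
(* Every window from [s] of duration at most 1 ends by [idx s 1], so this single event covers all of
   them. *)
pose E s := [set w | c s <= stopped_exp xi M (a s) (c s) s (idx s 1 - s) w].
pose B s := if (s0 <= s)%N then E s else set0.
have PE s : (s0 <= s)%N -> measurable (E s) /\ (P (E s) <= ((c s)^-1)%:E)%E.
  move=> ss; have [s2 l1 aM _] := good s ss.
  have l0 : 0 <= ln (s%:R : R) by exact: le_trans l1.
  apply: (stopped_exp_maximal F_filtration mxi xiM xi0) => //.
  - move=> i _; apply: mulr_ge0; last exact: ltW.
    by apply: mulr_ge0 => //; apply: divr_ge0 => //; exact: ltW.
  - by rewrite exprn_gt0// ltr0n; exact: ltn_trans s2.
  - exact: ltn_trans s2.
have mB s : measurable (B s).
  by rewrite /B; case: ifP => [/PE[]|//].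
(* A telescoping majorant: the difference is 4 / ((s + 1) (s + 2)), which is at least 1 / s^2 for s
   >= 2. *)
have PB s : (P (B s) <= (4 / s.+1%:R - 4 / s.+2%:R)%:E)%E.
  rewrite /B; case: ifPn => [ss|_]; last first.
    rewrite measure0 lee_fin subr_ge0 ler_pM2l// lef_pV2 ?posrE//.
    by rewrite ler_nat.
  have [_ /le_trans] := PE s ss; apply.
  have [s2 _ _ _] := good s ss.
  have s2R : 2 <= s%:R :> R by rewrite ler_nat.
  rewrite lee_fin /c -natr1 -[s.+2%:R]natr1 -[s.+1%:R]natr1.
  set x := s%:R in s2R *.
  rewrite [leRHS](_ : _ = 4 / ((x + 1) * (x + 2))); last by field; apply/andP; split; lra.
  have x0 : 0 < x by lra.
  have y0 : 0 < (x + 1) * (x + 2) by apply: mulr_gt0; lra.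
  rewrite ler_pdivlMr// mulrC ler_pdivrMr ?exprn_gt0//.
  nra.
have BC := borel_cantelli_ae mB (measure_series_lty (fun k => _) PB).
apply: filterS (BC _) => [w|k]; last by rewrite divr_ge0.
move=> [s1 _ Bs1]; exists (maxn s0 s1) => // s /=; rewrite geq_max => /andP[ss0 ss1] b sb eb.
have [s2 l1 aM ae] := good s ss0.
rewrite leNgt; apply/negP => rS.
apply: (Bs1 s ss1); rewrite /B ss0 /E/=.
have [si i1 i2] := idxP s 1 ler01.
have bi : (b <= idx s 1%R)%N.
  rewrite leqNgt; apply/negP => ib.
  have i3 := elapsed_le eta_gt0 (leqW si) ib.
  by move: (lt_le_trans i2 i3); rewrite ltNge eb.
apply: (@stopped_exp_hit _ _ _ _ _ _ _ _ (b - s)%N); first exact: leq_sub2r.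
rewrite subnKC//.
have s0' : 0 < s%:R :> R by rewrite ltr0n; exact: ltn_trans s2.
(* On a logarithmic scale the level is [2 * ln s%:R]: the noise contributes at least three times
   [ln s%:R], and the compensators take away at most one. *)
rewrite /c -[s%:R]lnK ?posrE// -expRM_natl ler_expR.
rewrite /compensated sumrB.
have -> : \sum_(s <= i < b) a s i * xi i w = 3 / r * ln s%:R * \sum_(s <= i < b) theta i * xi i w.
  by rewrite mulr_sumr; apply: eq_bigr => i _; rewrite /a !mulrA.
have ls0 : 0 < ln (s%:R : R) by exact: lt_le_trans l1.
have h1 : 3 * ln s%:R <= 3 / r * ln s%:R * \sum_(s <= i < b) theta i * xi i w.
  rewrite [leLHS](_ : _ = 3 / r * ln s%:R * r); last by field; rewrite gt_eqF.
  by rewrite ler_wpM2l ?(ltW rS)// mulr_ge0 ?divr_ge0 ?(ltW r0) ?(ltW ls0).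
have h2 : \sum_(s <= i < b) 2 * (a s i * M) ^+ 2 <= ln s%:R.
  rewrite (@le_trans _ _ (ln s%:R * elapsed eta s b))//; last by rewrite ler_piMr// ltW.
  rewrite /elapsed mulr_sumr big_nat_cond [leRHS]big_nat_cond; apply: ler_sum => i.
  by rewrite andbT => /andP[/ae].
rewrite (le_trans _ (lerB h1 h2))//.
by rewrite [leRHS](_ : _ = 2 * ln s%:R)//; ring.
Qed.

(** The one-sided bound is used for [xi] and for its opposite, with the countably many thresholds
    [p.+1%:R^-1], so that one null set serves every [e]. *)
Lemma noise_bounded (xi : nat -> T -> R) :
  (forall k, sub_measurable (F k) (xi k)) -> (forall k w, `|xi k w| <= M) ->
  (forall k, (1 <= k)%N -> forall A, F k.-1 A -> \int[P]_(w in A) xi k w = 0) ->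
  {ae P, forall w, forall e : R, 0 < e -> \forall s \near \oo, forall b, (s <= b)%N ->
    elapsed eta s b <= 1 -> `|\sum_(s <= i < b) theta i * xi i w| <= e}.
Proof.
move=> mxi xiM xi0.
have [sF Fm _] := F_filtration.
have mxiN k : sub_measurable (F k) (fun w => - xi k w).
  move: (mxi k); rewrite !sub_measurableP// => mk.
  by apply: measurableT_comp => //; exact: measurable_oppr.
have xiNM k w : `|- xi k w| <= M by rewrite normrN.
have xiN0 k : (1 <= k)%N -> forall A, F k.-1 A -> \int[P]_(w in A) - xi k w = 0.
  move=> k1 A FA; under eq_Rintegral do rewrite -mulN1r.
  rewrite RintegralZl ?xi0 ?mulr0//; first exact: Fm FA.
  apply: (integrableS measurableT) => //; first exact: Fm FA.
  by apply: (bounded_integrable P _ (xiM k)); apply: sub_measurableT (mxi k); exact: Fm.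
have H (p : nat) : {ae P, forall w, \forall s \near \oo, forall b, (s <= b)%N ->
    elapsed eta s b <= 1 -> `|\sum_(s <= i < b) theta i * xi i w| <= p.+1%:R^-1}.
  have p0 : 0 < p.+1%:R^-1 :> R by rewrite invr_gt0.
  apply: filterS2 (noise_upper mxi xiM xi0 p0) (noise_upper mxiN xiNM xiN0 p0) => w H1 H2.
  apply: filterS2 H1 H2 => s H1 H2 b sb eb; rewrite ler_norml H1// andbT lerNl.
  by rewrite -sumrN (le_trans _ (H2 b sb eb))// ler_sum// => i _; rewrite mulrN.
apply: filterS (ae_foralln H) => w Hw e e0.
have := Hw (Num.truncn e^-1); apply: filterS => s Hs b sb eb.
rewrite (le_trans (Hs b sb eb))// -[leRHS]invrK lef_pV2 ?posrE ?invr_gt0//.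
exact/ltW/truncnS_gt.
Qed.

(** The bound on the noise holds only almost surely. Truncation at [- M] and [M] makes it hold
    everywhere, preserves adaptedness, and changes the variables only on a null set, hence no
    integral. *)
Lemma noise_ae (xi : nat -> T -> R) :
  (forall k, sub_measurable (F k) (xi k)) ->
  {ae P, forall w, forall k, `|xi k w| <= M} ->
  (forall k, (1 <= k)%N -> is_cond_exp P (F k.-1) (xi k) (fun=> 0)) ->
  {ae P, forall w, forall e : R, 0 < e -> \forall s \near \oo, forall b, (s <= b)%N ->
    elapsed eta s b <= 1 -> `|\sum_(s <= i < b) theta i * xi i w| <= e}.
Proof.
move=> mxi xiM xi0.
have [sF Fm _] := F_filtration.
pose xi' k w := Num.max (- M) (Num.min M (xi k w)).
have xi'E : {ae P, forall w, forall k, xi' k w = xi k w}.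
  apply: filterS xiM => w + k => /(_ k); rewrite ler_norml => /andP[l u].
  by rewrite /xi' (min_idPr u) (max_idPr l).
have mxi' k : sub_measurable (F k) (xi' k).
  move: (mxi k); rewrite !sub_measurableP// => mk.
  apply: measurable_maxr; first exact: measurable_cst.
  by apply: measurable_minr => //; exact: measurable_cst.
have xi'M k w : `|xi' k w| <= M.
  have MM : - M <= M by rewrite (@le_trans _ _ 0)// ?oppr_le0 ltW.
  by rewrite ler_norml /xi' le_max lexx/= ge_max ge_min lexx MM.
have xi'0 k : (1 <= k)%N -> forall A, F k.-1 A -> \int[P]_(w in A) xi' k w = 0.
  move=> k1 A FA; have [_ _ _ /(_ A FA) I0] := xi0 k k1.
  rewrite /Rintegral (_ : integral _ _ _ = 0%E)//.
  rewrite -[RHS](integral0 P A) I0; apply: ae_eq_integral.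
  - exact: Fm FA.
  - apply: measurable_funTS; apply/measurable_EFinP.
    by apply: sub_measurableT (mxi' k); exact: Fm.
  - apply: measurable_funTS; apply/measurable_EFinP.
    by apply: sub_measurableT (mxi k); exact: Fm.
  by apply: filterS xi'E => w /(_ k) ->.
apply: filterS2 xi'E (noise_bounded mxi' xi'M xi'0) => w wE Hw e e0.
apply: filterS (Hw e e0) => s Hs b sb eb.
by under eq_bigr do rewrite -wE; exact: Hs.
Qed.

End noise.

(** * Vector-valued noise and the almost sure conclusion *)

Lemma triple_noise_ae (R : realType) (n : nat) (d : measure_display)
    (T : measurableType d) (P : probability T R) (xi : nat -> T -> triple R n)
    (F : nat -> set (set T)) (eta theta : nat -> R) :
  filtration F -> martingale_difference P F xi ->
  (exists M : R, {ae P, forall w, forall k, enorm3 (xi k w) <= M}) ->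
  (forall k, 0 < eta k) -> (forall k, 0 < theta k) -> series eta @ \oo --> +oo ->
  eta k * ln k%:R @[k --> \oo] --> 0 ->
  theta k ^+ 2 / eta k * ln k%:R @[k --> \oo] --> 0 ->
  {ae P, forall w, forall e : R, 0 < e -> \forall s \near \oo, forall b, (s <= b)%N ->
    elapsed eta s b <= 1 -> `|\sum_(s <= i < b) theta i *: xi i w| <= e}.
Proof.
move=> F_filtration [mxi xi0] [M0 xiM0] eta0 theta0 eta_sum eta_log theta_log.
pose M := `|M0| + 1; have M_gt0 : 0 < M by rewrite ltr_wpDl.
have xiM : {ae P, forall w, forall k, `|xi k w| <= M}.
  apply: filterS xiM0 => w + k => /(_ k) xk.
  by rewrite (le_trans (ler_norm_enorm3 _))// (le_trans xk)// (le_trans (ler_norm _))// lerDl.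
pose small (X : nat -> T -> R) w := forall e : R, 0 < e -> \forall s \near \oo,
  forall b, (s <= b)%N -> elapsed eta s b <= 1 -> `|\sum_(s <= i < b) theta i * X i w| <= e.
have H1 : {ae P, forall w, forall j, small (fun k w => (xi k w).1.1 0 j) w}.
  apply: ae_forall_ord => j; apply: (noise_ae F_filtration M_gt0) => //.
  - by move=> k; have [m1 _ _] := mxi k; exact: m1.
  - apply: filterS xiM => w + k => /(_ k); apply: le_trans.
    by rewrite (le_trans (ler_coord_norm _ _))//; have [] := ler_norm_triple (xi k w).
  - by move=> k k1; have [c1 _ _] := xi0 k k1; exact: c1.
have H2 : {ae P, forall w, forall j, small (fun k w => (xi k w).1.2 0 j) w}.
  apply: ae_forall_ord => j; apply: (noise_ae F_filtration M_gt0) => //.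
  - by move=> k; have [_ m2 _] := mxi k; exact: m2.
  - apply: filterS xiM => w + k => /(_ k); apply: le_trans.
    by rewrite (le_trans (ler_coord_norm _ _))//; have [] := ler_norm_triple (xi k w).
  - by move=> k k1; have [_ c2 _] := xi0 k k1; exact: c2.
have H3 : {ae P, forall w, forall j, small (fun k w => (xi k w).2 0 j) w}.
  apply: ae_forall_ord => j; apply: (noise_ae F_filtration M_gt0) => //.
  - by move=> k; have [_ _ m3] := mxi k; exact: m3.
  - apply: filterS xiM => w + k => /(_ k); apply: le_trans.
    by rewrite (le_trans (ler_coord_norm _ _))//; have [] := ler_norm_triple (xi k w).
  - by move=> k k1; have [_ _ c3] := xi0 k k1; exact: c3.
apply: filterS3 H1 H2 H3 => w H1 H2 H3 e e0.
have allj (X : 'I_n -> nat -> T -> R) : (forall j, small (X j) w) ->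
    \forall s \near \oo, forall j b, (s <= b)%N -> elapsed eta s b <= 1 ->
    `|\sum_(s <= i < b) theta i * X j i w| <= e.
  by move=> HX; apply: filter_forall => j; exact: HX.
apply: filterS3 (allj _ H1) (allj _ H2) (allj _ H3) => s {}H1 {}H2 {}H3 b sb eb.
rewrite triple_norm_le; apply/and3P; split; apply: rV_norm_le => [|j]; rewrite ?(ltW e0)//.
- rewrite (big_morph (fun p : triple R n => p.1.1 0 j) (id1 := 0) (op1 := +%R)).
  + by under eq_bigr do rewrite mxE; exact: H1.
  + by move=> p q; rewrite mxE.
  + by rewrite mxE.
- rewrite (big_morph (fun p : triple R n => p.1.2 0 j) (id1 := 0) (op1 := +%R)).
  + by under eq_bigr do rewrite mxE; exact: H2.
  + by move=> p q; rewrite mxE.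
  + by rewrite mxE.
- rewrite (big_morph (fun p : triple R n => p.2 0 j) (id1 := 0) (op1 := +%R)).
  + by under eq_bigr do rewrite mxE; exact: H3.
  + by move=> p q; rewrite mxE.
  + by rewrite mxE.
Qed.

Theorem theorem1 (R : realType) (n : nat)
    (f : 'rV[R]_n -> R) (Df : 'rV[R]_n -> set 'rV[R]_n)
    (f_lip : locally_lipschitz f)
    (f_lb : has_lbound (range f))
    (Df_compact : forall x, compact (Df x))
    (Df_convex : forall x, convex_set (Df x))
    (Df_closed : closed_graph Df)
    (Df_conservative : conservative_field Df)
    (f_potential : is_potential f Df)
    (f_crit : (f @` [set x | Df x 0])^° = set0)
    (d : measure_display) (T : measurableType d) (P : probability T R)
    (x m v : nat -> T -> 'rV[R]_n)
    (dk xi : nat -> T -> triple R n)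
    (eta theta : nat -> R)
    (z_random : forall k, [/\ vmeasurable measurable (x k),
                              vmeasurable measurable (m k)
                            & vmeasurable measurable (v k)])
    (z_rec : {ae P, forall w, forall k,
       (x k.+1 w, m k.+1 w, v k.+1 w) =
       (x k w, m k w, v k w) - eta k *: dk k w - theta k *: xi k w})
    (alpha gamma epsilon tau1 tau2 : R)
    (alpha_ge0 : 0 <= alpha) (gamma_ge0 : 0 <= gamma)
    (epsilon_gt0 : 0 < epsilon) (tau1_gt0 : 0 < tau1) (tau2_gt0 : 0 < tau2)
    (z_bounded : {ae P, forall w,
       has_ubound (range (fun k => enorm (x k w) + enorm (m k w) + enorm (v k w)))})
    (U : triple R n -> set 'rV[R]_n) (kappa : R)
    (U_locbounded : locally_bounded U)
    (U_convex : forall z, convex_set (U z))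
    (U_compact : forall z, compact (U z))
    (U_closed : closed_graph U)
    (kappa_ge0 : 0 <= kappa)
    (U_sign : forall x0 m0 v0 u, U (x0, m0, v0) u -> forall i : 'I_n,
       0 <= kappa * `|v0 0 i| <= Num.sg (v0 0 i) * u 0 i)
    (delta : nat -> R)
    (delta_gt0 : forall k, 0 < delta k)
    (delta_cvg : delta k @[k --> \oo] --> 0)
    (d_in : {ae P, forall w, forall k,
       expansion enorm3 (adam_map alpha gamma epsilon tau1 tau2 Df U) (delta k)
         (x k w, m k w, v k w) (dk k w)})
    (F : nat -> set (set T))
    (F_filtration : filtration F)
    (xi_mds : martingale_difference P F xi)
    (xi_bounded : exists M : R, {ae P, forall w, forall k, enorm3 (xi k w) <= M})
    (eta_gt0 : forall k, 0 < eta k) (theta_gt0 : forall k, 0 < theta k)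
    (eta_sum : series eta @ \oo --> +oo)
    (theta_sum : series theta @ \oo --> +oo)
    (eta_log : eta k * ln k%:R @[k --> \oo] --> 0)
    (theta_log : theta k ^+ 2 / eta k * ln k%:R @[k --> \oo] --> 0)
    (kappa_cond : (1 - kappa) * gamma * tau2 <= 2 * tau1) :
  {ae P, forall w,
     cluster (x k w @[k --> \oo]) `<=` [set p | Df p 0] /\
     cvg (f (x k w) @[k --> \oo])}.
Proof.
have D_nonempty p : Df p !=set0 by have [_ /(_ p)[]] := Df_conservative.
have noise := triple_noise_ae F_filtration xi_mds xi_bounded eta_gt0 theta_gt0 eta_sum
  eta_log theta_log.
(* All randomness is confined to an intersection of almost sure events, on which the deterministic
   result applies to each path separately. *)
apply: filterS3 z_rec z_bounded (filterI d_in noise) => w rec bd [din nz].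
exact: (adam_deterministic f_lip f_potential Df_closed Df_compact Df_convex D_nonempty
  f_crit U_locbounded U_convex U_closed U_sign alpha_ge0 gamma_ge0 epsilon_gt0 tau1_gt0
  tau2_gt0 kappa_cond rec bd delta_gt0 delta_cvg din eta_gt0 eta_sum eta_log nz).
Qed.
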